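(* Let $n\ge1$, $p\in[1,\infty)$ and $s\in(0,1)$, let $\Omega\subset\mathbb{R}^n$ be measurable with finite measure, and let $K\subset\mathbb{R}^n$ be compact. Then: 1. If $sp<n$, then $W^{s,p}(\mathbb{R}^n)$ is compactly embedded in $L^q(\Omega)$ for every $1\le q<p^\star(n,s):=\frac{np}{n-sp}$. 2. If $sp=n$, then $W^{s,p}(\mathbb{R}^n)$ is compactly embedded in $L^q(\Omega)$ for every $1\le q<\infty$. 3. If $sp>n$, then $W^{s,p}(\mathbb{R}^n)$ is compactly embedded in $C^\beta(K)$ for every $0\le\beta<s-\frac{n}{p}$. Furthermore, if $\Omega$ is a bounded domain with Lipschitz boundary, then 4. If $0\le t<s$, then $W^{s,p}(\mathbb{R}^n)$ is compactly embedded in $W^{t,p}(\Omega)$.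
   Context: For $s\in(0,1)$ and $p\in[1,\infty)$, $$[u]_{W^{s,p}(\mathbb{R}^n)}=\left(s(1-s)\int_{\mathbb{R}^n}\int_{\mathbb{R}^n}\frac{|u(x)-u(y)|^p}{|x-y|^{n+sp}}\,dx\,dy\right)^{1/p},$$ $W^{s,p}(\mathbb{R}^n)=\{u\in L^p(\mathbb{R}^n):[u]_{W^{s,p}(\mathbb{R}^n)}<+\infty\}$, with norm $\|u\|_{W^{s,p}(\mathbb{R}^n)}=\|u\|_{L^p(\mathbb{R}^n)}+[u]_{W^{s,p}(\mathbb{R}^n)}$. For $t\in(0,1)$, $W^{t,p}(\Omega)$ is defined in the same way with $\mathbb{R}^n$ replaced by $\Omega$ (double integral over $\Omega\times\Omega$), and $W^{0,p}(\Omega)=L^p(\Omega)$. $C^\beta(K)$ is the Hölder space of exponent $\beta$ on $K$ with its usual norm ($C^0(K)=C(K)$ with the sup norm). ''$W^{s,p}(\mathbb{R}^n)$ is compactly embedded in $Y$'', where $Y$ is a space of functions on $\Omega$ (or $K$), means that the restriction map $u\mapsto u|_\Omega$ (respectively $u\mapsto u|_K$, taking the continuous representative of $u$) is a compact linear operator from $W^{s,p}(\mathbb{R}^n)$ to $Y$, i.e. it maps bounded sets to relatively compact sets. *)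

(* Defs.v *)
From HB Require Import structures.
From mathcomp Require Import all_boot all_order all_algebra.
From mathcomp Require Import all_classical all_reals all_analysis.

Set Implicit Arguments.
Unset Strict Implicit.
Unset Printing Implicit Defensive.

Import Order.TTheory GRing.Theory Num.Theory.
Import numFieldNormedType.Exports.

Local Open Scope classical_set_scope.
Local Open Scope ring_scope.

(* The Borel sigma-algebra on R^n, as the product sigma-algebra. *)

Section borel_rV.
Variables (R : realType) (n : nat).

Definition rV_coord (i : 'I_n) (x : 'rV[R]_n) : measurableTypeR R := x ord0 i.

Let rV_set0 : g_sigma_preimage rV_coord set0.
Proof. exact: sigma_algebra0. Qed.

Let rV_setC A : g_sigma_preimage rV_coord A ->
  g_sigma_preimage rV_coord (~` A).
Proof. exact: sigma_algebraC. Qed.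

Let rV_bigcup (F : (set 'rV[R]_n)^nat) :
  (forall i, g_sigma_preimage rV_coord (F i)) ->
  g_sigma_preimage rV_coord (\bigcup_i (F i)).
Proof. exact: sigma_algebra_bigcup. Qed.

HB.instance Definition _ := @isMeasurable.Build default_measure_display
  'rV[R]_n (g_sigma_preimage rV_coord) rV_set0 rV_setC rV_bigcup.

Lemma measurable_rV_coord (i : 'I_n) : measurable_fun setT (rV_coord i).
Proof.
move=> _ Y mY; rewrite setTI; apply: sub_sigma_algebra => /=.
rewrite -bigcup_seq/=; exists i => /=; first by rewrite mem_index_enum.
by exists Y => //; rewrite setTI.
Qed.

Lemma measurable_fun_rVP d (T : measurableType d) (f : T -> 'rV[R]_n) :
  (forall i, measurable_fun setT (rV_coord i \o f)) -> measurable_fun setT f.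
Proof.
move=> mf _ Y mY; rewrite setTI.
suff : g_sigma_preimage rV_coord `<=` [set A | measurable (f @^-1` A)] by exact.
apply: smallest_sub.
  split => /=.
  - by rewrite preimage_set0.
  - by move=> A mA; rewrite setTD preimage_setC; exact: measurableC.
  - by move=> F mF; rewrite preimage_bigcup; exact: bigcup_measurable.
move=> A; rewrite -bigcup_seq => -[i _ [B mB <-]] /=.
by rewrite setTI -comp_preimage -[X in measurable X]setTI; exact: mf.
Qed.

End borel_rV.

(* Lebesgue measure on the Borel sets of R^n, as an iterated product: 'rV_n.+1
   is identified with R * 'rV_n through (a, v) |-> row_mx a v. *)

Section lebesgue_rV_step.
Variables (R : realType) (n : nat).

Definition rV_cons (z : measurableTypeR R * 'rV[R]_n) : 'rV[R]_n.+1 :=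
  row_mx (z.1)%:M z.2.

Definition rV_uncons (x : 'rV[R]_n.+1) : measurableTypeR R * 'rV[R]_n :=
  (x ord0 ord0, \row_j x ord0 (lift ord0 j)).

Lemma rV_consK : cancel rV_cons rV_uncons.
Proof.
move=> [a v]; rewrite /rV_uncons /rV_cons /=; congr pair.
  have -> : ord0 = lshift n (ord0 : 'I_1) :> 'I_(1 + n) by exact/val_inj.
  by rewrite (row_mxEl (a%:M : 'rV_1) v) mxE eqxx mulr1n.
apply/rowP => j; rewrite mxE.
have -> : lift ord0 j = rshift 1 j :> 'I_(1 + n) by exact/val_inj.
by rewrite (row_mxEr (a%:M : 'rV_1) v).
Qed.

Lemma measurable_rV_cons : measurable_fun setT rV_cons.
Proof.
apply: measurable_fun_rVP => i.
have [j ->|j ->] := split_ordP (i : 'I_(1 + n)).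
- rewrite (_ : _ \o _ = fst); first exact: measurable_fst.
  apply/funext => -[a v] /=; rewrite /rV_coord /rV_cons /=.
  by rewrite (row_mxEl (a%:M : 'rV_1) v) mxE !ord1 mulr1n.
- rewrite (_ : _ \o _ = @rV_coord R n j \o snd).
    by apply: measurableT_comp;
      [exact: measurable_rV_coord | exact: measurable_snd].
  by apply/funext => -[a v] /=; rewrite /rV_coord /rV_cons /= (row_mxEr (a%:M : 'rV_1) v).
Qed.

Lemma measurable_rV_uncons : measurable_fun setT rV_uncons.
Proof.
apply/measurable_fun_pairP; split.
- exact: (@measurable_rV_coord R n.+1 ord0).
- apply: measurable_fun_rVP => i.
  rewrite (_ : _ \o _ = @rV_coord R n.+1 (lift ord0 i)).
    exact: measurable_rV_coord.
  by apply/funext => x; rewrite /rV_coord /= mxE.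
Qed.

Variable mu : {sigma_finite_measure set 'rV[R]_n -> \bar R}.

Definition lebesgue_rV_step : set 'rV[R]_n.+1 -> \bar R :=
  pushforward (@lebesgue_measure R \x mu)%E rV_cons.

Let step0 : lebesgue_rV_step set0 = 0%E.
Proof. by rewrite /lebesgue_rV_step /pushforward preimage_set0 measure0. Qed.

Let step_ge0 A : (0 <= lebesgue_rV_step A)%E.
Proof. exact: (measure_ge0 (@lebesgue_measure R \x mu)%E). Qed.

Let step_sigma_additive : semi_sigma_additive lebesgue_rV_step.
Proof.
move=> F mF tF mUF.
exact: (@measure_semi_sigma_additive _ _ _
  (measure_function_pushforward__canonical__measure_function_Measure
    [the measure _ _ of (@lebesgue_measure R \x mu)%E] measurable_rV_cons)).
Qed.

HB.instance Definition _ := isMeasure.Build _ _ _ lebesgue_rV_step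
  step0 step_ge0 step_sigma_additive.

Let step_sigma_finite : sigma_finite setT lebesgue_rV_step.
Proof.
have /sigma_finiteP[F [TF ndF Foo]] := sigma_finiteT (@lebesgue_measure R).
have /sigma_finiteP[G [TG ndG Goo]] := sigma_finiteT mu.
exists (fun k => rV_uncons @^-1` (F k `*` G k)).
  rewrite -preimage_bigcup [X in _ @^-1` X](_ : _ = setT) ?preimage_setT//.
  apply/seteqP; split => // -[x y] _.
  have [k _ Fkx] : (\bigcup_k F k) x by rewrite -TF.
  have [l _ Gly] : (\bigcup_k G k) y by rewrite -TG.
  exists (maxn k l) => //; split.
  - by move: x Fkx; exact/subsetPset/ndF/leq_maxl.
  - by move: y Gly; exact/subsetPset/ndG/leq_maxr.
move=> k; have [mF Fk] := Foo k; have [mG Gk] := Goo k; split.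
  by rewrite -[X in measurable X]setTI; apply: measurable_rV_uncons => //;
     exact: measurableX.
rewrite /lebesgue_rV_step /pushforward -comp_preimage.
rewrite [X in X @^-1` _](_ : _ = id); last first.
  by apply/funext => z; exact: rV_consK.
by rewrite preimage_id product_measure1E// lte_mul_pinfty// ge0_fin_numE.
Qed.

HB.instance Definition _ := Measure_isSigmaFinite.Build _ _ _ lebesgue_rV_step
  step_sigma_finite.

End lebesgue_rV_step.

Fixpoint borel_lebesgue (R : realType) (n : nat) :
    {sigma_finite_measure set 'rV[R]_n -> \bar R} :=
  match n with
  | 0 => [the sigma_finite_measure _ _ of @dirac _ 'rV[R]_0 0 R]
  | m.+1 => [the sigma_finite_measure _ _ of
               lebesgue_rV_step (borel_lebesgue R m)]
  end.

(* [Rn R n] is 'rV[R]_n with the sigma-algebra of Lebesgue (as opposed to Borel)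
   measurable sets, and [leb] is the Lebesgue measure, which is complete. *)
Definition Rn (R : realType) (n : nat) : measurableType _ :=
  caratheodory_type ((borel_lebesgue R n)^*)%mu.

Definition leb (R : realType) (n : nat) : {measure set (Rn R n) -> \bar R} :=
  [the measure _ _ of
    @completed_measure_extension _ _ R (borel_lebesgue R n)].

(* The norm of the library on 'rV[R]_n is the sup norm: it is used below for
   topological notions only. *)
Definition dotp (R : realType) (n : nat) (x y : 'rV[R]_n) : R :=
  \sum_(i < n) x ord0 i * y ord0 i.

Definition enorm (R : realType) (n : nat) (x : 'rV[R]_n) : R :=
  Num.sqrt (dotp x x).

(* A space of real functions, with a norm that may be a mere seminorm on
   functions, those at distance 0 from each other being topologically
   indistinguishable. A function on a subset E of U is represented by its
   extension by 0 to U, and the restriction of f to E is therefore f \_ E. *)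
Record normed_fspace (U : Type) (R : realType) := NormedFspace {
  fcarrier : set (U -> R) ;
  fnorm : (U -> R) -> \bar R }.

Section fspace_topology.
Variables (U : Type) (R : realType) (X : normed_fspace U R).

Definition fpoint : Type := {f : U -> R | fcarrier X f}.

Definition fball (f : fpoint) (e : R) : set fpoint :=
  [set g | (fnorm X (sval g \- sval f)%R < e%:E)%E].

HB.instance Definition _ := gen_eqMixin fpoint.
HB.instance Definition _ := gen_choiceMixin fpoint.
HB.instance Definition _ := isSubBaseTopological.Build fpoint
  [set B | exists f e, 0 < e /\ B = fball f e] id.

End fspace_topology.

Definition norm_bounded (U : Type) (R : realType) (X : normed_fspace U R)
    (A : set (U -> R)) :=
  exists M : R, forall u, A u -> (fnorm X u <= M%:E)%E.

Definition relatively_compact (U : Type) (R : realType)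
    (Y : normed_fspace U R) (B : set (U -> R)) :=
  compact (closure [set g : fpoint Y | B (sval g)]).

Definition compact_linear_operator (U : Type) (R : realType)
    (X Y : normed_fspace U R) (T : (U -> R) -> (U -> R)) :=
  [/\ forall u, fcarrier X u -> fcarrier Y (T u),
      forall (a : R) u v, fcarrier X u -> fcarrier X v ->
        T (a \*o u \+ v) = a \*o T u \+ T v
    & forall A, A `<=` fcarrier X -> norm_bounded X A ->
        relatively_compact Y (T @` A)].

Section function_spaces.
Variables (R : realType) (n : nat).
Implicit Types (E K : set 'rV[R]_n) (u v : 'rV[R]_n -> R).

Definition Lp (p : R) E : normed_fspace 'rV[R]_n R := NormedFspace
  [set u | u \_ E = u /\ u \in Lfun (leb R n) p%:E]
  (fun u => 'N[leb R n]_p%:E[EFin \o u])%E.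

Definition gagliardo (s p : R) E u : \bar R :=
  (((s * (1 - s))%:E *
    \int[leb R n]_(y in E) \int[leb R n]_(x in E)
      (`|u x - u y| `^ p / enorm (x - y) `^ (n%:R + s * p))%:E) `^ p^-1)%E.

Definition Wsp (s p : R) E : normed_fspace 'rV[R]_n R :=
  if s == 0 then Lp p E else NormedFspace
    [set u | fcarrier (Lp p E) u /\ (gagliardo s p E u < +oo)%E]
    (fun u => fnorm (Lp p E) u + gagliardo s p E u)%E.

Definition sup_norm K u : \bar R :=
  ereal_sup (0%E |` [set `|u x|%:E | x in K]).

(* Coincident points x = y contribute 0 / 0 = 0. *)
Definition hoelder_seminorm (b : R) K u : \bar R :=
  ereal_sup (0%E |`
    [set (`|u z.1 - u z.2| / enorm (z.1 - z.2) `^ b)%:E | z in K `*` K]).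

Definition hoelder_norm (b : R) K u : \bar R :=
  if b == 0 then sup_norm K u else (sup_norm K u + hoelder_seminorm b K u)%E.

Definition hoelder_space (b : R) K : normed_fspace 'rV[R]_n R := NormedFspace
  [set u | [/\ u \_ K = u, {within K, continuous u}
             & (hoelder_norm b K u < +oo)%E]]
  (hoelder_norm b K).

Definition is_continuous_rep u v :=
  continuous v /\ ae_eq (leb R n) setT u v.

(* Any two continuous representatives are equal; 0 is a junk value, used if
   there is none. *)
Definition continuous_rep u : 'rV[R]_n -> R :=
  xget (cst 0) (is_continuous_rep u).

Definition compactly_embedded_on E (X Y : normed_fspace 'rV[R]_n R) :=
  compact_linear_operator X Y (fun u => u \_ E).

Definition compactly_embedded_C_on K (X Y : normed_fspace 'rV[R]_n R) :=
  (forall u, fcarrier X u -> exists v, is_continuous_rep u v) /\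
  compact_linear_operator X Y (fun u => continuous_rep u \_ K).

(* Near each boundary point x0, and up to a rotation that sends e to the last
   vector of the canonical basis, E lies strictly above the graph of a Lipschitz
   function g of the other coordinates: x is split into its component along e
   and its orthogonal projection onto the hyperplane orthogonal to e. *)
Definition lipschitz_boundary E :=
  forall x0, (closure E `\` E°) x0 ->
  exists (r : R) (e : 'rV[R]_n) (g : 'rV[R]_n -> R) (L : R),
    [/\ 0 < r, enorm e = 1,
        forall y z, dotp y e = 0 -> dotp z e = 0 ->
          `|g y - g z| <= L * enorm (y - z)
      & forall x, enorm (x - x0) < r ->
          E x <-> g (x - dotp x e *: e) < dotp x e].

Definition bounded_lipschitz_domain E :=
  [/\ open E, connected E, E !=set0, bounded_set E & lipschitz_boundary E].

End function_spaces.

(* Main.v *)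
Require Import Defs.
From HB Require Import structures.
From mathcomp Require Import all_boot all_order all_algebra.
From mathcomp Require Import all_classical all_reals all_analysis.
From mathcomp Require finmap.
From mathcomp Require Import measurable_realfun ring lra zify.
Import Order.TTheory GRing.Theory Num.Theory.
Import numFieldNormedType.Exports.
Local Open Scope classical_set_scope.
Local Open Scope ring_scope.

Set Implicit Arguments.
Unset Strict Implicit.
Unset Printing Implicit Defensive.

(** Cut R^n into dyadic cubes of side 2^-k and replace u, on each cube, by one
of its own values, chosen so that the L^p oscillation of u around it on the cube
is at most the mean oscillation; on a cube of diameter d the latter is bounded
by a power of d times the Gagliardo energy of u on the cube, because |x - y| <= d
there. The cubes of one generation are disjoint, so summing gives a step
function S_k with

  ||u - S_k||_p^p <= C 2^(-k s p) H     ([dyadic_steps]),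

where H bounds the energy. Everything follows from this estimate. The increment
S_(k+1) - S_k is constant on cubes of measure 2^(-(k+1) n), so its L^p bound is
also a sup bound, at the price of a factor 2^(k n):
|S_(k+1) - S_k|^p <= C 2^(k (n - s p)). Interpolating between the two, the
integrals of |S_(k+1) - S_k|^q decrease geometrically as soon as
n (q - p) < s p q, that is, as soon as q < n p / (n - s p) when s p < n, and for
all q >= p when s p = n; summing the increments gives the rate of convergence of
S_k to u in L^q, uniformly on bounded sets of W^{s,p} ([step_approximation]). If
s p > n, then the sup bound itself is geometric, so S_k converges uniformly;
comparing the values of S_k on neighbouring cubes at the scale of |x - y| shows
that the limit is a representative of u that is Hoelder continuous of exponent
s - n/p, with a bound that depends on the norm of u only
([hoelder_representative]).

Compactness is total boundedness plus completeness, total boundedness being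
expressed by colourings: a set can be coloured with finitely many colours so
that functions of the same colour are at distance at most e
([relatively_compact_colouring]).
- In L^q(Omega), with Omega of finite measure, it suffices to colour the S_k for
  one large k. They are uniformly bounded, the part of Omega outside a large box
  has small measure, and in the box finitely many bounded coefficients remain,
  which are coloured after rounding ([Lq_colouring]). Exponents q < p come from p
  because the measure of Omega is finite.
- In C^b(K), colour by the rounded values at one point in each of the small
  cubes of a box that contains K. Functions of the same colour are uniformly close
  on K, and interpolating with their common Hoelder bound of exponent
  s - n/p > b makes them close in C^b ([hoelder_colouring]).
- In W^{t,p}(Omega), the energy of order t of a difference is split at
  |x - y| = rho: the pairs closer than rho contribute at most rho^((s - t) p)
  times the energy of order s over R^n, the others at most a constant, depending
  on rho, times the L^p norm ([genergy_compare]); so a colouring for L^p(Omega)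
  is one for W^{t,p}(Omega) ([Wsp_colouring]).

Completeness of L^q uses that a sequence whose increments have geometrically
small norms converges almost everywhere ([geometric_majorant]); W^{t,p}(Omega)
is handled by viewing the Gagliardo seminorm as the L^p norm of a weighted
difference quotient on R^n x R^n. *)

(** * Relative compactness from finite colourings *)

(** Only differences occur, since compactness depends on the distance between
functions alone. *)
Record seminormed_fspace (U : Type) (R : realType) (Y : normed_fspace U R) :
    Prop := SeminormedFspace {
  fnorm_subxx : forall f, fcarrier Y f -> fnorm Y (f \- f) = 0%E ;
  fnorm_subC : forall f g, fcarrier Y f -> fcarrier Y g ->
    fnorm Y (f \- g) = fnorm Y (g \- f) ;
  fnorm_triangle : forall f g h, fcarrier Y f -> fcarrier Y g ->
    fcarrier Y h ->
    (fnorm Y (f \- h)%R <= fnorm Y (f \- g)%R + fnorm Y (g \- h)%R)%E }.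

(** Every Cauchy sequence has a subsequence with increments of this size, so
completeness may be tested on such sequences, for which the norms of the
increments have a finite sum. *)
Definition complete_fspace (U : Type) (R : realType) (Y : normed_fspace U R) :=
  forall f_ : nat -> U -> R, (forall k, fcarrier Y (f_ k)) ->
    (forall k, (fnorm Y (f_ k.+1 \- f_ k)%R <= (2^-1 ^+ k)%:E)%E) ->
    exists2 f, fcarrier Y f &
      forall e : R, 0 < e -> exists k0, forall k, (k0 <= k)%N ->
        (fnorm Y (f_ k \- f)%R <= e%:E)%E.

(** Total boundedness, with the cover given by the colour classes: no centres
have to be chosen, so the property pulls back along maps that do not respect
any topology, such as the choice of step functions. *)
Definition finitely_coloured (V : Type) (B : set V)
    (small : V -> V -> Prop) :=
  exists (I : finType) (phi : V -> I),
    forall f g, B f -> B g -> phi f = phi g -> small f g.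

Lemma ultra_finite_colouring (T : Type) (F : set_system T) (I : finType)
    (phi : T -> I) : UltraFilter F -> exists i, F (phi @^-1` [set i]).
Proof.
move=> FU; apply: contrapT => /forallNP nF.
have FP : ProperFilter F by apply: ultra_proper.
have nFi i : F (~` (phi @^-1` [set i])).
  by have [/nF|] := in_ultra_setVsetC (phi @^-1` [set i]) FU.
by have /filter_ex[x /(_ (phi x))] := filter_forall FP nFi; apply.
Qed.

(** An ultrafilter lives on a single colour of each finite colouring, hence
contains sets of arbitrarily small diameter. Points in the intersections of
these sets form a sequence to which completeness applies, and the ultrafilter
converges to its limit. *)
Lemma relatively_compact_colouring (U : Type) (R : realType)
    (Y : normed_fspace U R) (B : set (U -> R)) :
  seminormed_fspace Y -> complete_fspace Y -> B `<=` fcarrier Y ->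
  (forall e : R, 0 < e ->
     finitely_coloured B (fun f g => (fnorm Y (f \- g)%R <= e%:E)%E)) ->
  relatively_compact Y B.
Proof.
move=> [dxx dC dT] cplY BY colB; rewrite /relatively_compact.
pose d (f g : fpoint Y) := fnorm Y (sval f \- sval g).
have dpC f g : d f g = d g f by apply: dC; [exact: svalP|exact: svalP].
have dpT f g h : (d f h <= d f g + d g h)%E.
  by apply: dT; exact: svalP.
have oball (f : fpoint Y) e : 0 < e -> open (fball f e).
  move=> e0; rewrite openE /interior => g gf; rewrite nbhsE.
  exists (fball f e) => //; split => //.
  exists [set fball f e]; last by rewrite bigcup_set1.
  move=> _ ->; exists (finmap.fset1 (fball f e)).
    by move=> A /finmap.fset1P ->; apply/mem_set; exists f, e.
  by rewrite set_fset1 bigcap_set1.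
have nball (f : fpoint Y) e : 0 < e -> nbhs f (fball f e).
  move=> e0; apply: open_nbhs_nbhs; split; first exact: oball.
  by rewrite /fball /= dxx ?lte_fin//; exact: svalP.
set C := closure _.
rewrite compact_ultra /= => F FU FC.
have FP : ProperFilter F by apply: ultra_proper.
(* A point of the closure has no colour of its own: it gets that of a member of
   B within e/3 of it. *)
have small e : 0 < e -> exists2 P, F P & forall f g, P f -> P g -> (d f g <= e%:E)%E.
  move=> e0.
  have e30 : 0 < e / 3 by rewrite divr_gt0.
  have [I [phi phiP]] := colB _ e30.
  have /choice[b bP] (f : fpoint Y) :
      exists g : fpoint Y, C f -> B (sval g) /\ (d f g <= (e / 3)%:E)%E.
    have [Cf|nCf] := pselect (C f); last by exists f.
    have [g [Bg fg]] := Cf _ (nball f _ e30).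
    by exists g => _; split => //; rewrite dpC; exact: ltW.
  have [i Fi] := ultra_finite_colouring (fun f => phi (sval (b f))) FU.
  exists (C `&` ((fun f => phi (sval (b f))) @^-1` [set i])); first exact: filterI.
  move=> f g [/bP[Bf df] /= fi] [/bP[Bg dg] /= gi].
  apply: le_trans (dpT _ (b f) _) _.
  apply: (@le_trans _ _ ((e / 3)%:E + ((e / 3)%:E + (e / 3)%:E))%E).
    apply: leeD => //; apply: le_trans (dpT _ (b g) _) _.
    apply: leeD; last by rewrite dpC.
    by apply: phiP => //; rewrite fi gi.
  by rewrite -!EFinD lee_fin; lra.
have /choice[P PP] (k : nat) : exists P, F P /\
    forall f g, P f -> P g -> (d f g <= (2^-1 ^+ k)%:E)%E.
  by have [P FP' Pd] := small (2^-1 ^+ k) ltac:(rewrite exprn_gt0//); exists P.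
have FPk k : F (\bigcap_(i in `I_k.+1) P i).
  elim: k => [|k IH]; first by rewrite (_ : `I_1 = [set 0%N]) ?bigcap_set1;
    [exact: (PP _).1|apply/seteqP; split=> i /=; rewrite ltnS leqn0 => /eqP].
  rewrite IIS bigcap_setU bigcap_set1.
  by apply: filterI => //; exact: (PP _).1.
have /choice[f_ f_P] (k : nat) : exists f, (\bigcap_(i in `I_k.+1) P i) f.
  by have [f fk] := filter_ex (FPk k); exists f.
have [f Yf fl] := cplY (fun k => sval (f_ k)) (fun k => svalP (f_ k)) (fun k =>
   (PP k).2 _ _ (f_P k.+1 k (ltnW (ltnSn _))) (f_P k k (ltnSn _))).
pose fp : fpoint Y := exist _ f Yf.
have Fball e : 0 < e -> F (fball fp e).
  move=> e0; have e20 : 0 < e / 4 by rewrite divr_gt0.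
  have [k0 k0P] := fl _ e20.
  have [k1 k1P] : exists k1, (2^-1 ^+ k1 : R) <= e / 4.
    have /cvgrPdist_le/(_ _ e20)[k _ kP] : (2^-1 ^+ k : R) @[k --> \oo] --> (0 : R).
      by apply: cvg_expr; rewrite ger0_norm// invf_lt1//; lra.
    exists k; have := kP k (leqnn k).
    by rewrite sub0r normrN ger0_norm// exprn_ge0.
  pose k := maxn k0 k1.
  apply: filterS (PP k).1 => g Pg; rewrite /fball /=.
  apply: (@le_lt_trans _ _ (e / 2)%:E); last by rewrite lte_fin; lra.
  apply: le_trans (dpT g (f_ k) fp) _.
  rewrite [X in (_ <= X)%E](_ : _ = (e / 4)%:E + (e / 4)%:E)%E; last first.
    by rewrite -EFinD; congr EFin; lra.
  apply: leeD; last exact/k0P/leq_maxl.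
  apply: le_trans ((PP k).2 _ _ Pg (f_P k k (ltnSn _))) _.
  rewrite lee_fin; apply: le_trans k1P.
  by apply: ler_wiXn2l; rewrite ?invr_ge0// ?invf_le1// ?ler1n// leq_maxr.
(* The topology is generated by balls around arbitrary centres g, so a subbasic
   neighbourhood of the limit must be shrunk to a ball around the limit. *)
have Ff : F --> fp.
  move=> A; rewrite /= nbhsE => -[_ [[D Dsub <-] [V DV Vf]] DA].
  apply: (filterS DA); apply: (filterS (bigcup_sup DV)).
  have [J Jsub JV] := Dsub _ DV.
  rewrite -JV; apply: filter_bigI => W WJ.
  have := Jsub _ WJ; rewrite inE => -[g [e [e0 We]]].
  move: Vf; rewrite -JV => /(_ W WJ) /=; rewrite We => gf.
  have gf' : (d fp g < e%:E)%E by [].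
  have dfin : d fp g \is a fin_num.
    rewrite ge0_fin_numE ?(lt_trans gf') ?ltry// leNgt; apply/negP => d0.
    have := dpT fp g fp; rewrite (dpC g) {1}/d dxx//; apply/negP.
    by rewrite -ltNge -[X in (_ < X)%E]adde0 lteD.
  have r0 : 0 < e - fine (d fp g) by rewrite subr_gt0 -lte_fin fineK.
  apply: filterS (Fball _ r0) => h /= hf.
  rewrite /fball /=; apply: le_lt_trans (dpT h fp g) _.
  by rewrite -(fineK dfin) -(subrK (fine (d fp g)) e) EFinD lteD2rE.
exists fp; split => //.
have : closure C fp.
  move=> V nV; have [g [Vg Cg]] := filter_ex (filterI (Ff _ nV) FC).
  by exists g.
by rewrite {1}/C -(iffLR (closure_id _) (@closed_closure _ _)).
Qed.

(** * Lebesgue measure on R^n *)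

Section leb_basics.
Variables (R : realType) (n : nat).

Lemma measurable_Borel_Rn (A : set 'rV[R]_n) :
  measurable A -> measurable (A : set (Rn R n)).
Proof. by move=> mA; apply: sub_caratheodory; exact: sub_sigma_algebra. Qed.

Lemma leb_Borel (A : set 'rV[R]_n) : measurable A ->
  leb R n A = borel_lebesgue R n A.
Proof. by move=> mA; rewrite /leb /= /completed_measure_extension measurable_mu_extE. Qed.

Lemma leb_sigma_finite : sigma_finite setT (leb R n).
Proof. exact/completed_measure_extension_sigma_finite/sigma_finiteT. Qed.

(** The same measure, with the structure that the theorems of Fubini and
Tonelli ask for. *)
Definition sleb : {sigma_finite_measure set (Rn R n) -> \bar R} :=
  HB.pack (Measure.sort (leb R n))
    (Measure_isSigmaFinite.Build _ _ _ (leb R n) leb_sigma_finite).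

Lemma measurable_coord_Rn (i : 'I_n) :
  measurable_fun setT (fun x : Rn R n => x ord0 i).
Proof.
move=> _ Y mY; rewrite setTI; apply: measurable_Borel_Rn.
by rewrite -[X in measurable X]setTI; exact: measurable_rV_coord.
Qed.

Lemma measurable_enorm_sub : measurable_fun setT
  (fun z : Rn R n * Rn R n => enorm ((z.1 : 'rV[R]_n) - z.2)).
Proof.
rewrite /enorm; apply: measurableT_comp => //.
  by apply: continuous_measurable_fun; exact: sqrt_continuous.
rewrite /dotp; apply: measurable_sum => i.
have mB : measurable_fun setT (fun z : Rn R n * Rn R n =>
    ((z.1 : 'rV[R]_n) - z.2) ord0 i).
  under eq_fun do rewrite mxE mxE.
  apply: measurable_funB.
    exact: (measurableT_comp (measurable_coord_Rn i) measurable_fst).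
  exact: (measurableT_comp (measurable_coord_Rn i) measurable_snd).
exact: measurable_funM.
Qed.

End leb_basics.

Definition cube (R : realType) (n : nat) (a : 'I_n -> R) (d : R) : set 'rV[R]_n :=
  [set x | forall i, a i <= x ord0 i < a i + d].

Lemma measurable_cube (R : realType) n (a : 'I_n -> R) d : measurable (cube a d).
Proof.
rewrite (_ : cube a d = \bigcap_(i in [set: 'I_n])
   (@rV_coord R n i @^-1` [set` `[a i, a i + d[])).
  apply: fin_bigcap_measurable => // i _.
  by rewrite -[X in measurable X]setTI; apply: measurable_rV_coord.
apply/seteqP; split => x /= xP i; first by move=> _; rewrite /rV_coord /= in_itv /=; exact: xP.
by have := xP i; rewrite /rV_coord /= in_itv /=; exact.
Qed.

Lemma borel_lebesgue_cube (R : realType) n (a : 'I_n -> R) d : 0 <= d ->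
  borel_lebesgue R n (cube a d) = (d ^+ n)%:E.
Proof.
move=> d0; elim: n a => [|n IH] a /=.
  rewrite diracE mem_set//= => -[]//.
rewrite /lebesgue_rV_step /pushforward.
rewrite (_ : _ @^-1` _ = `[a ord0, a ord0 + d[%classic `*`
    cube (fun i => a (lift ord0 i)) d); last first.
  apply/seteqP; split => -[x v] /=.
    move=> xv; split => /=.
      have := xv ord0; rewrite in_itv /=.
      have -> : ord0 = lshift n (ord0 : 'I_1) :> 'I_(1 + n) by exact/val_inj.
      by rewrite /rV_cons (row_mxEl (x%:M : 'rV_1) v) mxE eqxx mulr1n.
    move=> i; have := xv (lift ord0 i).
    have -> : lift ord0 i = rshift 1 i :> 'I_(1 + n) by exact/val_inj.
    by rewrite /rV_cons (row_mxEr (x%:M : 'rV_1) v).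
  move=> [/= xa va] i; have [j ij|j ij] := split_ordP (i : 'I_(1 + n)).
    rewrite /rV_cons ij (row_mxEl (x%:M : 'rV_1) v) mxE !ord1 eqxx mulr1n.
    have -> : lshift n (0 : 'I_1) = ord0 :> 'I_(n.+1) by exact/val_inj.
    by move: xa; rewrite in_itv.
  have := va j; rewrite /rV_cons ij (row_mxEr (x%:M : 'rV_1) v).
  by have -> : rshift 1 j = lift ord0 j :> 'I_(n.+1) by exact/val_inj.
rewrite product_measure1E//; last exact: measurable_cube.
rewrite IH.
have lI : (lebesgue_measure `[a ord0, (a ord0 + d)%R[%classic = d%:E :> \bar R)%E.
  rewrite lebesgue_measure_itv/= lte_fin ltrDl; have [d_gt0|d_le0] := ltP 0 d.
    by rewrite -EFinD addrAC subrr add0r.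
  by congr EFin; apply/eqP; rewrite eq_le d_le0 d0.
by rewrite exprS EFinM; congr (_ * _)%E.
Qed.

Lemma leb_cube (R : realType) n (a : 'I_n -> R) d : 0 <= d ->
  leb R n (cube a d) = (d ^+ n)%:E.
Proof.
by move=> d0; rewrite leb_Borel ?borel_lebesgue_cube//; exact: measurable_cube.
Qed.

(** * Powers of L^p norms *)

(** The p-th power of the L^p norm: without the root it is additive over
disjoint sets, and meaningful for every p > 0. *)
Definition Lpow d (T : measurableType d) (R : realType)
    (mu : {measure set T -> \bar R}) (D : set T) (p : R) (f : T -> R) : \bar R :=
  (\int[mu]_(x in D) (`|f x| `^ p)%:E)%E.

Section Lpow.
Context d (T : measurableType d) (R : realType).
Variables (mu : {measure set T -> \bar R}) (D : set T).
Hypothesis mD : measurable D.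
Implicit Types (p : R) (f g h : T -> R).

Lemma measurable_Lpow_fun p f : measurable_fun D f ->
  measurable_fun D (fun x => (`|f x| `^ p)%:E).
Proof.
move=> mf; apply/measurable_EFinP.
by apply: (measurableT_comp (measurable_powR p)); exact: measurableT_comp.
Qed.

Lemma Lpow_ge0 p f : (0 <= Lpow mu D p f)%E.
Proof. by apply: integral_ge0 => x _; rewrite lee_fin powR_ge0. Qed.

Lemma integralZ_Lpow p (B : R) f : 0 <= B -> measurable_fun D f ->
  (\int[mu]_(x in D) (B * `|f x| `^ p)%:E = B%:E * Lpow mu D p f)%E.
Proof.
move=> B0 mf; rewrite -ge0_integralZl_EFin//; last exact: measurable_Lpow_fun.
Qed.

Lemma LpowN p f : Lpow mu D p (fun x => - f x) = Lpow mu D p f.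
Proof. by rewrite /Lpow; under eq_integral do rewrite normrN. Qed.

(** The constant 2^p is not sharp for p >= 1, but it serves all p >= 0 at
once. *)
Lemma powRD_le p (a b : R) : 0 <= p -> 0 <= a -> 0 <= b ->
  (a + b) `^ p <= 2 `^ p * (a `^ p + b `^ p).
Proof.
move=> p0 a0 b0.
have [ab|ba] := leP a b.
  apply: (@le_trans _ _ ((2 * b) `^ p)).
    by rewrite ge0_ler_powR ?nnegrE//; lra.
  by rewrite powRM// ler_wpM2l ?powR_ge0// lerDr powR_ge0.
apply: (@le_trans _ _ ((2 * a) `^ p)).
  by rewrite ge0_ler_powR ?nnegrE//; lra.
by rewrite powRM// ler_wpM2l ?powR_ge0// lerDl powR_ge0.
Qed.

Lemma Lpow_triangle p f g h : 0 <= p -> measurable_fun D f ->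
  measurable_fun D g -> measurable_fun D h ->
  (forall x, D x -> `|f x| <= `|g x| + `|h x|) ->
  (Lpow mu D p f <= (2 `^ p)%:E * (Lpow mu D p g + Lpow mu D p h))%E.
Proof.
move=> p0 mf mg mh fgh; rewrite /Lpow.
rewrite -ge0_integralD//; [|exact: measurable_Lpow_fun|exact: measurable_Lpow_fun].
have mgh : measurable_fun D (fun x => (`|g x| `^ p)%:E + (`|h x| `^ p)%:E)%E.
  by apply: emeasurable_funD; exact: measurable_Lpow_fun.
rewrite -ge0_integralZl_EFin ?powR_ge0//; last first.
  by move=> x _; rewrite adde_ge0// lee_fin powR_ge0.
apply: ge0_le_integral => //.
- exact: measurable_Lpow_fun.
- exact: measurable_funeM.
- move=> x Dx; rewrite -EFinD -EFinM lee_fin.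
  apply: le_trans (powRD_le p0 (normr_ge0 _) (normr_ge0 _)).
  by rewrite ge0_ler_powR// ?nnegrE// ?addr_ge0// fgh.
Qed.

Lemma nneseries_geo_le (u : nat -> \bar R) (c rho : R) :
  0 <= c -> 0 < rho < 1 -> (forall j, 0 <= u j)%E ->
  (forall j, u j <= (c * rho ^+ j)%:E)%E ->
  (\sum_(0 <= j <oo) u j <= (c / (1 - rho))%:E)%E.
Proof.
move=> c0 /andP[r0 r1] u0 uc; apply: lime_le; first exact: is_cvg_nneseries.
apply: nearW => m; apply: (@le_trans _ _ (\sum_(0 <= j < m) (c * rho ^+ j)%:E)%E).
  exact: lee_sum.
rewrite sumEFin lee_fin; apply: geometric_le_lim => //.
by rewrite ger0_norm// ltW.
Qed.

(** Weighing the j-th term by rho^(-j/2) turns a geometric bound for the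
integrals into a pointwise one: the weighted sum W is still integrable, and
each |f_j|^q is at most rho^(j/2) W. *)
Lemma geometric_majorant (q c rho : R) (f_ : nat -> T -> R) :
  0 < q -> 0 <= c -> 0 < rho < 1 -> (forall j, measurable_fun D (f_ j)) ->
  (forall j, Lpow mu D q (f_ j) <= (c * rho ^+ j)%:E)%E ->
  exists W : T -> \bar R, [/\ measurable_fun D W, forall x, (0 <= W x)%E,
    (\int[mu]_(x in D) W x <= (c / (1 - Num.sqrt rho))%:E)%E &
    forall x, (W x < +oo)%E -> forall j,
      `|f_ j x| <= fine (W x) `^ q^-1 * (rho `^ (2 * q)^-1) ^+ j].
Proof.
move=> q0 c0 /andP[r0 r1] mf fc; pose sg := Num.sqrt rho.
have sg0 : 0 < sg by rewrite sqrtr_gt0.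
have sg1 : sg < 1 by rewrite -[X in _ < X]sqrtr1 ltr_sqrt.
have sg2 : sg ^+ 2 = rho by rewrite sqr_sqrtr// ltW.
pose h j x := ((sg ^- j)%:E * (`|f_ j x| `^ q)%:E)%E.
have h0 j x : (0 <= h j x)%E.
  by rewrite /h -EFinM lee_fin mulr_ge0 ?powR_ge0// invr_ge0 exprn_ge0// ltW.
have mh j : measurable_fun D (h j).
  by apply: measurable_funeM; exact: measurable_Lpow_fun.
exists (fun x => \sum_(0 <= j <oo) h j x)%E; split.
- by apply: ge0_emeasurable_sum.
- by move=> x; exact: nneseries_ge0.
- rewrite integral_nneseries//; apply: nneseries_geo_le => //.
  + by rewrite -/sg sg0.
  + by move=> j; exact: integral_ge0.
  + move=> j; rewrite ge0_integralZl_EFin//; last 2 first.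
      exact: measurable_Lpow_fun.
      by rewrite invr_ge0 exprn_ge0// ltW.
    apply: (@le_trans _ _ ((sg ^- j)%:E * (c * rho ^+ j)%:E)%E).
      by apply: lee_pmul => //; [rewrite lee_fin invr_ge0 exprn_ge0// ltW|exact: Lpow_ge0|exact: fc].
    have -> : rho ^+ j = sg ^+ j * sg ^+ j by rewrite -sg2 -exprM mulnC exprM expr2.
    rewrite -EFinM lee_fin mulrCA (mulrA (sg ^- j)) mulVf ?mul1r//.
    by rewrite expf_neq0// gt_eqF.
- move=> x Woo j.
  have hj : (h j x <= \sum_(0 <= j <oo) h j x)%E.
    apply: (@le_trans _ _ (\sum_(0 <= i < j.+1) h i x)%E).
      by rewrite big_nat_recr//= leeDr// sume_ge0.
    exact: nneseries_lim_ge.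
  set W := (\sum_(0 <= j <oo) h j x)%E in Woo hj *.
  have Wfin : W \is a fin_num by rewrite ge0_fin_numE// nneseries_ge0.
  move: hj; rewrite -(fineK Wfin) /h -EFinM lee_fin => hj.
  have fj : `|f_ j x| `^ q <= fine W * sg ^+ j.
    by rewrite -ler_pdivrMr ?exprn_gt0// mulrC.
  have W0 : 0 <= fine W by apply: fine_ge0; exact: nneseries_ge0.
  have -> : `|f_ j x| = (`|f_ j x| `^ q) `^ q^-1.
    by rewrite -powRrM mulfV ?gt_eqF// powRr1.
  apply: (@le_trans _ _ ((fine W * sg ^+ j) `^ q^-1)).
    apply: ge0_ler_powR fj; rewrite ?invr_ge0 ?(ltW q0) ?nnegrE ?powR_ge0//.
    by rewrite mulr_ge0// exprn_ge0// ltW.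
  rewrite powRM ?exprn_ge0 ?(ltW sg0)// ler_wpM2l ?powR_ge0//.
  rewrite -(powR_mulrn j (ltW sg0)) -(powR_mulrn j (powR_ge0 _ _)).
  have -> : sg = rho `^ 2^-1 by rewrite powR12_sqrt// ltW.
  rewrite -!powRrM le_eqVlt; apply/orP; left; apply/eqP.
  by congr (_ `^ _); rewrite invfM; ring.
Qed.

Lemma ae_fin_of_integral (W : T -> \bar R) (c : R) : measurable_fun D W ->
  (forall x, 0 <= W x)%E -> (\int[mu]_(x in D) W x <= c%:E)%E ->
  {ae mu, forall x, D x -> (W x < +oo)%E}.
Proof.
move=> mW W0 Wc.
have iW : mu.-integrable D W.
  apply/integrableP; split => //.
  under eq_integral do rewrite gee0_abs//.
  by rewrite (le_lt_trans Wc) ?ltry.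
have := integrable_ae mD iW; apply: filterS => x + Dx => /(_ Dx) Wx.
by rewrite -ge0_fin_numE.
Qed.

End Lpow.

Lemma geometric_increments (R : realType) (a : nat -> R) (M t : R) :
  0 <= M -> 0 < t < 1 -> (forall j, `|a j.+1 - a j| <= M * t ^+ j) ->
  exists2 l, a @ \oo --> l & `|l - a 0%N| <= M / (1 - t).
Proof.
move=> M0 /andP[t0 t1] aM.
have aE : a = (fun n => a 0%N + series (fun j => a j.+1 - a j) n).
  by apply/funext => n; rewrite /series /= telescope_sumr// addrC subrK.
have tn : `|t| < 1 by rewrite ger0_norm// ltW.
have cs : cvgn (series (fun j => a j.+1 - a j)).
  apply: normed_cvg; apply: (series_le_cvg _ _ aM) => //.
  - by move=> n; rewrite mulr_ge0// exprn_ge0// ltW.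
  - exact: is_cvg_geometric_series.
exists (a 0%N + limn (series (fun j => a j.+1 - a j))).
  by rewrite {1}aE; apply: cvgD => //; exact: cvg_cst.
rewrite addrC addKr.
have cn : cvgn (fun n => `|series (fun j => a j.+1 - a j) n|) by apply: is_cvg_norm.
rewrite -lim_norm//; apply: limr_le => //; apply: nearW => n.
apply: le_trans (ler_norm_sum _ _ _) _.
apply: le_trans (geometric_le_lim n M0 t0 tn).
by apply: ler_sum => i _; exact: aM.
Qed.

Section Lpow_limits.
Context d (T : measurableType d) (R : realType).
Variables (mu : {measure set T -> \bar R}) (D : set T).
Hypothesis mD : measurable D.
Variables (q c rho : R) (f_ : nat -> T -> R).
Hypotheses (q0 : 0 < q) (c0 : 0 <= c) (rho01 : 0 < rho < 1).
Hypothesis mf : forall j, measurable_fun D (f_ j).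

Let tau := rho `^ (2 * q)^-1.
Let tau01 : 0 < tau < 1.
Proof.
have /andP[r0 r1] := rho01; rewrite powR_gt0//= /tau.
apply: (@lt_le_trans _ _ (1 `^ (2 * q)^-1)); last by rewrite powR1.
by apply: gt0_ltr_powR => //; rewrite ?nnegrE ?invr_gt0 ?mulr_gt0// ltW.
Qed.

Lemma ae_cvg0_Lpow : (forall j, Lpow mu D q (f_ j) <= (c * rho ^+ j)%:E)%E ->
  {ae mu, forall x, D x -> f_ j x @[j --> \oo] --> 0}.
Proof.
move=> fc; have [W [mW W0 iW Wf]] := geometric_majorant mD q0 c0 rho01 mf fc.
have := ae_fin_of_integral mD mW W0 iW; apply: filterS => x + Dx => /(_ Dx) /Wf Wx.
apply/norm_cvg0P; apply: (@squeeze_cvgr _ _ _ _ (cst 0) (fun j => fine (W x) `^ q^-1 * tau ^+ j)).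
- by apply: nearW => j; rewrite normr_ge0 Wx.
- exact: cvg_cst.
- by apply: cvg_geometric; have /andP[t0 t1] := tau01; rewrite ger0_norm// ltW.
Qed.

Hypothesis fc : forall j,
  (Lpow mu D q (fun x => f_ j.+1 x - f_ j x)%R <= (c * rho ^+ j)%:E)%E.

Let mdf j : measurable_fun D (fun x => f_ j.+1 x - f_ j x).
Proof. exact: measurable_funB. Qed.

Lemma ae_is_cvg_Lpow : {ae mu, forall x, D x -> cvgn (f_ ^~ x)}.
Proof.
have [W [mW W0 iW Wf]] := geometric_majorant mD q0 c0 rho01 mdf fc.
have := ae_fin_of_integral mD mW W0 iW; apply: filterS => x + Dx => /(_ Dx) /Wf Wx.
by have [l fl _] := geometric_increments (powR_ge0 _ _) tau01 Wx; apply/cvg_ex; exists l.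
Qed.

(** By [geometric_majorant] the increments are dominated by a geometric sequence
times W^(1/q), with W integrable; hence so is |u - f_0|, and the q-th power of
the dominating function is a multiple of W. *)
Lemma Lpow_telescope (u : T -> R) : measurable_fun D u ->
  {ae mu, forall x, D x -> f_ j x @[j --> \oo] --> u x} ->
  (Lpow mu D q (fun x => u x - f_ 0%N x)%R <=
    (c * ((1 - tau) `^ q * (1 - Num.sqrt rho))^-1)%:E)%E.
Proof.
move=> mu_ fu.
have [W [mW W0 iW Wf]] := geometric_majorant mD q0 c0 rho01 mdf fc.
have /andP[t0 t1] := tau01.
have t1q : 0 < (1 - tau) `^ q by rewrite powR_gt0// subr_gt0.
apply: (@le_trans _ _ (((1 - tau) `^ q)^-1%:E * \int[mu]_(x in D) W x)%E); last first.
  rewrite invfM mulrCA EFinM; apply: lee_pmul => //.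
  - by rewrite lee_fin invr_ge0 ltW.
  - exact: integral_ge0.
rewrite -ge0_integralZl_EFin//; last by rewrite invr_ge0 ltW.
apply: ae_ge0_le_integral => //.
- by apply: measurable_Lpow_fun; exact: measurable_funB.
- by move=> x _; rewrite mule_ge0// lee_fin invr_ge0 ltW.
- exact: measurable_funeM.
have := ae_fin_of_integral mD mW W0 iW; apply: filterS2 fu => x fux Woo Dx.
have /Wf Wx := Woo Dx.
have [l fl lf] := geometric_increments (powR_ge0 _ _) tau01 Wx.
have <- : l = u x by apply: cvg_unique (fux Dx) => //; exact: fl.
have Wfin : W x \is a fin_num by rewrite ge0_fin_numE// Woo.
rewrite -(fineK Wfin) -EFinM lee_fin.
have W0x : 0 <= fine (W x) by apply: fine_ge0.
apply: (@le_trans _ _ ((fine (W x) `^ q^-1 / (1 - tau)) `^ q)).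
  rewrite ge0_ler_powR ?nnegrE ?(ltW q0)//.
  by rewrite divr_ge0 ?powR_ge0// subr_ge0 ltW.
rewrite powRM ?powR_ge0// ?invr_ge0 ?subr_ge0 ?(ltW t1)// -powRrM mulVf ?gt_eqF//.
rewrite powRr1// mulrC ler_wpM2r// -powR_inv1 ?subr_ge0 ?(ltW t1)//.
by rewrite -powRrM mulN1r powRN.
Qed.

End Lpow_limits.

(** * The Gagliardo energy *)

(** Otherwise f would exceed its mean at every point of A: the difference would
be positive with integral 0, so A would be a null set. *)
Lemma integral_mean_le d (T : measurableType d) (R : realType)
    (mu : {measure set T -> \bar R}) (A : set T) (m : R) (f : T -> \bar R) :
  measurable A -> mu A = m%:E -> 0 < m -> measurable_fun A f ->
  (forall x, A x -> (0 <= f x)%E) ->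
  exists2 y, A y & (m%:E * f y <= \int[mu]_(x in A) f x)%E.
Proof.
move=> mA Am m0 mf f0; apply: contrapT => nex.
have gtf y : A y -> (\int[mu]_(x in A) f x < m%:E * f y)%E.
  by move=> Ay; rewrite ltNge; apply/negP => le; apply: nex; exists y.
have I0 : (0 <= \int[mu]_(x in A) f x)%E by exact: integral_ge0.
have [A0|[y Ay]] : A = set0 \/ A !=set0 by have [->|] := eqVneq A set0; [left|move/set0P; right].
  by move: Am; rewrite A0 measure0 => -[m0']; move: m0; rewrite -m0' ltxx.
have If : (\int[mu]_(x in A) f x)%E \is a fin_num.
  by rewrite ge0_fin_numE// (lt_le_trans (gtf _ Ay)) ?leey.
pose c := fine (\int[mu]_(x in A) f x)%E / m.
have cf x : A x -> (c%:E < f x)%E.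
  move=> Ax; have := gtf _ Ax; rewrite -{1}(fineK If).
  case: (f x) => [r| |] //=; last by rewrite gt0_muleNy ?lte_fin.
    by rewrite -EFinM !lte_fin /c ltr_pdivrMr// mulrC.
  by rewrite ltry.
have c0 : 0 <= c by rewrite divr_ge0 ?fine_ge0// ltW.
pose g x := (f x - c%:E)%E.
have mg : measurable_fun A g by exact: emeasurable_funB.
have g0 x : A x -> (0 <= g x)%E by move=> Ax; rewrite sube_ge0 ?ltW ?cf.
have fE : (\int[mu]_(x in A) f x = \int[mu]_(x in A) (g x + cst c%:E x))%E.
  by apply: eq_integral => x _; rewrite /g /cst subeK.
have g_0 : (\int[mu]_(x in A) g x = 0)%E.
  have := fE; rewrite ge0_integralD//.
  rewrite integral_cst// Am -EFinM -(fineK If) /c divfK ?gt_eqF// fineK//.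
  rewrite -{1}[X in X = _](add0e) => /esym.
  have ig : (\int[mu]_(x in A) g x)%E \is a fin_num.
    rewrite ge0_fin_numE ?integral_ge0//; apply: le_lt_trans (_ : _ <= \int[mu]_(x in A) f x)%E _.
      by rewrite fE; apply: ge0_le_integral => //;
        [apply: emeasurable_funD|move=> x Ax; rewrite leeDl// lee_fin].
    by rewrite -ge0_fin_numE.
  by move=> /eqP; rewrite -(fineK If) -(fineK ig) -!EFinD eqe => /eqP/addIr ->.
have : mu.-negligible A.
  have : (\int[mu]_(x in A) `|g x| = 0)%E.
    by rewrite -[RHS]g_0; apply: eq_integral => x /set_mem Ax; rewrite gee0_abs ?g0.
  move=> /(ae_eq_integral_abs mu mA mg) [N [mN N0 gN]]; exists N; split => //.
  move=> x Ax; apply: gN => /= /(_ Ax) gx.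
  by have := cf _ Ax; rewrite -sube_gt0 -/(g x) gx ltxx.
move=> [N [mN N0 AN]]; have : (mu A <= mu N)%E by apply: le_measure => //; rewrite inE.
by rewrite Am N0 lee_fin leNgt m0.
Qed.

Definition gkernel (R : realType) (n : nat) (s p : R) (u : 'rV[R]_n -> R)
    (x y : 'rV[R]_n) : R :=
  `|u x - u y| `^ p / enorm (x - y) `^ (n%:R + s * p).

(** The Gagliardo seminorm without its root and its factor s (1 - s), so that
it is superadditive over disjoint sets. *)
Definition genergy (R : realType) (n : nat) (s p : R) (E : set 'rV[R]_n)
    (u : 'rV[R]_n -> R) : \bar R :=
  (\int[leb R n]_(y in E) \int[leb R n]_(x in E) (gkernel s p u x y)%:E)%E.

Section enorm.
Variables (R : realType) (n : nat).
Implicit Types x y : 'rV[R]_n.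

Lemma enorm_ge0 x : 0 <= enorm x.
Proof. exact: sqrtr_ge0. Qed.

Lemma coord_le_enorm x i : `|x ord0 i| <= enorm x.
Proof.
rewrite -sqrtr_sqr /enorm ler_sqrt; last by apply: sumr_ge0 => j _; rewrite -expr2 sqr_ge0.
rewrite /dotp (bigD1 i)//= -expr2 lerDl; apply: sumr_ge0 => j _.
by rewrite -expr2 sqr_ge0.
Qed.

Lemma enorm_eq0 x y : enorm (x - y) = 0 -> x = y.
Proof.
move=> e0; apply/rowP => i; apply/eqP; rewrite -subr_eq0 -normr_le0 -e0.
by have := coord_le_enorm (x - y) i; rewrite !mxE.
Qed.

Lemma enorm_le x (d : R) : 0 <= d -> (forall i, `|x ord0 i| <= d) ->
  enorm x <= n%:R * d.
Proof.
move=> d0 xd; rewrite -(@ger0_norm _ (n%:R * d)) ?mulr_ge0// -sqrtr_sqr.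
rewrite /enorm ler_sqrt ?sqr_ge0//.
apply: (@le_trans _ _ (\sum_(i < n) d ^+ 2)).
  by apply: ler_sum => i _; rewrite -expr2 -real_normK ?num_real// lerXn2r ?nnegrE.
rewrite sumr_const card_ord exprMn -[leLHS]mulr_natl ler_wpM2r ?sqr_ge0//.
by rewrite -natrX ler_nat; case: (n) => // m; rewrite leq_pmulr.
Qed.

End enorm.

Section genergy.
Variables (R : realType) (n : nat) (s p : R).
Implicit Types (u : 'rV[R]_n -> R) (E A : set (Rn R n)).

Lemma gkernel_ge0 u x y : 0 <= gkernel s p u x y.
Proof. by rewrite divr_ge0 ?powR_ge0. Qed.

Lemma measurable_gkernel u : measurable_fun setT (u : Rn R n -> R) ->
  measurable_fun setT (fun z : Rn R n * Rn R n => (gkernel s p u z.1 z.2)%:E).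
Proof.
move=> mu_; apply/measurable_EFinP; apply: measurable_funM.
  apply: (measurableT_comp (measurable_powR p)); apply: measurableT_comp => //.
  apply: measurable_funB.
    exact: (measurableT_comp mu_ measurable_fst).
  exact: (measurableT_comp mu_ measurable_snd).
under eq_fun do rewrite -powRN.
exact: (measurableT_comp (measurable_powR _) (@measurable_enorm_sub R n)).
Qed.

Lemma measurable_gkernelx u y : measurable_fun setT (u : Rn R n -> R) ->
  measurable_fun setT (fun x : Rn R n => (gkernel s p u x y)%:E).
Proof.
move=> mu_.
by have := measurableT_comp (measurable_gkernel mu_) (@measurable_pair2 _ _ (Rn R n) (Rn R n) y).
Qed.

Lemma measurable_integral_x (h : Rn R n * Rn R n -> \bar R) E :
  measurable E ->
  measurable_fun setT h -> (forall z, (0 <= h z)%E) ->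
  measurable_fun setT (fun y : Rn R n => \int[leb R n]_(x in E) h (x, y))%E.
Proof.
move=> mE mh h0.
under eq_fun do rewrite integral_mkcond epatch_indic.
apply: (@measurable_fun_fubini_tonelli_G _ _ _ _ _ (sleb R n)
  (fun z : Rn R n * Rn R n => h z * (\1_E z.1)%:E)%E).
  apply: emeasurable_funM => //; apply/measurable_EFinP.
  by apply: (measurableT_comp _ measurable_fst); exact: measurable_indic.
by move=> z; rewrite mule_ge0// lee_fin.
Qed.

Lemma measurable_energy_density u E : measurable E ->
  measurable_fun setT (u : Rn R n -> R) ->
  measurable_fun setT
    (fun y : Rn R n => \int[leb R n]_(x in E) (gkernel s p u x y)%:E)%E.
Proof.
move=> mE mu_; apply: (measurable_integral_x (h := fun z => (gkernel s p u z.1 z.2)%:E)) => //.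
  exact: measurable_gkernel.
by move=> z; rewrite lee_fin gkernel_ge0.
Qed.

Lemma genergy_ge0 E u : (0 <= genergy s p E u)%E.
Proof.
by apply: integral_ge0 => y _; apply: integral_ge0 => x _; rewrite lee_fin gkernel_ge0.
Qed.

(** Among the values of u on A there is one that is within the mean oscillation
of u on A: the function y |-> int_A |u(x) - u(y)|^p dx is somewhere at most its
mean, which the energy controls because |x - y| <= d. Such a value does the work
of the average of u on A, and needs neither Jensen's inequality nor the
integrability of u. *)
Lemma good_value A u (m d : R) : measurable A ->
  leb R n A = m%:E -> 0 < m -> 0 < n%:R + s * p -> 0 < p ->
  (forall x y, A x -> A y -> enorm (x - y) <= d) -> 0 < d ->
  measurable_fun setT (u : Rn R n -> R) ->
  exists c : R, (m%:E * Lpow (leb R n) A p (fun x => (u x - c)%R) <=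
    (d `^ (n%:R + s * p))%:E * genergy s p A u)%E.
Proof.
move=> mA Am m0 nsp p0 Ad d0 mu_.
have mF : measurable_fun A (fun y : Rn R n =>
    \int[leb R n]_(x in A) (gkernel s p u x y)%:E)%E.
  by apply: measurable_funTS; exact: measurable_energy_density.
have F0 (y : Rn R n) : A y -> (0 <= \int[leb R n]_(x in A) (gkernel s p u x y)%:E)%E.
  by move=> _; apply: integral_ge0 => x _; rewrite lee_fin gkernel_ge0.
have [y Ay le_y] := integral_mean_le mA Am m0 mF F0.
exists (u y); rewrite -/(genergy s p A u) in le_y.
apply: (@le_trans _ _ (m%:E * ((d `^ (n%:R + s * p))%:E *
    \int[leb R n]_(x in A) (gkernel s p u x y)%:E))%E); last first.
  by rewrite muleCA; apply: lee_wpmul2l => //; rewrite lee_fin powR_ge0.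
apply: lee_wpmul2l; first by rewrite lee_fin ltW.
have mk := measurable_funTS (measurable_gkernelx y mu_) : measurable_fun A _.
rewrite -ge0_integralZl_EFin ?powR_ge0//; last by move=> x _; rewrite lee_fin gkernel_ge0.
apply: ge0_le_integral.
- exact: mA.
- by move=> x _; rewrite lee_fin powR_ge0.
- apply: measurable_Lpow_fun; apply: measurable_funTS.
  by apply: measurable_funB => //; exact: measurable_cst.
- exact: measurable_funeM.
- move=> x Ax; rewrite -EFinM lee_fin /gkernel.
  have [->|xy] := eqVneq (u x - u y) 0.
    by rewrite normr0 powR0 ?gt_eqF// mul0r mulr0.
  have e0 : 0 < enorm (x - y).
    rewrite lt_neqAle enorm_ge0 andbT; apply/eqP => e0; move: xy.
    by rewrite (enorm_eq0 (esym e0)) subrr eqxx.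
  rewrite mulrCA ler_peMr ?powR_ge0// ler_pdivlMr ?powR_gt0// mul1r.
  by rewrite ge0_ler_powR ?nnegrE ?enorm_ge0 ?(ltW nsp) ?(ltW d0)// Ad.
Qed.

(** The pairs of points that lie in two different sets Q i only add to the
energy of the whole space. *)
Lemma genergy_trivIset (Q : nat -> set (Rn R n)) u :
  (forall i, measurable (Q i)) -> trivIset setT Q ->
  measurable_fun setT (u : Rn R n -> R) ->
  (\sum_(0 <= i <oo) genergy s p (Q i) u <= genergy s p setT u)%E.
Proof.
move=> mQ tQ mu_.
have mF := measurable_energy_density (@measurableT _ (Rn R n)) mu_.
have F0 (y : Rn R n) : (0 <= \int[leb R n]_(x in setT) (gkernel s p u x y)%:E)%E.
  by apply: integral_ge0 => x _; rewrite lee_fin gkernel_ge0.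
apply: (@le_trans _ _ (\sum_(0 <= i <oo) \int[leb R n]_(y in Q i)
    \int[leb R n]_(x in setT) (gkernel s p u x y)%:E)%E).
  apply: lee_nneseries => [i _ _|i _]; first exact: genergy_ge0.
  apply: ge0_le_integral.
  - exact: mQ.
  - by move=> y _; apply: integral_ge0 => x _; rewrite lee_fin gkernel_ge0.
  - by apply: measurable_funTS; exact: measurable_energy_density.
  - by apply: measurable_funTS; exact: mF.
  - move=> y _; apply: ge0_subset_integral.
    + exact: mQ.
    + exact: measurableT.
    + exact: measurable_gkernelx.
    + by move=> x _; rewrite lee_fin gkernel_ge0.
    + by [].
rewrite -ge0_integral_bigcup; last first.
- exact: tQ.
- by move=> y _; exact: F0.
- by apply: measurable_funTS; exact: mF.
- exact: mQ.
apply: ge0_subset_integral.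
- by apply: bigcup_measurable => i _; exact: mQ.
- exact: measurableT.
- exact: mF.
- by move=> y _; exact: F0.
- by [].
Qed.

Lemma genergy_subset (E1 E2 : set (Rn R n)) u : measurable E1 ->
  measurable E2 -> E1 `<=` E2 ->
  measurable_fun setT (u : Rn R n -> R) ->
  (genergy s p E1 u <= genergy s p E2 u)%E.
Proof.
move=> m1 m2 E12 mu_.
have F0 E (y : Rn R n) : (0 <= \int[leb R n]_(x in E) (gkernel s p u x y)%:E)%E.
  by apply: integral_ge0 => x _; rewrite lee_fin gkernel_ge0.
apply: (@le_trans _ _ (\int[leb R n]_(y in E1) \int[leb R n]_(x in E2)
    (gkernel s p u x y)%:E)%E).
  apply: ge0_le_integral.
  - exact: m1.
  - by move=> y _; exact: F0.
  - by apply: measurable_funTS; exact: measurable_energy_density.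
  - by apply: measurable_funTS; exact: measurable_energy_density.
  - move=> y _; apply: ge0_subset_integral.
    + exact: m1.
    + exact: m2.
    + by apply: measurable_funTS; exact: measurable_gkernelx.
    + by move=> x _; rewrite lee_fin gkernel_ge0.
    + exact: E12.
apply: ge0_subset_integral; [exact: m1|exact: m2| |by move=> y _; exact: F0|exact: E12].
by apply: measurable_funTS; exact: measurable_energy_density.
Qed.

End genergy.

(** * Dyadic step functions *)

Section dyadic.
Variables (R : realType) (n : nat).
Implicit Types (k : nat) (x y : 'rV[R]_n) (z : {ffun 'I_n -> int}).

Definition side k : R := 2^-1 ^+ k.

Definition gidx k x : {ffun 'I_n -> int} :=
  [ffun i => Num.floor (x ord0 i * 2 ^+ k)].

Definition dcube k z : set (Rn R n) :=
  cube (fun i => (z i)%:~R * side k) (side k).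

Definition step k (c : {ffun 'I_n -> int} -> R) : Rn R n -> R :=
  fun x => c (gidx k x).

Lemma side_gt0 k : 0 < side k.
Proof. by rewrite exprn_gt0// invr_gt0. Qed.

Lemma side_powR k (a : R) : side k `^ a = (2^-1 `^ a) ^+ k.
Proof.
have h0 : 0 <= 2^-1 :> R by rewrite invr_ge0.
by rewrite -(powR_mulrn k (powR_ge0 _ _)) powRAC powR_mulrn.
Qed.

Lemma sideV k : side k = (2 ^+ k)^-1.
Proof. by rewrite /side exprVn. Qed.

Lemma dcubeP k z x : dcube k z x <-> gidx k x = z.
Proof.
have t0 : 0 < 2 ^+ k :> R by rewrite exprn_gt0.
have E (z' : {ffun 'I_n -> int}) i : ((z' i)%:~R * side k <= x ord0 i < (z' i)%:~R * side k + side k) =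
    ((z' i)%:~R <= x ord0 i * 2 ^+ k < (z' i + 1)%:~R).
  rewrite sideV ler_pdivrMr//; congr (_ && _).
  by rewrite -[X in _ + X]mul1r -mulrDl ltr_pdivlMr// intrD.
split=> [xz|<- i].
  by apply/ffunP => i; rewrite ffunE; apply: floor_def; rewrite -E; exact: xz.
by rewrite /= E ffunE floor_itv.
Qed.

Lemma measurable_dcube k z : measurable (dcube k z).
Proof. by apply: measurable_Borel_Rn; exact: measurable_cube. Qed.

Lemma leb_dcube k z : leb R n (dcube k z) = (side k ^+ n)%:E.
Proof. by rewrite leb_cube// ltW// side_gt0. Qed.

Lemma dcube_coord k x y i : gidx k x = gidx k y ->
  `|x ord0 i - y ord0 i| <= side k.
Proof.
move=> /dcubeP/(_ i) /andP[xl xr].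
have /(_ i) /andP[yl yr] := (dcubeP k _ y).2 erefl.
rewrite ler_norml; apply/andP; split; lra.
Qed.

(** The cubes of generation k, as a sequence: countable additivity is stated for
sequences, so the integer vectors are numbered, and the numbers that code no
vector are given the empty set. *)
Definition ncube k (i : nat) : set (Rn R n) :=
  if pickle_inv i is Some z then dcube k z else set0.

Lemma measurable_ncube k i : measurable (ncube k i).
Proof. by rewrite /ncube; case: pickle_inv => [z|]; [exact: measurable_dcube|exact: measurable0]. Qed.

Lemma ncubeP k i x : ncube k i x <-> pickle (gidx k x) = i.
Proof.
rewrite /ncube; split=> [|<-]; last by rewrite pickleK_inv; apply/dcubeP.
by have := @pickle_invK {ffun 'I_n -> int} i; case: pickle_inv => //= z <- /dcubeP ->.
Qed.

Lemma trivIset_ncube k : trivIset setT (ncube k).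
Proof. by move=> i j _ _ [x [/ncubeP <- /ncubeP <-]]. Qed.

Lemma bigcup_ncube k : \bigcup_i ncube k i = setT.
Proof.
by apply/seteqP; split => // x _; exists (pickle (gidx k x)) => //; apply/ncubeP.
Qed.

Lemma measurable_step k (c : {ffun 'I_n -> int} -> R) :
  measurable_fun setT (step k c).
Proof.
move=> _ Y mY; rewrite setTI.
rewrite (_ : _ @^-1` _ = \bigcup_(i in [set i | if pickle_inv i is Some z
    then Y (c z) else False]) ncube k i).
  by apply: bigcup_measurable => i _; exact: measurable_ncube.
apply/seteqP; split => x.
  move=> /= Yx; exists (pickle (gidx k x)); last exact/ncubeP.
  by rewrite /= pickleK_inv.
by move=> [i /= + /ncubeP ix]; rewrite -ix pickleK_inv.
Qed.

(** The cube of x alone contributes the left-hand side to the integral. *)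
Lemma step_sup k (c : {ffun 'I_n -> int} -> R) (p : R) x :
  ((side k ^+ n * `|step k c x| `^ p)%:E <= Lpow (leb R n) setT p (step k c))%E.
Proof.
have mS := measurable_step k c.
have mQ := measurable_dcube k (gidx k x).
have <- : (\int[leb R n]_(y in dcube k (gidx k x)) (`|step k c y| `^ p)%:E =
    (side k ^+ n * `|step k c x| `^ p)%:E)%E.
  transitivity (\int[leb R n]_(y in dcube k (gidx k x))
      cst (`|step k c x| `^ p)%:E y)%E.
    by apply: eq_integral => y /set_mem /dcubeP xy; rewrite /step xy.
  by rewrite integral_cst// leb_dcube EFinM muleC.
apply: ge0_subset_integral; [exact: mQ|exact: measurableT| | |by []].
- exact: measurable_Lpow_fun.
- by move=> y _; rewrite lee_fin powR_ge0.
Qed.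

End dyadic.

Arguments side {R} k.
Arguments dcube {R n} k z.
Arguments ncube {R n} k i.

Section dyadic_approximation.
Variables (R : realType) (n : nat) (s p H : R) (u : Rn R n -> R).
Hypotheses (n0 : (0 < n)%N) (s0 : 0 < s) (p0 : 0 < p) (H0 : 0 <= H).
Hypothesis mu_ : measurable_fun setT u.
Hypothesis uH : (genergy s p setT u <= H%:E)%E.

Let al := n%:R + s * p.
Let al0 : 0 < al. Proof. by rewrite ltr_wpDl ?mulr_gt0. Qed.

Lemma measurable_subr (c : R) : measurable_fun setT (fun x => u x - c).
Proof. by apply: measurable_funB => //; exact: measurable_cst. Qed.

Lemma cube_good_value k (z : {ffun 'I_n -> int}) : exists c : R,
  (Lpow (leb R n) (dcube k z) p (fun x => u x - c)%R <=
    ((n%:R * side k) `^ al / side k ^+ n)%:E * genergy s p (dcube k z) u)%E.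
Proof.
have d0 := side_gt0 R k.
have dn0 : 0 < side k ^+ n :> R by rewrite exprn_gt0.
have nd0 : 0 < n%:R * side k :> R by rewrite mulr_gt0// ltr0n.
have diam (x y : 'rV[R]_n) : dcube k z x -> dcube k z y -> enorm (x - y) <= n%:R * side k.
  move=> /dcubeP xz /dcubeP yz; apply: enorm_le (ltW d0) _ => i.
  by rewrite !mxE; apply: dcube_coord; rewrite xz yz.
have [c cP] := good_value (@measurable_dcube R n k z) (leb_dcube R k z) dn0 al0 p0
  diam nd0 mu_.
exists c.
have -> : (n%:R * side k) `^ al / side k ^+ n =
  (side k ^+ n)^-1 * (n%:R * side k) `^ al by rewrite mulrC.
by rewrite EFinM -muleA lee_pdivlMl.
Qed.

Lemma genergy_le (E : set (Rn R n)) : measurable E ->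
  (genergy s p E u <= H%:E)%E.
Proof.
move=> mE; apply: le_trans uH.
by apply: genergy_subset; [exact: mE|exact: measurableT|by []|exact: mu_].
Qed.

(** The step function of generation k takes on each cube a good value of u. The
cubes are disjoint, so the local errors add up to a multiple of the energy; and
neighbouring values are compared through a good value on the union of the two
cubes. *)
Lemma dyadic_steps : exists c : nat -> {ffun 'I_n -> int} -> R,
  (forall k, (Lpow (leb R n) setT p (fun x => u x - step k (c k) x)%R <=
     (n%:R `^ al * H * (2^-1 `^ (s * p)) ^+ k)%:E)%E) /\
  (forall k (x y : 'rV[R]_n), (forall i, `|x ord0 i - y ord0 i| <= side k) ->
     `|step k (c k) x - step k (c k) y| `^ p <=
       (2 `^ p * (2 * (2 `^ p * (2 * ((3 * n)%:R `^ al * H))))) *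
       (2^-1 `^ (s * p - n%:R)) ^+ k).
Proof.
have d0 k := side_gt0 R k.
have dn0 k : 0 < side k ^+ n :> R by rewrite exprn_gt0.
have mQ k z := @measurable_dcube R n k z.
have mS k c := @measurable_step R n k c.
have /choice[c0 c0P] := fun kz => cube_good_value kz.1 kz.2.
pose c k z := c0 (k, z).
have cP k z := c0P (k, z); rewrite /= in cP.
exists c; split=> [k|k x y xy].
- have E : forall r : R, n%:R `^ al * r * (2^-1 `^ (s * p)) ^+ k =
      ((n%:R * side k) `^ al / side k ^+ n) * r.
    move=> r; rewrite powRM ?ler0n ?(ltW (d0 k))// -side_powR.
    have -> : side k `^ al = side k ^+ n * side k `^ (s * p).
      rewrite /al powRD ?powR_mulrn ?(ltW (d0 k))//.
      by rewrite (gt_eqF (d0 k)) implybT.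
    by field; rewrite gt_eqF.
  rewrite E EFinM.
  rewrite /Lpow -(bigcup_ncube R n k) ge0_integral_bigcup; last first.
  + exact: trivIset_ncube.
  + by move=> x _; rewrite lee_fin powR_ge0.
  + apply: measurable_funTS; apply: measurable_Lpow_fun.
    by apply: measurable_funB.
  + exact: measurable_ncube.
  apply: (@le_trans _ _ (\sum_(0 <= i <oo)
      ((n%:R * side k) `^ al / side k ^+ n)%:E * genergy s p (ncube k i) u)%E).
    apply: lee_nneseries => [i _ _|i _].
      by apply: integral_ge0 => x _; rewrite lee_fin powR_ge0.
    rewrite /ncube; case: pickle_inv => [z|]; last first.
      by rewrite integral_set0 mule_ge0 ?genergy_ge0// lee_fin divr_ge0 ?powR_ge0// ltW.
    apply: le_trans (cP k z); rewrite le_eqVlt; apply/orP; left; apply/eqP.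
    by apply: eq_integral => x /set_mem /dcubeP xz; rewrite /step xz.
  rewrite nneseriesZl; last by move=> i _; exact: genergy_ge0.
  apply: lee_wpmul2l; first by rewrite lee_fin divr_ge0 ?powR_ge0// ltW.
  apply: le_trans uH; apply: genergy_trivIset => //.
  + exact: measurable_ncube.
  + exact: trivIset_ncube.
- pose B : set (Rn R n) := dcube k (gidx k x) `|` dcube k (gidx k y).
  have mB : measurable B by apply: measurableU; exact: mQ.
  have QB : dcube k (gidx k x) `<=` B by exact: subsetUl.
  have Q'B : dcube k (gidx k y) `<=` B by exact: subsetUr.
  have Bfin : leb R n B \is a fin_num.
    rewrite ge0_fin_numE//; apply: (@le_lt_trans _ _
        (leb R n (dcube k (gidx k x)) + leb R n (dcube k (gidx k y)))%E).
      by apply: measureU2; exact: mQ.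
    by rewrite !leb_dcube ltry.
  have mside : side k ^+ n <= fine (leb R n B).
    rewrite -lee_fin fineK// -(leb_dcube R k (gidx k x)).
    by apply: le_measure => //; rewrite inE//; exact: mQ.
  have diam (v w : 'rV[R]_n) : B v -> B w -> enorm (v - w) <= (3 * n)%:R * side k.
    move=> Bv Bw; rewrite mulnC natrM -mulrA; apply: enorm_le.
      by rewrite mulr_ge0// ltW.
    move=> i; rewrite !mxE.
    have near (v' x' : 'rV[R]_n) : dcube k (gidx k x') v' ->
        - side k <= v' ord0 i - x' ord0 i <= side k.
      by move=> /dcubeP /(dcube_coord i); rewrite ler_norml.
    have := xy i; have := d0 k; rewrite !ler_norml => ? /andP[? ?].
    by case: Bv => /near/andP[? ?]; case: Bw => /near/andP[? ?];
      apply/andP; split; lra.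
  have K0 : 0 < (3 * n)%:R * side k :> R by rewrite mulr_gt0// ltr0n muln_gt0.
  have [b bP] := good_value mB (esym (fineK Bfin)) (lt_le_trans (dn0 k) mside)
    al0 p0 diam K0 mu_.
  pose K := ((3 * n)%:R * side k) `^ al * H.
  have K_ge0 : 0 <= K by rewrite mulr_ge0 ?powR_ge0.
  have bB : (Lpow (leb R n) B p (fun x => u x - b)%R <= (K / side k ^+ n)%:E)%E.
    rewrite mulrC EFinM lee_pdivlMl//.
    apply: (@le_trans _ _ ((fine (leb R n B))%:E * Lpow (leb R n) B p (fun x => u x - b)%R)%E).
      by apply: lee_wpmul2r; rewrite ?lee_fin// Lpow_ge0.
    apply: le_trans bP _; rewrite /K EFinM; apply: lee_wpmul2l.
      by rewrite lee_fin powR_ge0.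
    exact: genergy_le.
  have cb z : dcube k z `<=` B -> `|c k z - b| `^ p <=
      2 `^ p * (2 * ((3 * n)%:R `^ al * H)) * (2^-1 `^ (s * p - n%:R)) ^+ k.
    move=> zB.
    have cz : (Lpow (leb R n) (dcube k z) p (fun x => u x - c k z)%R <=
        (K / side k ^+ n)%:E)%E.
      apply: le_trans (cP k z) _; apply: (@le_trans _ _
          (((n%:R * side k) `^ al / side k ^+ n)%:E * H%:E)%E).
        apply: lee_wpmul2l; last by apply: genergy_le; exact: mQ.
        by rewrite lee_fin divr_ge0 ?powR_ge0// ltW.
      rewrite -EFinM lee_fin /K mulrAC ler_wpM2r ?invr_ge0 ?(ltW (dn0 k))//.
      rewrite ler_wpM2r// ge0_ler_powR ?nnegrE ?(ltW al0) ?mulr_ge0 ?(ltW (d0 k))//.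
      by rewrite ler_wpM2r ?(ltW (d0 k))// ler_nat leq_pmull.
    have bz : (Lpow (leb R n) (dcube k z) p (fun x => u x - b)%R <=
        (K / side k ^+ n)%:E)%E.
      apply: le_trans bB; apply: ge0_subset_integral; [exact: mQ|exact: mB| | |exact: zB].
        by apply: measurable_Lpow_fun; apply: measurable_funTS; exact: measurable_subr.
      by move=> w _; rewrite lee_fin powR_ge0.
    have : (Lpow (leb R n) (dcube k z) p (cst (c k z - b)%R) <=
        (2 `^ p)%:E * ((K / side k ^+ n)%:E + (K / side k ^+ n)%:E))%E.
      have tri := @Lpow_triangle _ _ R (leb R n) (dcube k z) (mQ k z) p
        (cst (c k z - b)%R) (fun x => (u x - c k z)%R) (fun x => (u x - b)%R) (ltW p0).
      apply: le_trans (tri _ _ _ _) _.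
      + exact: measurable_cst.
      + by apply: measurable_funTS; exact: measurable_subr.
      + by apply: measurable_funTS; exact: measurable_subr.
      + move=> w _ /=.
        have -> : c k z - b = u w - b - (u w - c k z) by ring.
        by rewrite [leRHS]addrC; exact: ler_normB.
      + apply: lee_wpmul2l; first by rewrite lee_fin powR_ge0.
        by apply: leeD; [exact: cz|exact: bz].
    have -> : Lpow (leb R n) (dcube k z) p (cst (c k z - b)%R) =
        (`|c k z - b| `^ p * side k ^+ n)%:E.
      by have := integral_cst (leb R n) (mQ k z) (`|c k z - b| `^ p)%:E;
        rewrite leb_dcube -EFinM => <-.
    rewrite -EFinD -!EFinM lee_fin -ler_pdivlMr// => /le_trans; apply.
    rewrite le_eqVlt; apply/orP; left; apply/eqP.
    rewrite -side_powR powRB ?powR_mulrn ?(ltW (d0 k))//; last first.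
      by rewrite (gt_eqF (d0 k)) implybT.
    rewrite /K powRM ?(ltW (d0 k))//.
    have -> : side k `^ al = side k ^+ n * side k `^ (s * p).
      rewrite /al powRD ?powR_mulrn ?(ltW (d0 k))//.
      by rewrite (gt_eqF (d0 k)) implybT.
    by field; rewrite gt_eqF.
  rewrite -mulrA [X in _ * X](_ : _ =
     2 `^ p * (2 * ((3 * n)%:R `^ al * H)) * (2^-1 `^ (s * p - n%:R)) ^+ k +
     2 `^ p * (2 * ((3 * n)%:R `^ al * H)) * (2^-1 `^ (s * p - n%:R)) ^+ k); last by ring.
  apply: (@le_trans _ _ (2 `^ p * (`|c k (gidx k x) - b| `^ p + `|c k (gidx k y) - b| `^ p))).
    apply: le_trans (powRD_le (ltW p0) _ _) => //.
    rewrite ge0_ler_powR ?nnegrE ?(ltW p0) ?addr_ge0//.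
    rewrite /step; have -> : c k (gidx k x) - c k (gidx k y) =
      (c k (gidx k x) - b) - (c k (gidx k y) - b) by ring.
    exact: ler_normB.
  by rewrite ler_wpM2l ?powR_ge0// lerD ?cb.
Qed.

End dyadic_approximation.

(** * Uniform approximation of bounded sets of W^{s,p} *)

(** The balls of W^{s,p}(R^n), up to powers and constants in the norms. *)
Definition energy_bounded (R : realType) (n : nat) (s p H : R)
    (u : Rn R n -> R) :=
  [/\ measurable_fun setT u, (Lpow (leb R n) setT p u <= H%:E)%E &
      (genergy s p setT u <= H%:E)%E].

(** Each cube of generation k.+1 lies in a single cube of generation k, so a step
function of generation k is also one of generation k.+1. *)
Lemma gidx_nested (R : realType) n k (x : 'rV[R]_n) :
  gidx k x = [ffun i => (gidx k.+1 x i %/ 2)%Z].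
Proof.
apply/ffunP => i; rewrite !ffunE; apply: floor_def.
set t := x ord0 i * 2 ^+ k.+1.
have -> : x ord0 i * 2 ^+ k = t / 2 by rewrite /t exprSr; field.
have /andP[zl zr] := floor_itv t.
set z := Num.floor t in zl zr *.
have e := divz_eq z 2; have m0 := modz_ge0 z (isT : 2 != 0 :> int).
have m2 := ltz_pmod z (isT : 0 < 2 :> int).
have two (w : int) : w%:~R * 2 = (w * 2)%:~R :> R by rewrite intrM.
rewrite ler_pdivlMr// ltr_pdivrMr// !two; apply/andP; split.
  by apply: le_trans zl; rewrite ler_int; lia.
by apply: lt_le_trans zr _; rewrite ler_int; lia.
Qed.

Lemma powR_lt1 (R : realType) (a t : R) : 0 < a -> 0 <= t < 1 -> t `^ a < 1.
Proof.
move=> a0 /andP[t0 t1]; apply: (@lt_le_trans _ _ (1 `^ a)); last by rewrite powR1.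
by apply: gt0_ltr_powR => //; rewrite nnegrE.
Qed.

Section approximation.
Variables (R : realType) (n : nat) (s p H : R).
Hypotheses (n0 : (0 < n)%N) (s0 : 0 < s) (p0 : 0 < p) (H0 : 0 <= H).

Let r : R := 2^-1 `^ (s * p).
Let r01 : 0 < r < 1.
Proof.
rewrite /r powR_gt0 ?invr_gt0//=.
by rewrite powR_lt1 ?mulr_gt0// invr_ge0 ler0n invf_lt1// ltr1n.
Qed.

Let C0 : R := n%:R `^ (n%:R + s * p) * H.
Let C1 : R := 2 `^ p * (C0 + C0).
Let C0_ge0 : 0 <= C0. Proof. by rewrite mulr_ge0 ?powR_ge0. Qed.
Let C1_ge0 : 0 <= C1. Proof. by rewrite mulr_ge0 ?powR_ge0// addr_ge0. Qed.

(* The L^q powers of the increments decrease with ratio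
   rho q = 2^(-(s q - n (q - p) / p)), written as the product of the ratio r of
   their L^p powers and of that of the (q - p)-th powers of their sup norms. *)
Let rho (q : R) := r * (2 ^+ n * r) `^ ((q - p) / p).
Let rho01 (q : R) : p <= q -> n%:R * (q - p) < s * p * q -> 0 < rho q < 1.
Proof.
move=> pq npq; have /andP[r0 r1] := r01.
have tr0 : 0 < 2 ^+ n * r by rewrite mulr_gt0// exprn_gt0.
rewrite {1}/rho mulr_gt0 ?powR_gt0//=.
have -> : rho q = 2^-1 `^ (s * q - n%:R * ((q - p) / p)).
  rewrite /rho; have -> : 2 ^+ n = 2^-1 `^ (- n%:R) :> R.
    by rewrite powRN powR_mulrn ?invr_ge0// exprVn invrK.
  have hD (a b : R) : 2^-1 `^ (a + b) = 2^-1 `^ a * 2^-1 `^ b :> R.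
    by rewrite powRD// invr_neq0 ?implybT// pnatr_eq0.
  rewrite /r -[_ * 2^-1 `^ (s * p)]hD -powRrM -hD.
  by congr (_ `^ _); field; rewrite gt_eqF.
apply: powR_lt1; last by rewrite invr_ge0 ler0n invf_lt1// ltr1n.
rewrite subr_gt0 mulrA ltr_pdivrMr//.
by rewrite mulrAC.
Qed.

Let C2 (q : R) := C1 * (C1 * 2 ^+ n) `^ ((q - p) / p) *
  ((1 - rho q `^ (2 * q)^-1) `^ q * (1 - Num.sqrt (rho q)))^-1.

Section increments.
Variables (u : Rn R n -> R) (c : nat -> {ffun 'I_n -> int} -> R).
Hypothesis mu_ : measurable_fun setT u.
Hypothesis uc : forall k,
  (Lpow (leb R n) setT p (fun x => u x - step k (c k) x)%R <= (C0 * r ^+ k)%:E)%E.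

Let S k := step k (c k) : Rn R n -> R.
Let mS k : measurable_fun setT (S k). Proof. exact: measurable_step. Qed.
Let muS k : measurable_fun setT (fun x => u x - S k x).
Proof. by apply: measurable_funB. Qed.

Lemma steps_ae_cvg : {ae leb R n, forall x, S k x @[k --> \oo] --> u x}.
Proof.
have := @ae_cvg0_Lpow _ _ R (leb R n) setT (@measurableT _ (Rn R n)) p C0 r
  (fun k x => (u x - S k x)%R) p0 C0_ge0 r01 muS uc.
apply: filterS => x /(_ I) ux.
have -> : S ^~ x = (fun k => u x - (u x - S k x)) by apply/funext => k; ring.
by rewrite -[X in _ --> X]subr0; apply: cvgB => //; exact: cvg_cst.
Qed.

Lemma increments_Lpow j :
  (Lpow (leb R n) setT p (fun x => S j.+1 x - S j x)%R <= (C1 * r ^+ j)%:E)%E.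
Proof.
have tri := @Lpow_triangle _ _ R (leb R n) setT (@measurableT _ (Rn R n)) p
  (fun x => S j.+1 x - S j x)%R (fun x => u x - S j x)%R
  (fun x => u x - S j.+1 x)%R (ltW p0).
apply: le_trans (tri _ _ _ _) _.
- by apply: measurable_funB.
- exact: muS.
- exact: muS.
- move=> x _; have -> : S j.+1 x - S j x = u x - S j x - (u x - S j.+1 x) by ring.
  exact: ler_normB.
rewrite /C1 -mulrA EFinM; apply: lee_wpmul2l; first by rewrite lee_fin powR_ge0.
rewrite mulrDl EFinD; apply: leeD; first exact: uc.
apply: le_trans (uc j.+1) _; rewrite lee_fin ler_wpM2l//.
by have /andP[? ?] := r01; rewrite exprS ler_piMl ?ltW// exprn_gt0.
Qed.

(** The increment is a step function of generation j.+1, whose cubes have measure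
2^(-n (j+1)); dividing the L^p bound by it bounds every value. *)
Lemma increments_sup j x :
  `|S j.+1 x - S j x| `^ p <= C1 * 2 ^+ n * (2 ^+ n * r) ^+ j.
Proof.
have dE : (fun x => S j.+1 x - S j x) =
    step j.+1 (fun z => c j.+1 z - c j [ffun i => (z i %/ 2)%Z]).
  by apply/funext => y; rewrite /S /step -gidx_nested.
have := increments_Lpow j; rewrite dE.
move=> /(le_trans (step_sup _ _ _ x)); rewrite -dE lee_fin.
rewrite mulrC -ler_pdivlMr ?exprn_gt0 ?side_gt0// => /le_trans; apply.
rewrite sideV exprVn invrK -exprM mulnC exprM exprS exprMn.
by rewrite le_eqVlt; apply/orP; left; apply/eqP; ring.
Qed.

(** Interpolation: |f|^q <= (sup |f|)^(q-p) |f|^p. *)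
Lemma increments_Lpow_high (q : R) : p <= q -> forall j,
  (Lpow (leb R n) setT q (fun x => S j.+1 x - S j x)%R <=
   (C1 * (C1 * 2 ^+ n) `^ ((q - p) / p) * rho q ^+ j)%:E)%E.
Proof.
move=> pq j; set th := (q - p) / p.
have th0 : 0 <= th by rewrite divr_ge0 ?subr_ge0// ltW.
pose B := (C1 * 2 ^+ n * (2 ^+ n * r) ^+ j) `^ th.
have /andP[r0 r1] := r01.
have tr0 : 0 <= 2 ^+ n * r by rewrite mulr_ge0// ltW.
have B0 : 0 <= C1 * 2 ^+ n by rewrite mulr_ge0.
have X0 : 0 <= C1 * 2 ^+ n * (2 ^+ n * r) ^+ j by rewrite mulr_ge0// exprn_ge0.
have mD : measurable_fun setT (fun x => S j.+1 x - S j x) by apply: measurable_funB.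
apply: (@le_trans _ _ (B%:E * Lpow (leb R n) setT p (fun x => S j.+1 x - S j x)%R)%E).
  rewrite -integralZ_Lpow ?powR_ge0//.
  apply: ge0_le_integral.
  - exact: measurableT.
  - by move=> x _; rewrite lee_fin powR_ge0.
  - exact: measurable_Lpow_fun.
  - apply/measurable_EFinP; apply: measurable_funM; first exact: measurable_cst.
    by apply/measurable_EFinP; exact: measurable_Lpow_fun.
  - move=> x _; rewrite lee_fin.
    have -> : q = p * th + p by rewrite /th; field; rewrite gt_eqF.
    rewrite powRD; last first.
      by rewrite (_ : (_ == 0) = false)//; apply: gt_eqF; rewrite ltr_wpDl// mulr_ge0// ltW.
    rewrite ler_wpM2r ?powR_ge0// powRrM /B.
    apply: ge0_ler_powR; rewrite ?nnegrE ?powR_ge0//.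
    exact: increments_sup.
apply: (@le_trans _ _ (B%:E * (C1 * r ^+ j)%:E)%E).
  by apply: lee_wpmul2l; [rewrite lee_fin powR_ge0|exact: increments_Lpow].
rewrite -EFinM lee_fin /B powRM// ?exprn_ge0//.
have -> : ((2 ^+ n * r) ^+ j) `^ th = ((2 ^+ n * r) `^ th) ^+ j.
  by rewrite -(powR_mulrn j (powR_ge0 _ _)) powRAC powR_mulrn.
by rewrite /rho -/th [in leRHS]exprMn le_eqVlt; apply/orP; left; apply/eqP; ring.
Qed.

(** The increments are summable in L^q by [increments_Lpow_high], and their sum
is u - S k because the step functions converge to u almost everywhere. *)
Lemma steps_Lpow_high (q : R) : p <= q ->
  n%:R * (q - p) < s * p * q ->
  forall k, (Lpow (leb R n) setT q (fun x => u x - S k x)%R <=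
   (C2 q * rho q ^+ k)%:E)%E.
Proof.
move=> pq npq k; have /andP[r0 r1] := r01.
have q0 : 0 < q by exact: lt_le_trans pq.
have th0 : 0 <= (q - p) / p by rewrite divr_ge0 ?subr_ge0// ltW.
have tr0 : 0 < 2 ^+ n * r by rewrite mulr_gt0// exprn_gt0.
have rr01 := rho01 pq npq.
set cq := C1 * (C1 * 2 ^+ n) `^ ((q - p) / p).
have cq0 : 0 <= cq * rho q ^+ k.
  have /andP[/ltW rh0 _] := rr01.
  by apply: mulr_ge0; [rewrite /cq mulr_ge0 ?powR_ge0|exact: exprn_ge0].
have inc j : (Lpow (leb R n) setT q (fun x => S (k + j.+1)%N x - S (k + j)%N x)%R <=
    (cq * rho q ^+ k * rho q ^+ j)%:E)%E.
  by rewrite addnS -mulrA -exprD; exact: increments_Lpow_high.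
have lim : {ae leb R n, forall x, setT x -> S (k + j)%N x @[j --> \oo] --> u x}.
  apply: filterS steps_ae_cvg => x Sx _.
  by under eq_fun do rewrite addnC; apply: cvg_comp Sx; exact: cvg_addnr.
have := Lpow_telescope (@measurableT _ (Rn R n)) q0 cq0 rr01 (fun j => mS (k + j)%N)
  inc mu_ lim.
by rewrite addn0 /C2 -/cq mulrAC.
Qed.

End increments.

(** A rate of convergence that is common to all functions of bounded energy. The
bound M k on the values of the step functions, which depends on k, makes
their coefficients range over bounded intervals. *)
Lemma step_approximation (q : R) : p <= q -> n%:R * (q - p) < s * p * q ->
  exists C rho : R, exists M : nat -> R, [/\ 0 <= C, 0 < rho < 1 &
    forall u, energy_bounded s p H u ->
    exists c : nat -> {ffun 'I_n -> int} -> R,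
      (forall k, (Lpow (leb R n) setT q (fun x => u x - step k (c k) x)%R <=
         (C * rho ^+ k)%:E)%E) /\
      (forall k (x : Rn R n), `|step k (c k) x| <= M k)].
Proof.
move=> pq npq; have rr01 := rho01 pq npq; have /andP[rr0 rr1] := rr01.
have q0 : 0 < q by exact: lt_le_trans pq.
have C2_ge0 : 0 <= C2 q.
  have d1 : 0 < 1 - Num.sqrt (rho q).
    by rewrite subr_gt0 -[ltRHS]sqrtr1 ltr_sqrt.
  apply: mulr_ge0; first by apply: mulr_ge0; [exact: C1_ge0|exact: powR_ge0].
  rewrite invr_ge0; apply: mulr_ge0; [exact: powR_ge0|exact: ltW].
(* M k comes from [step_sup]: the L^p power of the step function is at most
   2^p times those of u and of the error, and is divided by the measure of a
   cube. *)
exists (C2 q), (rho q), (fun k => ((2 `^ p * (H + C0 * r ^+ k)) / side k ^+ n) `^ p^-1).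
split=> // u [mu_ uH eH].
have [c [c1 _]] := dyadic_steps n0 s0 p0 H0 mu_ eH.
exists c; split=> [k|k x]; first exact: (steps_Lpow_high (c := c)).
have /andP[r0 r1] := r01.
have d0 : 0 < side k ^+ n :> R by rewrite exprn_gt0// side_gt0.
have -> : `|step k (c k) x| = (`|step k (c k) x| `^ p) `^ p^-1.
  by rewrite -powRrM mulfV ?gt_eqF// powRr1.
apply: ge0_ler_powR; rewrite ?invr_ge0 ?nnegrE ?powR_ge0 ?(ltW p0)//.
  by rewrite mulr_ge0 ?invr_ge0 ?(ltW d0)// mulr_ge0 ?powR_ge0// addr_ge0// mulr_ge0// exprn_ge0// ltW.
rewrite ler_pdivlMr// mulrC -lee_fin.
apply: le_trans (step_sup k (c k) p x) _.
have tri := @Lpow_triangle _ _ R (leb R n) setT (@measurableT _ (Rn R n)) p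
  (step k (c k)) u (fun x => u x - step k (c k) x)%R (ltW p0).
apply: le_trans (tri _ _ _ _) _.
- exact: measurable_step.
- exact: mu_.
- by apply: measurable_funB; [exact: mu_|exact: measurable_step].
- move=> y _; rewrite -{1}[step k (c k) y](subKr (u y)); exact: ler_normB.
rewrite [leRHS]EFinM; apply: lee_wpmul2l; first by rewrite lee_fin powR_ge0.
by rewrite EFinD; apply: leeD; [exact: uH|exact: c1].
Qed.

Lemma dyadic_scale (e : R) : 0 < e <= 1 ->
  exists k, e <= side k /\ side k <= 2 * e.
Proof.
move=> /andP[e0 e1].
have [m me] : exists m, (side m : R) < e.
  have /cvgrPdist_lt/(_ _ e0)[m _ mP] : (2^-1 ^+ k : R) @[k --> \oo] --> (0 : R).
    by apply: cvg_expr; rewrite ger0_norm// invf_lt1//; lra.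
  exists m; have := mP m (leqnn m).
  by rewrite sub0r normrN ger0_norm// exprn_ge0.
have [k ke kmin] := ex_minnP (ex_intro _ m me : exists m, (side m : R) < e).
case: k ke kmin => [|k] ke kmin; first by move: ke; rewrite /side expr0 ltNge e1.
exists k; split; first by rewrite leNgt; apply/negP => /kmin; rewrite ltnn.
rewrite -ler_pdivrMl// ; move: ke; rewrite /side exprS; exact: ltW.
Qed.

(** The representative v is the uniform limit of the step functions S k, with
|v - S k| <= const * 2^(-k (s - n/p)). Given x and y with |x - y| <= 1, take k
with 2^-k between |x - y| and 2 |x - y|: then x and y lie in neighbouring cubes,
and by [dyadic_steps] S k x - S k y is of the same order 2^(-k (s - n/p)). *)
Lemma hoelder_representative : n%:R < s * p ->
  exists2 C : R, 0 <= C & forall u, energy_bounded s p H u ->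
  exists v : 'rV[R]_n -> R, [/\ {ae leb R n, forall x, u x = v x},
    forall x, `|v x| <= C &
    forall x y, `|v x - v y| <= C * enorm (x - y) `^ (s - n%:R / p)].
Proof.
move=> nsp; have /andP[r0 r1] := r01.
pose ga := s - n%:R / p.
have ga0 : 0 < ga by rewrite subr_gt0 ltr_pdivrMr.
have gaE : s * p - n%:R = ga * p by rewrite /ga; field; rewrite gt_eqF.
pose t : R := 2^-1 `^ ga.
have t0 : 0 < t by rewrite powR_gt0 ?invr_gt0.
have t1 : t < 1 by rewrite powR_lt1// invr_ge0 ler0n invf_lt1// ltr1n.
have tp : 2 ^+ n * r = t `^ p.
  have -> : 2 ^+ n = 2^-1 `^ (- n%:R) :> R.
    by rewrite powRN powR_mulrn ?invr_ge0// exprVn invrK.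
  rewrite /r -powRD; last by rewrite invr_neq0 ?implybT// pnatr_eq0.
  by rewrite /t -powRrM -gaE addrC.
have proot (a : R) : 0 <= a -> (a `^ p) `^ p^-1 = a.
  by move=> a0; rewrite -powRrM mulfV ?gt_eqF// powRr1.
pose M := (C1 * 2 ^+ n) `^ p^-1.
have M0 : 0 <= M by exact: powR_ge0.
pose A := (2 `^ p * (2 * (2 `^ p * (2 * ((3 * n)%:R `^ (n%:R + s * p) * H))))) `^ p^-1.
have A0 : 0 <= A by exact: powR_ge0.
pose B := ((2 `^ p * (H + C0))) `^ p^-1.
have B0 : 0 <= B by exact: powR_ge0.
(* The first summand serves distances above 1, where the sup bound suffices; the
   second one distances up to 1, the factor 2^ga being lost in the choice of a
   dyadic scale. *)
pose C := 2 * (B + M / (1 - t)) + (2 * (M / (1 - t)) + A) * 2 `^ ga.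
have Mt0 : 0 <= M / (1 - t) by rewrite divr_ge0// subr_ge0 ltW.
have X1 : 0 <= B + M / (1 - t) by exact: addr_ge0.
have X2 : 0 <= 2 * (M / (1 - t)) + A by apply: addr_ge0 => //; exact: mulr_ge0.
have X3 : 0 <= (2 * (M / (1 - t)) + A) * 2 `^ ga by apply: mulr_ge0 => //; exact: powR_ge0.
have X4 : 0 <= 2 * (B + M / (1 - t)) by exact: mulr_ge0.
have C_ge0 : 0 <= C by exact: addr_ge0.
exists C => // u [mu_ uH eH].
have [c [c1 c2]] := dyadic_steps n0 s0 p0 H0 mu_ eH.
pose S k := step k (c k) : Rn R n -> R.
have inc x j : `|S j.+1 x - S j x| <= M * t ^+ j.
  rewrite -[leLHS]proot// /M -[t ^+ j]proot ?exprn_ge0 ?(ltW t0)//.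
  have c20 : 0 <= C1 * 2 ^+ n by apply: mulr_ge0; [exact: C1_ge0|exact: exprn_ge0].
  rewrite -powRM ?powR_ge0//.
  apply: ge0_ler_powR; rewrite ?invr_ge0 ?nnegrE ?powR_ge0 ?(ltW p0)//.
    by apply: mulr_ge0; [apply: mulr_ge0; [exact: C1_ge0|exact: exprn_ge0]|exact: powR_ge0].
  apply: le_trans (increments_sup mu_ c1 j x) _.
  by rewrite tp -(powR_mulrn j (powR_ge0 _ _)) powRAC powR_mulrn// ltW.
have t01 : 0 < t < 1 by rewrite t0.
have lim y : exists l : R, S j y @[j --> \oo] --> l.
  by have [l Sl _] := geometric_increments M0 t01 (inc y); exists l.
have /choice[v vP] := lim.
have tail x k : `|v x - S k x| <= M / (1 - t) * t ^+ k.
  have Mk0 : 0 <= M * t ^+ k by rewrite mulr_ge0// exprn_ge0// ltW.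
  have inc' j : `|S (k + j.+1)%N x - S (k + j)%N x| <= M * t ^+ k * t ^+ j.
    by rewrite addnS -mulrA -exprD; exact: inc.
  have [l Sl] := geometric_increments Mk0 t01 inc'.
  have <- : v x = l.
    have Sv : S (k + j)%N x @[j --> \oo] --> v x.
      by under eq_fun do rewrite addnC; apply: cvg_comp (vP x); exact: cvg_addnr.
    exact: cvg_unique Sv Sl.
  by rewrite addn0 mulrAC.
have bS x : `|S 0%N x| <= B.
  rewrite -[leLHS]proot// /B.
  apply: ge0_ler_powR; rewrite ?invr_ge0 ?nnegrE ?powR_ge0 ?(ltW p0)//.
    by rewrite mulr_ge0 ?powR_ge0// addr_ge0.
  rewrite -lee_fin; have := step_sup 0 (c 0%N) p x.
  rewrite /side expr0 expr1n mul1r => /le_trans; apply.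
  have tri := @Lpow_triangle _ _ R (leb R n) setT (@measurableT _ (Rn R n)) p
    (S 0%N) u (fun x => u x - S 0%N x)%R (ltW p0).
  apply: le_trans (tri _ _ _ _) _.
  - exact: measurable_step.
  - exact: mu_.
  - by apply: measurable_funB; [exact: mu_|exact: measurable_step].
  - move=> y _; rewrite -{1}[S 0%N y](subKr (u y)); exact: ler_normB.
  rewrite [leRHS]EFinM; apply: lee_wpmul2l; first by rewrite lee_fin powR_ge0.
  rewrite EFinD; apply: leeD; first exact: uH.
  by have := c1 0%N; rewrite expr0 mulr1.
have bv x : `|v x| <= B + M / (1 - t).
  rewrite -[v x](subrK (S 0%N x)) addrC; apply: le_trans (ler_normD _ _) _.
  by apply: lerD; [exact: bS|have := tail x 0%N; rewrite expr0 mulr1].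
exists v; split.
- apply: filterS (steps_ae_cvg mu_ c1) => x ux.
  exact: cvg_unique ux (vP x).
- move=> x; apply: le_trans (bv x) _; rewrite /C.
  by move: X1 X3; lra.
- move=> x y; set e := enorm (x - y).
  have e_ge0 : 0 <= e by exact: enorm_ge0.
  have [e1|e1] := leP e 1; last first.
    apply: (@le_trans _ _ (2 * (B + M / (1 - t)))).
      by apply: le_trans (ler_normB _ _) _; have := bv x; have := bv y; lra.
    apply: (@le_trans _ _ C).
      by rewrite /C lerDl.
    rewrite ler_peMr// -/ga -[leLHS](powRr0 e).
    by apply: ler_powR; exact: ltW.
  have [e0|e0] := eqVneq e 0.
    by rewrite (enorm_eq0 e0) subrr normr0 mulr_ge0 ?powR_ge0.
  have [k [ek ke]] : exists k, e <= side k /\ side k <= 2 * e.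
    by apply: dyadic_scale; rewrite e1 lt_neqAle eq_sym e0 e_ge0.
  have adj : `|S k x - S k y| <= A * t ^+ k.
    rewrite -[leLHS]proot// /A -[t ^+ k]proot ?exprn_ge0 ?(ltW t0)//.
    rewrite -powRM ?powR_ge0 ?mulr_ge0 ?powR_ge0//.
    apply: ge0_ler_powR; rewrite ?invr_ge0 ?nnegrE ?powR_ge0 ?(ltW p0)//.
      by rewrite !mulr_ge0 ?powR_ge0.
    have xy i : `|x ord0 i - y ord0 i| <= side k.
      by apply: le_trans ek; have := coord_le_enorm (x - y) i; rewrite !mxE.
    apply: le_trans (c2 k x y xy) _.
    rewrite gaE powRrM -/t.
    by rewrite -(powR_mulrn k (powR_ge0 _ _)) powRAC powR_mulrn// ltW.
  have tk : t ^+ k <= 2 `^ ga * e `^ ga.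
    rewrite /t -side_powR -powRM//.
    by apply: ge0_ler_powR; rewrite ?(ltW ga0) ?nnegrE ?(ltW (side_gt0 _ _))// mulr_ge0.
  apply: (@le_trans _ _ ((2 * (M / (1 - t)) + A) * t ^+ k)).
    have := tail x k; have := tail y k; move: adj.
    have -> : v x - v y = (v x - S k x) + (S k x - S k y) - (v y - S k y) by ring.
    move=> h1 h2 h3; apply: le_trans (ler_normB _ _) _.
    apply: le_trans (lerD (ler_normD _ _) (lexx _)) _.
    by rewrite mulrDl; lra.
  apply: (@le_trans _ _ ((2 * (M / (1 - t)) + A) * (2 `^ ga * e `^ ga))).
    by rewrite ler_wpM2l.
  by rewrite mulrA ler_wpM2r ?powR_ge0// /C lerDr.
Qed.

End approximation.

(** * Total boundedness in L^q *)

Lemma finitely_coloured_interval (R : realType) (M eta : R) : 0 < eta ->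
  finitely_coloured [set a : R | `|a| <= M] (fun a b => `|a - b| <= eta).
Proof.
move=> eta0; pose N := Num.truncn (2 * M / eta).
exists 'I_N.+1, (fun a => inord (Num.truncn ((a + M) / eta))) => a b.
rewrite /= !ler_norml => /andP[a1 a2] /andP[b1 b2] ab.
have bound x : - M <= x -> x <= M ->
    (Num.truncn ((x + M) / eta) <= N)%N /\ 0 <= (x + M) / eta.
  move=> x1 x2; split; last by rewrite divr_ge0//; lra.
  by apply: le_truncn; rewrite ler_wpM2r ?invr_ge0 ?(ltW eta0)//; lra.
have [aN a0] := bound a a1 a2; have [bN b0] := bound b b1 b2.
have /(congr1 (@nat_of_ord _)) := ab; rewrite !inordK ?ltnS// => {}ab.
have /andP[al ar] := truncn_itv a0; have /andP[bl br] := Num.Theory.truncn_itv b0.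
rewrite ab in al ar; move: al ar bl br.
have e1 (m : nat) : m.+1%:R * eta = m%:R * eta + eta by rewrite -natr1 mulrDl mul1r.
rewrite !ler_pdivlMr// !ltr_pdivrMr// !e1 => *.
apply/andP; split; lra.
Qed.

Lemma finitely_coloured_family (R : realType) (J : finType) (M eta : R) :
  0 < eta ->
  finitely_coloured [set a : J -> R | forall j, `|a j| <= M]
    (fun a b => forall j, `|a j - b j| <= eta).
Proof.
move=> eta0; have [I [psi psiP]] := @finitely_coloured_interval R M eta eta0.
exists {ffun J -> I}, (fun a => [ffun j => psi (a j)]) => a b aM bM ab j.
apply: psiP; [exact: aM|exact: bM|].
by move/ffunP: ab => /(_ j); rewrite !ffunE.
Qed.

Lemma finitely_coloured_preimage (V W : Type) (A : set V) (B : set W)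
    (f : V -> W) (small : W -> W -> Prop) :
  (forall v, A v -> B (f v)) -> finitely_coloured B small ->
  finitely_coloured A (fun v w => small (f v) (f w)).
Proof.
move=> AB [I [phi phiP]]; exists I, (phi \o f) => v w Av Aw vw.
by apply: phiP => //; exact: AB.
Qed.

Lemma finitely_colouredW (V : Type) (A : set V) (small small' : V -> V -> Prop) :
  (forall v w, A v -> A w -> small v w -> small' v w) ->
  finitely_coloured A small -> finitely_coloured A small'.
Proof.
by move=> ss [I [phi phiP]]; exists I, phi => v w Av Aw vw; apply: ss => //; exact: phiP.
Qed.

Definition box (R : realType) (n : nat) (L : nat) : set (Rn R n) :=
  cube (fun=> - L%:R) (L%:R + L%:R).
Arguments box {R n} L.

Lemma measurable_box (R : realType) n L : measurable (@box R n L).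
Proof. by apply: measurable_Borel_Rn; exact: measurable_cube. Qed.

Lemma leb_tail (R : realType) n (Om : set (Rn R n)) (e : R) :
  measurable Om -> (leb R n Om < +oo)%E -> 0 < e ->
  exists L, (leb R n (Om `\` box L) <= e%:E)%E.
Proof.
move=> mO finO e0.
have mD L : measurable (Om `\` box L) by apply: measurableD => //; exact: measurable_box.
have : leb R n (Om `\` box L) @[L --> \oo] --> leb R n (\bigcap_L (Om `\` box L)).
  apply: nonincreasing_cvg_mu => //.
  - by apply: le_lt_trans finO; apply: le_measure; rewrite ?inE.
  - by apply: bigcap_measurable; [exists 0%N|move=> L _; exact: mD].
  - move=> L L' LL'; apply/subsetPset; apply: setDS => x bx i.
    have /andP[b1 b2] := bx i; have : L%:R <= L'%:R :> R by rewrite ler_nat.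
    by move=> LL; apply/andP; split; lra.
have -> : \bigcap_L (Om `\` box L) = set0.
  apply/seteqP; split => // x /= xb.
  pose L := (\max_(i < n) (Num.truncn `|x ord0 i|)).+1.
  have [_] := xb L I; apply => i.
  have : `|x ord0 i| < L%:R.
    apply: (@lt_le_trans _ _ (Num.truncn `|x ord0 i|).+1%:R).
      by have /andP[] := truncn_itv (normr_ge0 (x ord0 i)).
    by rewrite ler_nat ltnS; exact: (leq_bigmax i).
  by rewrite ltr_norml => /andP[x1 x2]; rewrite /=; apply/andP; split; lra.
rewrite measure0 => /fine_cvgP[+ /cvgrPdist_le/(_ _ e0)[L2 _ P2]].
move=> [L1 _ P1]; exists (maxn L1 L2).
have /= := P1 (maxn L1 L2) (leq_maxl _ _); have /= := P2 (maxn L1 L2) (leq_maxr _ _).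
rewrite sub0r normrN => le fin; rewrite -(fineK fin) lee_fin.
exact: le_trans (ler_norm _) le.
Qed.

(** a^q <= l^q if a <= l, and a^q <= l^(q-r) a^r if a > l. Taking l small and
then |f| small in L^r gives smallness in L^q on a set of finite measure. *)
Lemma Lpow_lower (R : realType) d (T : measurableType d)
    (mu : {measure set T -> \bar R}) (D : set T) (q r l : R) (f : T -> R) :
  measurable D -> 0 < q -> q <= r -> 0 < l -> measurable_fun D f ->
  (Lpow mu D q f <= (l `^ q)%:E * mu D + (l `^ (q - r))%:E * Lpow mu D r f)%E.
Proof.
move=> mD q0 qr l0 mf.
have mc : measurable_fun D (fun x => (l `^ (q - r) * `|f x| `^ r)%:E).
  apply/measurable_EFinP; apply: measurable_funM; first exact: measurable_cst.
  by apply/measurable_EFinP; exact: measurable_Lpow_fun.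
have -> : ((l `^ q)%:E * mu D + (l `^ (q - r))%:E * Lpow mu D r f =
    \int[mu]_(x in D) (cst (l `^ q)%:E x + (l `^ (q - r) * `|f x| `^ r)%:E))%E.
  rewrite (ge0_integralD mu mD _ _ _ mc).
  - by rewrite integral_cst// integralZ_Lpow ?powR_ge0.
  - by move=> x _ /=; rewrite lee_fin powR_ge0.
  - exact: measurable_cst.
  - by move=> x _; rewrite lee_fin mulr_ge0 ?powR_ge0.
apply: ge0_le_integral => //.
- exact: measurable_Lpow_fun.
- by apply: emeasurable_funD => //; exact: measurable_cst.
move=> x _; rewrite -EFinD lee_fin.
have [fl|lf] := leP `|f x| l.
  apply: (@le_trans _ _ (l `^ q)); last by rewrite lerDl mulr_ge0 ?powR_ge0.
  by apply: ge0_ler_powR; rewrite ?nnegrE// ltW.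
apply: (@le_trans _ _ (l `^ (q - r) * `|f x| `^ r)); last by rewrite lerDr powR_ge0.
have f0 : 0 < `|f x| by exact: lt_trans lf.
have -> : `|f x| `^ q = `|f x| `^ (q - r) * `|f x| `^ r.
  by rewrite -powRD ?subrK// (gt_eqF f0) implybT.
rewrite ler_wpM2r ?powR_ge0// -opprB !powRN lef_pV2 ?posrE ?powR_gt0//.
by apply: ge0_ler_powR; rewrite ?subr_ge0 ?nnegrE ?(ltW l0) ?(ltW f0) ?(ltW lf).
Qed.

Lemma gidx_surj (R : realType) n k (z : {ffun 'I_n -> int}) :
  exists x : 'rV[R]_n, gidx k x = z.
Proof.
exists (\row_i ((z i)%:~R * side k)); apply/dcubeP => i.
by rewrite !mxE lexx ltrDl side_gt0.
Qed.

(** The integer vectors with coordinates between -N and N, as a finite type. With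
N = L 2^k they include the indices of all cubes of generation k that meet the
box of half-side L. *)
Definition index_of_ord n (N : nat) (j : {ffun 'I_n -> 'I_(2 * N).+1}) :
  {ffun 'I_n -> int} := [ffun i => (j i)%:Z - N%:Z].

Lemma gidx_box (R : realType) n k L (x : 'rV[R]_n) : box L x ->
  exists j, index_of_ord (N := L * 2 ^ k) j = gidx k x.
Proof.
move=> bx; exists [ffun i => inord `|(gidx k x i + (L * 2 ^ k)%:Z)%R|].
apply/ffunP => i; rewrite !ffunE; have /andP[b1 b2] := bx i.
have k0 : 0 < 2 ^+ k :> R by rewrite exprn_gt0.
set z := Num.floor _; set N := (L * 2 ^ k)%N.
have NE : N%:R = L%:R * 2 ^+ k :> R by rewrite natrM natrX.
have z1 : - N%:Z <= z.
  rewrite floor_ge_int mulrNz -pmulrn NE -mulNr.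
  by rewrite ler_wpM2r// ltW.
have z2 : z <= N%:Z.
  rewrite -ltzD1 floor_lt_int intrD -pmulrn NE.
  apply: (@lt_le_trans _ _ (L%:R * 2 ^+ k)); last by rewrite lerDl.
  by rewrite ltr_pM2r//; move: b2 => /=; lra.
by rewrite inordK; lia.
Qed.

Section Lq_compactness.
Variables (R : realType) (n : nat) (s p H : R) (Om : set (Rn R n)).
Hypotheses (n0 : (0 < n)%N) (s0 : 0 < s) (p0 : 0 < p) (H0 : 0 <= H).
Hypotheses (mO : measurable Om) (finO : (leb R n Om < +oo)%E).

Let m := fine (leb R n Om).
Let m0 : 0 <= m. Proof. exact: fine_ge0. Qed.
Let mE : leb R n Om = m%:E. Proof. by rewrite fineK// ge0_fin_numE. Qed.

Lemma Lpow_bounded (M q : R) (f : Rn R n -> R) : 0 < q -> 0 <= M ->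
  measurable_fun setT f -> (forall x, Om x -> `|f x| <= M) ->
  (Lpow (leb R n) Om q f <= (M `^ q * m)%:E)%E.
Proof.
move=> q0 M0 mf fM; rewrite EFinM -mE -integral_cst//.
apply: ge0_le_integral.
- exact: mO.
- by move=> x _; rewrite lee_fin powR_ge0.
- by apply: measurable_Lpow_fun; exact: measurable_funTS.
- exact: measurable_cst.
- by move=> x Ox; rewrite /= lee_fin ge0_ler_powR ?nnegrE ?(ltW q0)// fM.
Qed.

Lemma Lpow_setT_le q (f : Rn R n -> R) : measurable_fun setT f ->
  (Lpow (leb R n) Om q f <= Lpow (leb R n) setT q f)%E.
Proof.
move=> mf; apply: ge0_subset_integral; [exact: mO|exact: measurableT| | |by []].
- exact: measurable_Lpow_fun.
- by move=> x _; rewrite lee_fin powR_ge0.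
Qed.

Lemma Lpow_finite_high (r : R) : p <= r -> n%:R * (r - p) < s * p * r ->
  exists C, forall u, energy_bounded s p H u -> (Lpow (leb R n) Om r u <= C%:E)%E.
Proof.
move=> pr nr; have [C [rho [M [C0 rho01 CP]]]] := step_approximation n0 s0 p0 H0 pr nr.
have r0 : 0 < r by exact: lt_le_trans pr.
exists (2 `^ r * (C + `|M 0%N| `^ r * m)) => u uB.
have [c [c1 c2]] := CP u uB; have [mu_ _ _] := uB.
have mS : measurable_fun setT (step 0 (c 0%N)) by exact: measurable_step.
have mB : measurable_fun setT (fun x => u x - step 0 (c 0%N) x)%R.
  by apply: measurable_funB; [exact: mu_|exact: mS].
have tri := @Lpow_triangle _ _ R (leb R n) Om mO r u
  (fun x => u x - step 0 (c 0%N) x)%R (step 0 (c 0%N)) (ltW r0).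
apply: le_trans (tri _ _ _ _) _.
- by apply: measurable_funTS; exact: mu_.
- by apply: measurable_funTS; exact: mB.
- by apply: measurable_funTS; exact: mS.
- by move=> x _; rewrite -{1}[u x](subrK (step 0 (c 0%N) x)); exact: ler_normD.
rewrite EFinM; apply: lee_wpmul2l; first by rewrite lee_fin powR_ge0.
rewrite EFinD; apply: leeD.
- apply: le_trans (Lpow_setT_le r mB) _.
  by have := c1 0%N; rewrite expr0 mulr1.
- apply: Lpow_bounded => // x _.
  by apply: le_trans (c2 0%N x) _; exact: ler_norm.
Qed.

(** Take k so large that u is within e1 of its step function of generation k,
for all u at once, and L so large that the step functions, which are bounded by
M k, contribute at most e1 outside the box of half-side L. What remains are the
finitely many coefficients in the box, which lie in [-M k, M k]: they are coloured
by rounding. *)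
Lemma colouring_high (r e : R) : p <= r -> n%:R * (r - p) < s * p * r ->
  0 < e -> finitely_coloured (@energy_bounded R n s p H)
    (fun u w => (Lpow (leb R n) Om r (fun x => u x - w x)%R <= e%:E)%E).
Proof.
move=> pr nr e0.
have [C [rho [M [C0 rho01 CP]]]] := step_approximation n0 s0 p0 H0 pr nr.
have r0 : 0 < r by exact: lt_le_trans pr.
have /choice[c_ c_P] (u : Rn R n -> R) :
    exists c : nat -> {ffun 'I_n -> int} -> R, energy_bounded s p H u ->
      (forall k, (Lpow (leb R n) setT r (fun x => u x - step k (c k) x)%R <=
         (C * rho ^+ k)%:E)%E) /\
      (forall k (x : Rn R n), `|step k (c k) x| <= M k).
  have [uB|nB] := pselect (energy_bounded s p H u).
    by have [c cP] := CP u uB; exists c.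
  by exists (fun _ _ => 0).
pose A : R := 2 `^ r.
have A1 : 1 <= A by rewrite -[leLHS](powRr0 2) ler_powR// ?ler1n// ltW.
(* Each of the two uses of [Lpow_triangle] costs a factor A, and four errors of
   size e1 occur. *)
pose e1 := e / (4 * A ^+ 2).
have e10 : 0 < e1 by rewrite divr_gt0// mulr_gt0// exprn_gt0// (lt_le_trans _ A1).
have [k kP] : exists k, C * rho ^+ k <= e1.
  have /cvgrPdist_le/(_ _ e10)[k _ kP] : geometric C rho @ \oo --> 0.
    by apply: cvg_geometric; have /andP[? ?] := rho01; rewrite ger0_norm// ltW.
  exists k; have := kP k (leqnn k).
  by rewrite sub0r normrN; exact/le_trans/ler_norm.
pose Mk := `|M k|.
have [L LP] : exists L, (leb R n (Om `\` box L) <= (e1 / ((2 * Mk) `^ r + 1))%:E)%E.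
  by apply: leb_tail => //; rewrite divr_gt0// ltr_wpDl ?powR_ge0.
have mOL : measurable (Om `\` box L) by apply: measurableD; [exact: mO|exact: measurable_box].
have mOI : measurable (Om `&` box L) by apply: measurableI; [exact: mO|exact: measurable_box].
pose eta := (e1 / (m + 1)) `^ r^-1.
have eta0 : 0 < eta by rewrite powR_gt0// divr_gt0// ltr_wpDl.
have etar : eta `^ r * m <= e1.
  rewrite /eta -powRrM mulVf ?gt_eqF// powRr1; last by rewrite divr_ge0 ?addr_ge0// ltW.
  rewrite mulrAC ler_pdivrMr ?ltr_wpDl// ler_wpM2l ?(ltW e10)//.
  by rewrite lerDl.
have tailr : (((2 * Mk) `^ r)%:E * leb R n (Om `\` box L) <= e1%:E)%E.
  apply: (@le_trans _ _ (((2 * Mk) `^ r)%:E * (e1 / ((2 * Mk) `^ r + 1))%:E)%E).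
    by apply: lee_wpmul2l => //; rewrite lee_fin powR_ge0.
  rewrite -EFinM lee_fin mulrA ler_pdivrMr ?ltr_wpDl ?powR_ge0// mulrC.
  by rewrite ler_wpM2l ?(ltW e10)// lerDl.
pose J := {ffun 'I_n -> 'I_(2 * (L * 2 ^ k)).+1}.
pose a (u : Rn R n -> R) (j : J) := c_ u k (index_of_ord j).
have aM u : energy_bounded s p H u -> forall j, `|a u j| <= Mk.
  move=> /c_P[_ /(_ k) cM] j; have [x xj] := @gidx_surj R n k (index_of_ord j).
  by rewrite /a -xj; apply: le_trans (cM x) _; exact: ler_norm.
have col := finitely_coloured_preimage aM (@finitely_coloured_family R J Mk eta eta0).
apply: finitely_colouredW col => u w uB wB uw.
have [mu_ _ _] := uB; have [mw _ _] := wB.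
have [cu1 cu2] := c_P u uB; have [cw1 cw2] := c_P w wB.
pose Su := step k (c_ u k) : Rn R n -> R; pose Sw := step k (c_ w k) : Rn R n -> R.
have mSu : measurable_fun setT Su by exact: measurable_step.
have mSw : measurable_fun setT Sw by exact: measurable_step.
have mB (f g : Rn R n -> R) : measurable_fun setT f -> measurable_fun setT g ->
    measurable_fun Om (fun x => f x - g x).
  by move=> mf mg; apply: measurable_funTS; exact: measurable_funB.
have mBT (f g : Rn R n -> R) : measurable_fun setT f -> measurable_fun setT g ->
    measurable_fun setT (fun x => f x - g x).
  by move=> mf mg; exact: measurable_funB.
have hS : (Lpow (leb R n) Om r (fun x => Su x - Sw x)%R <= (e1 + e1)%:E)%E.
  have OmE : Om = (Om `&` box L) `|` (Om `\` box L) by rewrite setUIDK.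
  rewrite /Lpow {1}OmE ge0_integral_setU; last first.
  - by apply/disj_setPS => x [[_ +] [_]].
  - by move=> x _; rewrite lee_fin powR_ge0.
  - by rewrite -OmE; apply: measurable_Lpow_fun; exact: mB.
  - exact: mOL.
  - exact: mOI.
  rewrite EFinD; apply: leeD.
  - apply: (@le_trans _ _ (\int[leb R n]_(x in Om `&` box L) cst (eta `^ r)%:E x)%E).
      apply: ge0_le_integral.
      + exact: mOI.
      + by move=> x _; rewrite lee_fin powR_ge0.
      + by apply: measurable_Lpow_fun; apply: measurable_funTS; exact: mBT.
      + exact: measurable_cst.
      + move=> x [_ bx]; rewrite /= lee_fin ge0_ler_powR ?nnegrE ?(ltW r0) ?(ltW eta0)//.
        by have [j jx] := gidx_box k bx; have := uw j; rewrite /a jx.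
    rewrite integral_cst//; apply: (@le_trans _ _ ((eta `^ r)%:E * m%:E)%E).
      apply: lee_wpmul2l; first by rewrite lee_fin powR_ge0.
      by rewrite -mE; apply: le_measure; rewrite ?inE//; exact: subIsetl.
    by rewrite -EFinM lee_fin.
  - apply: le_trans tailr; rewrite -(integral_cst _ mOL).
    apply: ge0_le_integral.
    + exact: mOL.
    + by move=> x _; rewrite lee_fin powR_ge0.
    + by apply: measurable_Lpow_fun; apply: measurable_funTS; exact: mBT.
    + exact: measurable_cst.
    + move=> x _; rewrite /= lee_fin.
      apply: ge0_ler_powR; rewrite ?nnegrE ?(ltW r0) ?mulr_ge0 ?normr_ge0//.
      apply: le_trans (ler_normB _ _) _.
      have := le_trans (cu2 k x) (ler_norm (M k)).
      have := le_trans (cw2 k x) (ler_norm (M k)).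
      by rewrite -/Mk; lra.
have hu : (Lpow (leb R n) Om r (fun x => u x - Su x)%R <= e1%:E)%E.
  apply: le_trans (Lpow_setT_le r (mBT _ _ mu_ mSu)) _.
  by apply: le_trans (cu1 k) _; rewrite lee_fin.
have hw : (Lpow (leb R n) Om r (fun x => w x - Sw x)%R <= e1%:E)%E.
  apply: le_trans (Lpow_setT_le r (mBT _ _ mw mSw)) _.
  by apply: le_trans (cw1 k) _; rewrite lee_fin.
have hSw : (Lpow (leb R n) Om r (fun x => Su x - w x)%R <= (A * (e1 + e1 + e1))%:E)%E.
  have tri := @Lpow_triangle _ _ R (leb R n) Om mO r (fun x => Su x - w x)%R
    (fun x => Su x - Sw x)%R (fun x => w x - Sw x)%R (ltW r0).
  apply: le_trans (tri (mB _ _ mSu mw) (mB _ _ mSu mSw) (mB _ _ mw mSw) _) _.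
    move=> x _; have -> : Su x - w x = (Su x - Sw x) - (w x - Sw x) by ring.
    exact: ler_normB.
  rewrite [leRHS]EFinM; apply: lee_wpmul2l; first by rewrite lee_fin powR_ge0.
  by rewrite EFinD; apply: leeD; [exact: hS|exact: hw].
have tri := @Lpow_triangle _ _ R (leb R n) Om mO r (fun x => u x - w x)%R
  (fun x => u x - Su x)%R (fun x => Su x - w x)%R (ltW r0).
apply: le_trans (tri (mB _ _ mu_ mw) (mB _ _ mu_ mSu) (mB _ _ mSu mw) _) _.
  move=> x _; have -> : u x - w x = (u x - Su x) + (Su x - w x) by ring.
  exact: ler_normD.
apply: (@le_trans _ _ (A%:E * (e1%:E + (A * (e1 + e1 + e1))%:E))%E).
  apply: lee_wpmul2l; first by rewrite lee_fin powR_ge0.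
  by apply: leeD; [exact: hu|exact: hSw].
rewrite -EFinD -EFinM lee_fin.
have -> : e = A * (A * (e1 + (e1 + e1 + e1))).
  by rewrite /e1; field; rewrite gt_eqF// (lt_le_trans _ A1).
rewrite ler_wpM2l ?powR_ge0// [in leRHS]mulrDr lerD2r.
by rewrite ler_peMl// ltW.
Qed.

(** Exponents q below p are reached from p by [Lpow_lower], in which case the
condition holds by itself. *)
Lemma Lpow_finite (q : R) : 0 < q ->
  n%:R * (Num.max q p - p) < s * p * Num.max q p ->
  exists C, forall u, energy_bounded s p H u -> (Lpow (leb R n) Om q u <= C%:E)%E.
Proof.
set r := Num.max q p => q0 nr.
have [C CP] := @Lpow_finite_high r (ltac:(by rewrite le_max lexx orbT)) nr.
exists (1 `^ q * m + 1 `^ (q - r) * C) => u uB; have [mu_ _ _] := uB.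
apply: le_trans (@Lpow_lower _ _ _ _ Om q r 1 u mO q0 _ ltr01 _) _.
- by rewrite le_max lexx.
- by apply: measurable_funTS; exact: mu_.
rewrite EFinD !EFinM -mE; apply: leeD => //; apply: lee_wpmul2l; last exact: CP.
by rewrite lee_fin powR_ge0.
Qed.

(** A fine colouring for the exponent max q p is a colouring for q, by
[Lpow_lower] with l such that l^q |Om| <= e/2. *)
Lemma Lq_colouring (q e : R) : 0 < q ->
  n%:R * (Num.max q p - p) < s * p * Num.max q p ->
  0 < e -> finitely_coloured (@energy_bounded R n s p H)
    (fun u w => (Lpow (leb R n) Om q (fun x => u x - w x)%R <= e%:E)%E).
Proof.
set r := Num.max q p => q0 nr e0.
have pr : p <= r by rewrite le_max lexx orbT.
have qr : q <= r by rewrite le_max lexx.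
pose l := (e / (2 * (m + 1))) `^ q^-1.
have l0 : 0 < l by rewrite powR_gt0// divr_gt0// mulr_gt0// ltr_wpDl.
have lq : l `^ q * m <= e / 2.
  rewrite /l -powRrM mulVf ?gt_eqF// powRr1; last first.
    by rewrite divr_ge0 ?(ltW e0)// mulr_ge0// addr_ge0.
  rewrite mulrAC ler_pdivrMr ?mulr_gt0 ?ltr_wpDl//.
  have -> : e / 2 * (2 * (m + 1)) = e * (m + 1) by field.
  by rewrite ler_wpM2l ?(ltW e0)// lerDl.
have e1 : 0 < e / 2 / l `^ (q - r) by rewrite !divr_gt0// powR_gt0.
apply: finitely_colouredW (colouring_high pr nr e1) => u w [mu_ _ _] [mw _ _] uw.
have mB : measurable_fun Om (fun x => u x - w x).
  by apply: measurable_funTS; exact: measurable_funB.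
apply: le_trans (@Lpow_lower _ _ _ _ Om q r l _ mO q0 qr l0 mB) _.
rewrite mE; apply: (@le_trans _ _ ((e / 2)%:E + (e / 2)%:E)%E); last first.
  by rewrite -EFinD lee_fin -splitr.
apply: leeD; first by rewrite -EFinM lee_fin.
apply: (@le_trans _ _ ((l `^ (q - r))%:E * (e / 2 / l `^ (q - r))%:E)%E).
  by apply: lee_wpmul2l; [rewrite lee_fin powR_ge0|exact: uw].
by rewrite -EFinM lee_fin mulrC divfK// gt_eqF// powR_gt0.
Qed.

End Lq_compactness.

(** * The spaces L^q *)

Section Lnorm.
Context d (T : measurableType d) (R : realType).
Variable mu : {measure set T -> \bar R}.
Implicit Types (q c : R) (f : T -> R).

Lemma LnormE q f : ('N[mu]_q%:E[EFin \o f] = Lpow mu setT q f `^ q^-1)%E.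
Proof. by rewrite unlock. Qed.

Lemma Lnorm_leP q c f : 0 < q -> 0 <= c ->
  ('N[mu]_q%:E[EFin \o f] <= c%:E)%E <-> (Lpow mu setT q f <= (c `^ q)%:E)%E.
Proof.
move=> q0 c0; have L0 := Lpow_ge0 mu setT q f.
have q0' : 0 <= q^-1 by rewrite invr_ge0 ltW.
rewrite LnormE; case: (Lpow mu setT q f) L0 => [r r0| |//].
- rewrite lee_fin in r0; rewrite poweR_EFin !lee_fin; split => h.
    have -> : r = (r `^ q^-1) `^ q by rewrite -powRrM mulVf ?gt_eqF// powRr1.
    by apply: ge0_ler_powR; rewrite ?nnegrE ?powR_ge0 ?(ltW q0).
  have -> : c = (c `^ q) `^ q^-1 by rewrite -powRrM mulfV ?gt_eqF// powRr1.
  by apply: ge0_ler_powR; rewrite ?nnegrE ?powR_ge0.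
- by move=> _; rewrite poweRyr ?invr_eq0 ?gt_eqF// !leye_eq.
Qed.

Lemma LfunE q f : 0 < q ->
  f \in Lfun mu q%:E <-> measurable_fun setT f /\ (Lpow mu setT q f < +oo)%E.
Proof.
move=> q0; split.
  move=> /andP[]; rewrite !inE/= => mf; rewrite /finite_norm LnormE => fq; split => //.
  by apply: lty_poweRy fq; rewrite invr_eq0 gt_eqF.
move=> [mf fq]; apply/andP; split; rewrite inE//=.
by rewrite /finite_norm LnormE poweR_lty.
Qed.

Lemma Lpow_tail (q c rho : R) (f_ : nat -> T -> R) (g : T -> R) :
  0 < q -> 0 <= c -> 0 < rho < 1 -> (forall j, measurable_fun setT (f_ j)) ->
  (forall j, (Lpow mu setT q (fun x => f_ j.+1 x - f_ j x)%R <= (c * rho ^+ j)%:E)%E) ->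
  measurable_fun setT g -> {ae mu, forall x, f_ j x @[j --> \oo] --> g x} ->
  exists2 K, 0 <= K & forall k,
    (Lpow mu setT q (fun x => g x - f_ k x)%R <= (K * rho ^+ k)%:E)%E.
Proof.
move=> q0 c0 rho01 mf fc mg ae_g; have /andP[r0 r1] := rho01.
pose K0 := ((1 - rho `^ (2 * q)^-1) `^ q * (1 - Num.sqrt rho))^-1.
have K0_ge0 : 0 <= K0.
  have d1 : 0 < 1 - Num.sqrt rho by rewrite subr_gt0 -[ltRHS]sqrtr1 ltr_sqrt.
  by rewrite invr_ge0; apply: mulr_ge0; [exact: powR_ge0|exact: ltW].
exists (c * K0); first exact: mulr_ge0.
move=> k.
have ck0 : 0 <= c * rho ^+ k by rewrite mulr_ge0// exprn_ge0// ltW.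
have inc j : (Lpow mu setT q (fun x => f_ (k + j.+1)%N x - f_ (k + j)%N x)%R <=
    (c * rho ^+ k * rho ^+ j)%:E)%E.
  by rewrite addnS -mulrA -exprD; exact: fc.
have lim : {ae mu, forall x, setT x -> f_ (k + j)%N x @[j --> \oo] --> g x}.
  apply: filterS ae_g => x Sx _.
  by under eq_fun do rewrite addnC; apply: cvg_comp Sx; exact: cvg_addnr.
have := Lpow_telescope (@measurableT _ T) q0 ck0 rho01 (fun j => mf (k + j)%N)
  inc mg lim.
by rewrite addn0 -/K0 mulrAC.
Qed.

(** The limit g is the upper limit of the sequence: measurable, and equal to
the pointwise limit wherever there is one. The latter is what lets g vanish
where all the f_j do. *)
Lemma Lpow_complete (q c rho : R) (f_ : nat -> T -> R) :
  0 < q -> 0 <= c -> 0 < rho < 1 -> (forall j, measurable_fun setT (f_ j)) ->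
  (forall j, (Lpow mu setT q (fun x => f_ j.+1 x - f_ j x)%R <= (c * rho ^+ j)%:E)%E) ->
  exists g : T -> R, [/\ measurable_fun setT g,
    forall x l, f_ j x @[j --> \oo] --> l -> g x = l,
    {ae mu, forall x, f_ j x @[j --> \oo] --> g x} &
    exists2 K, 0 <= K & forall k,
      (Lpow mu setT q (fun x => g x - f_ k x)%R <= (K * rho ^+ k)%:E)%E].
Proof.
move=> q0 c0 rho01 mf fc.
pose g x := fine (limn_esup (fun j => (f_ j x)%:E)).
have mg : measurable_fun setT g.
  apply: (@measurableT_comp _ _ _ _ _ _ fine setT (fun x => limn_esup (fun j => (f_ j x)%:E))).
    exact: fine_measurable.
  by apply: measurable_fun_limn_esup => j; exact/measurable_EFinP.
have gl x l : f_ j x @[j --> \oo] --> l -> g x = l.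
  move=> fl; have fl' : (f_ j x)%:E @[j --> \oo] --> l%:E.
    by apply: cvg_EFin => //; exact: nearW.
  by rewrite /g is_cvg_limn_esupE ?(cvg_lim _ fl')//; apply/cvg_ex; exists l%:E.
have cvg_f := ae_is_cvg_Lpow (@measurableT _ T) q0 c0 rho01 mf fc.
have ae_g : {ae mu, forall x, f_ j x @[j --> \oo] --> g x}.
  apply: filterS cvg_f => x /(_ I) /cvg_ex[l fl].
  by rewrite (gl x l fl).
exists g; split => //.
exact: (Lpow_tail q0 c0 rho01 mf fc mg ae_g).
Qed.

End Lnorm.

Section Lp_space.
Variables (R : realType) (n : nat) (q : R) (E : set 'rV[R]_n).
Hypothesis q1 : 1 <= q.
Let q0 : 0 < q. Proof. exact: lt_le_trans q1. Qed.

Lemma Lp_carrierP (u : 'rV[R]_n -> R) : fcarrier (Lp q E) u <->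
  [/\ u \_ E = u, measurable_fun setT (u : Rn R n -> R) &
      (Lpow (leb R n) setT q u < +oo)%E].
Proof.
split=> [[uE /(LfunE (leb R n) u q0)[]]|[uE mu_ uq]] => //.
by split => //; apply/(LfunE (leb R n) u q0).
Qed.

Lemma seminormed_Lp : seminormed_fspace (Lp q E).
Proof.
split.
- move=> f _ /=; rewrite (_ : EFin \o _ = cst 0%E).
    by rewrite Lnorm0// eqe gt_eqF.
  by apply/funext => x /=; rewrite subrr.
- move=> f g _ _ /=; rewrite -(oppe_Lnorm (leb R n)); congr ('N[_]_ _[ _])%E.
  by apply/funext => x /=; rewrite opprB.
- move=> f g h /Lp_carrierP[_ mf _] /Lp_carrierP[_ mg _] /Lp_carrierP[_ mh _] /=.
  have -> : f \- h = (f \- g) \+ (g \- h) by apply/funext => x /=; ring.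
  apply: (@minkowski_EFin _ (Rn R n) R (leb R n)); last exact: q1.
    exact: (measurable_funB mf mg).
  exact: (measurable_funB mg mh).
Qed.

(** Completeness of L^q, together with the almost everywhere convergence that
identifies the limit of the difference quotients in [complete_Wsp]. *)
Lemma Lp_limit (f_ : nat -> 'rV[R]_n -> R) : (forall k, fcarrier (Lp q E) (f_ k)) ->
  (forall k, (fnorm (Lp q E) (f_ k.+1 \- f_ k)%R <= (2^-1 ^+ k)%:E)%E) ->
  exists g, [/\ fcarrier (Lp q E) g,
    {ae leb R n, forall x, f_ j x @[j --> \oo] --> g x} &
    forall e : R, 0 < e -> exists k0, forall k, (k0 <= k)%N ->
      (fnorm (Lp q E) (f_ k \- g)%R <= e%:E)%E].
Proof.
move=> Yf fd.
have mf j : measurable_fun setT (f_ j : Rn R n -> R) by have /Lp_carrierP[] := Yf j.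
have rho01 : 0 < (2^-1 `^ q : R) < 1.
  by rewrite powR_gt0 ?invr_gt0//= powR_lt1// invr_ge0 ler0n invf_lt1// ltr1n.
have fc j : (Lpow (leb R n) setT q (fun x => f_ j.+1 x - f_ j x)%R <=
    (1 * (2^-1 `^ q) ^+ j)%:E)%E.
  have := fd j; rewrite mul1r => /(Lnorm_leP _ _ q0).
  rewrite exprn_ge0 ?invr_ge0// => /(_ isT).
  by rewrite -/(side j) side_powR.
have [g [mg gl ae_g [K K0 gK]]] := Lpow_complete q0 ler01 rho01 mf fc.
have mB k : measurable_fun setT ((fun x => g x - f_ k x) : Rn R n -> R).
  exact: measurable_funB.
exists g; split => //.
  apply/Lp_carrierP; split => //.
  - apply/funext => x; rewrite patchE; case: ifPn => // xE; apply/esym/gl.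
    have -> : f_ ^~ x = cst 0.
      apply/funext => j; have /Lp_carrierP[<- _ _] := Yf j.
      by rewrite patchE (negbTE xE).
    exact: cvg_cst.
  - have tri := @Lpow_triangle _ _ R (leb R n) setT (@measurableT _ (Rn R n)) q
      g (fun x => g x - f_ 0%N x)%R (f_ 0%N) (ltW q0).
    apply: le_lt_trans (tri mg (mB 0%N) (mf 0%N) _) _.
      by move=> x _; rewrite -{1}[g x](subrK (f_ 0%N x)); exact: ler_normD.
    apply: lte_mul_pinfty; rewrite ?lee_fin ?powR_ge0//.
    apply: lte_add_pinfty; last by have /Lp_carrierP[] := Yf 0%N.
    by apply: le_lt_trans (gK 0%N) _; exact: ltry.
move=> e e0.
have /cvgrPdist_le/(_ _ (powR_gt0 q e0))[k0 _ k0P] : geometric K (2^-1 `^ q) @ \oo --> 0.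
  by apply: cvg_geometric; have /andP[? ?] := rho01; rewrite ger0_norm// ltW.
exists k0 => k kk0; apply/(Lnorm_leP _ _ q0 (ltW e0)).
rewrite (_ : f_ k \- g = fun x => - (g x - f_ k x)); last by apply/funext => x /=; ring.
rewrite LpowN; apply: le_trans (gK k) _; rewrite lee_fin.
by have := k0P k kk0; rewrite sub0r normrN; exact/le_trans/ler_norm.
Qed.

Lemma complete_Lp : complete_fspace (Lp q E).
Proof. by move=> f_ Yf /(Lp_limit Yf)[g [Yg _ fg]]; exists g. Qed.

Lemma Lpow_patch (f : 'rV[R]_n -> R) :
  Lpow (leb R n) setT q (f \_ E) = Lpow (leb R n) E q f.
Proof.
rewrite /Lpow [RHS]integral_mkcond; apply: eq_integral => x _.
by rewrite !patchE; case: ifPn => // _; rewrite normr0 powR0// gt_eqF.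
Qed.

End Lp_space.

(** * The Gagliardo seminorm as an L^p norm on the product space *)

Section gagliardo_space.
Variables (R : realType) (n : nat) (t p : R) (E : set (Rn R n)).
Hypotheses (p1 : 1 <= p) (t01 : 0 < t < 1) (mE : measurable E).
Implicit Types u v : 'rV[R]_n -> R.

Let p0 : 0 < p. Proof. exact: lt_le_trans p1. Qed.
Let t0 : 0 < t. Proof. by have /andP[] := t01. Qed.
Let tt0 : 0 < t * (1 - t).
Proof. by have /andP[? ?] := t01; rewrite mulr_gt0// subr_gt0. Qed.

Definition leb2 : {measure set (Rn R n * Rn R n) -> \bar R} :=
  [the measure _ _ of (sleb R n \x sleb R n)%E].

(** The difference quotient whose L^p norm on R^n x R^n is the Gagliardo
seminorm on E, up to a constant. It is linear in u, so Minkowski's inequality and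
the completeness of L^p apply to the seminorm. *)
Definition dquot u (z : Rn R n * Rn R n) : R :=
  (u z.1 - u z.2) / enorm ((z.1 : 'rV[R]_n) - z.2) `^ ((n%:R + t * p) / p) *
  \1_(E `*` E) z.

Lemma measurable_dquot u : measurable_fun setT (u : Rn R n -> R) ->
  measurable_fun setT (dquot u).
Proof.
move=> mu_; apply: measurable_funM; last first.
  by apply: measurable_indic; exact: measurableX.
apply: measurable_funM.
  apply: measurable_funB.
    exact: (measurableT_comp mu_ measurable_fst).
  exact: (measurableT_comp mu_ measurable_snd).
under eq_fun do rewrite -powRN.
exact: (measurableT_comp (measurable_powR _) (@measurable_enorm_sub R n)).
Qed.

Lemma dquotB u v z : dquot (u \- v) z = dquot u z - dquot v z.
Proof. by rewrite /dquot /=; ring. Qed.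

Lemma dquot_powR u (x y : Rn R n) : (`|dquot u (x, y)| `^ p)%:E =
  (((fun y => ((fun x => (gkernel t p u x y)%:E) \_ E) x) \_ E) y).
Proof.
rewrite /dquot indicE in_setX /= !patchE /=.
case: (x \in E); case: (y \in E); rewrite /= ?mulr0 ?normr0 ?powR0 ?gt_eqF//.
rewrite mulr1 /gkernel normrM powRM//; congr (_ * _)%:E.
set e := enorm _; have e0 : 0 <= e by exact: enorm_ge0.
rewrite ger0_norm ?invr_ge0 ?powR_ge0// -powRN -powRrM mulNr divfK ?gt_eqF//.
by rewrite powRN.
Qed.

(** Tonelli's theorem. *)
Lemma genergy_dquot u : measurable_fun setT (u : Rn R n -> R) ->
  genergy t p E u = Lpow leb2 setT p (dquot u).
Proof.
move=> mu_; rewrite /Lpow.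
have md := measurable_Lpow_fun p (measurable_dquot mu_).
have d0 z : (0 <= (`|dquot u z| `^ p)%:E)%E by rewrite lee_fin powR_ge0.
have -> := @fubini_tonelli2 _ _ _ _ _ (sleb R n) (sleb R n) _ md d0.
rewrite /fubini_G.
rewrite /genergy integral_mkcond; apply: eq_integral => y _.
under [RHS]eq_integral do rewrite dquot_powR.
rewrite patchE; case: ifPn => yE.
  rewrite integral_mkcond; apply: eq_integral => x _.
  by rewrite [RHS]patchE yE.
by rewrite integral0_eq// => x _; rewrite patchE (negbTE yE).
Qed.

Lemma gagliardoE u : measurable_fun setT (u : Rn R n -> R) ->
  gagliardo t p E u =
    (((t * (1 - t)) `^ p^-1)%:E * 'N[leb2]_p%:E[EFin \o dquot u])%E.
Proof.
move=> mu_; rewrite LnormE -genergy_dquot// -poweR_EFin -poweRM//.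
- by rewrite lee_fin ltW.
- exact: genergy_ge0.
Qed.

Lemma gagliardo_leP u (a : R) : 0 <= a -> measurable_fun setT (u : Rn R n -> R) ->
  (gagliardo t p E u <= a%:E)%E <->
  (genergy t p E u <= (a `^ p / (t * (1 - t)))%:E)%E.
Proof.
move=> a0 mu_; rewrite gagliardoE//.
have c0 : 0 < (t * (1 - t)) `^ p^-1 by rewrite powR_gt0.
rewrite -lee_pdivlMl// -EFinM.
apply: iff_trans (Lnorm_leP _ _ p0 _) _.
  by rewrite mulr_ge0// invr_ge0 ltW.
have cE : ((t * (1 - t)) `^ p^-1)^-1 `^ p = (t * (1 - t))^-1.
  by rewrite -powRN -powRrM mulNr mulVf ?gt_eqF// powR_inv1// ltW.
move: c0 cE; set c := _ `^ p^-1 => c0 cE.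
by rewrite -genergy_dquot// powRM ?invr_ge0 ?(ltW c0)// cE mulrC.
Qed.

Lemma gagliardo_lty u : measurable_fun setT (u : Rn R n -> R) ->
  (gagliardo t p E u < +oo)%E <-> (genergy t p E u < +oo)%E.
Proof.
move=> mu_; rewrite gagliardoE// LnormE -genergy_dquot//.
have c0 : 0 < (t * (1 - t)) `^ p^-1 by rewrite powR_gt0.
split=> [|uE].
  have [->|noo] := eqVneq (genergy t p E u) (+oo)%E; last by move=> _; rewrite ltey.
  by rewrite poweRyr ?invr_eq0 ?(gt_eqF p0)// gt0_muley ?ltxx// lte_fin.
by apply: lte_mul_pinfty; rewrite ?lee_fin ?(ltW c0)// poweR_lty.
Qed.

Lemma genergy_triangle u v w : measurable_fun setT (u : Rn R n -> R) ->
  measurable_fun setT (v : Rn R n -> R) -> measurable_fun setT (w : Rn R n -> R) ->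
  (forall x y, `|u x - u y| <= `|v x - v y| + `|w x - w y|) ->
  (genergy t p E u <= (2 `^ p)%:E * (genergy t p E v + genergy t p E w))%E.
Proof.
move=> mu_ mv mw uvw; rewrite !genergy_dquot//.
apply: Lpow_triangle; [exact: measurableT|exact: ltW| | | |].
- exact: measurable_dquot.
- exact: measurable_dquot.
- exact: measurable_dquot.
move=> z _; rewrite /dquot !normrM -!mulrDl.
by rewrite ler_wpM2r// ler_wpM2r.
Qed.

Lemma genergyB u v : genergy t p E (u \- v) = genergy t p E (v \- u).
Proof.
apply: eq_integral => y _; apply: eq_integral => x _.
rewrite /gkernel /=; congr ((_ `^ _) / _)%:E.
by rewrite -normrN; congr Num.norm; ring.
Qed.

Lemma gagliardoB u v : gagliardo t p E (u \- v) = gagliardo t p E (v \- u).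
Proof.
have gE w : gagliardo t p E w = (((t * (1 - t))%:E * genergy t p E w) `^ p^-1)%E by [].
by rewrite !gE genergyB.
Qed.

Let WspE : Wsp t p E = NormedFspace
    [set u | fcarrier (Lp p E) u /\ (gagliardo t p E u < +oo)%E]
    (fun u => fnorm (Lp p E) u + gagliardo t p E u)%E.
Proof. by rewrite /Wsp gt_eqF. Qed.

Lemma gagliardo_ge0 u : (0 <= gagliardo t p E u)%E.
Proof. exact: poweR_ge0. Qed.

Lemma Wsp_carrierP u : fcarrier (Wsp t p E) u <->
  [/\ fcarrier (Lp p E) u, measurable_fun setT (u : Rn R n -> R) &
      (genergy t p E u < +oo)%E].
Proof.
rewrite WspE /=; split=> [[uL ug]|[uL mu_ ug]].
  have /(Lp_carrierP _ p1)[_ mu_ _] := uL.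
  by split => //; exact/gagliardo_lty.
by split => //; exact/gagliardo_lty.
Qed.

Lemma Wsp_fnorm u : fnorm (Wsp t p E) u =
  (fnorm (Lp p E) u + gagliardo t p E u)%E.
Proof. by rewrite WspE. Qed.

Lemma seminormed_Wsp : seminormed_fspace (Wsp t p E).
Proof.
have [d0 dC dT] := seminormed_Lp E p1.
split.
- move=> f /Wsp_carrierP[fL mf _]; rewrite Wsp_fnorm d0// add0e.
  rewrite gagliardoE; last exact: (measurable_funB mf mf).
  have -> : EFin \o dquot (f \- f)%R = cst 0%E.
    by apply/funext => z /=; rewrite dquotB subrr.
  by rewrite Lnorm0 ?mule0// eqe gt_eqF.
- move=> f g /Wsp_carrierP[fL _ _] /Wsp_carrierP[gL _ _].
  by rewrite !Wsp_fnorm (dC _ _ fL gL) gagliardoB.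
- move=> f g h /Wsp_carrierP[fL mf _] /Wsp_carrierP[gL mg _] /Wsp_carrierP[hL mh _].
  rewrite !Wsp_fnorm addeACA; apply: leeD; first exact: dT.
  rewrite !gagliardoE; [|exact: (measurable_funB mg mh)|exact: (measurable_funB mf mg)|exact: (measurable_funB mf mh)].
  rewrite -ge0_muleDr ?Lnorm_ge0//; apply: lee_wpmul2l; first by rewrite lee_fin powR_ge0.
  have -> : dquot (f \- h) = (dquot (f \- g) \+ dquot (g \- h))%R.
    by apply/funext => z /=; rewrite !dquotB; ring.
  apply: (@minkowski_EFin _ _ R leb2); last exact: p1.
    by apply: measurable_dquot; exact: (measurable_funB mf mg).
  by apply: measurable_dquot; exact: (measurable_funB mg mh).
Qed.

Lemma ae_leb2 (P : Rn R n -> Prop) : {ae leb R n, forall x, P x} ->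
  {ae leb2, forall z, P z.1 /\ P z.2}.
Proof.
move=> [N [mN N0 PN]].
exists ((N `*` setT) `|` (setT `*` N)); split.
- by apply: measurableU; apply: measurableX.
- have m1 : measurable (N `*` [set: Rn R n]) by exact: measurableX.
  have m2 : measurable ([set: Rn R n] `*` N) by exact: measurableX.
  have z1 : leb2 (N `*` [set: Rn R n]) = 0%E.
    have := product_measure1E (leb R n) (sleb R n) mN (@measurableT _ (Rn R n)).
    by rewrite N0 mul0e.
  have z2 : leb2 ([set: Rn R n] `*` N) = 0%E.
    have := product_measure1E (leb R n) (sleb R n) (@measurableT _ (Rn R n)) mN.
    by rewrite /sleb /= N0 mule0.
  apply/eqP; rewrite eq_le measure_ge0 andbT.
  apply: le_trans (measureU2 _ m1 m2) _.
  by rewrite [X in (X + _)%E]z1 [X in (_ + X)%E]z2 adde0.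
- move=> [x y] /=; have [Px|nPx] := pselect (P x); last first.
    by move=> _; left; split => //; exact: PN.
  have [Py|nPy] := pselect (P y); last by move=> _; right; split => //; exact: PN.
  by move=> /(_ (conj Px Py)).
Qed.

(** The sequence converges in L^p and almost everywhere to some g, so its
difference quotients converge to that of g almost everywhere on R^n x R^n;
their increments being geometrically small in L^p, they converge in L^p to the
same limit. *)
Lemma complete_Wsp : complete_fspace (Wsp t p E).
Proof.
move=> f_ Yf fd.
have fL k : fcarrier (Lp p E) (f_ k) by have /Wsp_carrierP[] := Yf k.
have mf k : measurable_fun setT (f_ k : Rn R n -> R) by have /Wsp_carrierP[] := Yf k.
have mB k (g : 'rV[R]_n -> R) : measurable_fun setT (g : Rn R n -> R) ->
    measurable_fun setT ((f_ k \- g)%R : Rn R n -> R).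
  by move=> mg; exact: measurable_funB.
have h0 j : 0 <= 2^-1 ^+ j :> R by rewrite exprn_ge0 ?invr_ge0.
have fdL k : (fnorm (Lp p E) (f_ k.+1 \- f_ k)%R <= (2^-1 ^+ k)%:E)%E.
  apply: le_trans (fd k); rewrite Wsp_fnorm leeDl// gagliardo_ge0//.
have fdG k : (gagliardo t p E (f_ k.+1 \- f_ k)%R <= (2^-1 ^+ k)%:E)%E.
  by apply: le_trans (fd k); rewrite Wsp_fnorm leeDr//; exact: Lnorm_ge0.
have [g [gL ae_g fg]] := Lp_limit p1 fL fdL.
have /(Lp_carrierP _ p1)[_ mg _] := gL.
have rho01 : 0 < (2^-1 `^ p : R) < 1.
  by rewrite powR_gt0 ?invr_gt0//= powR_lt1// invr_ge0 ler0n invf_lt1// ltr1n.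
pose c := (t * (1 - t))^-1.
have c0 : 0 <= c by rewrite invr_ge0 ltW.
have dquot_diff (u v : 'rV[R]_n -> R) : measurable_fun setT (u : Rn R n -> R) ->
    measurable_fun setT (v : Rn R n -> R) ->
    Lpow leb2 setT p (fun z => dquot u z - dquot v z)%R = genergy t p E (u \- v).
  move=> mu_ mv; rewrite genergy_dquot; last exact: (measurable_funB mu_ mv).
  by congr Lpow; apply/funext => z; rewrite dquotB.
have fc j : (Lpow leb2 setT p (fun z => dquot (f_ j.+1) z - dquot (f_ j) z)%R <=
    (c * (2^-1 `^ p) ^+ j)%:E)%E.
  rewrite dquot_diff//.
  have /(gagliardo_leP (h0 j) (mB _ _ (mf j))) := fdG j.
  by rewrite -/(side j) side_powR mulrC.
have ae_dg : {ae leb2, forall z, dquot (f_ j) z @[j --> \oo] --> dquot g z}.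
  apply: filterS (ae_leb2 ae_g) => z [g1 g2]; rewrite /dquot.
  apply: cvgM; last exact: cvg_cst.
  apply: cvgM; last exact: cvg_cst.
  exact: cvgB.
have [K K0 gK] := Lpow_tail p0 c0 rho01 (fun j => measurable_dquot (mf j)) fc
  (measurable_dquot mg) ae_dg.
have gKE k : (genergy t p E (f_ k \- g)%R <= (K * (2^-1 `^ p) ^+ k)%:E)%E.
  by rewrite genergyB -dquot_diff.
exists g.
  apply/Wsp_carrierP; split => //.
  apply: (@le_lt_trans _ _ ((2 `^ p)%:E * (genergy t p E (f_ 0%N \- g)%R + genergy t p E (f_ 0%N)))%E).
    apply: (genergy_triangle mg (mB 0%N g mg) (mf 0%N)).
    move=> x y /=.
    have -> : g x - g y = (f_ 0%N x - f_ 0%N y) - (f_ 0%N x - g x - (f_ 0%N y - g y)) by ring.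
    by rewrite [leRHS]addrC; exact: ler_normB.
  apply: lte_mul_pinfty; rewrite ?lee_fin ?powR_ge0//.
  apply: lte_add_pinfty; last by have /Wsp_carrierP[] := Yf 0%N.
  by apply: le_lt_trans (gKE 0%N) _; exact: ltry.
move=> e e0.
have e20 : 0 < e / 2 by rewrite divr_gt0.
have [k1 k1P] := fg _ e20.
have b0 : 0 < (e / 2) `^ p / (t * (1 - t)) by rewrite divr_gt0// powR_gt0.
have /cvgrPdist_le/(_ _ b0)[k2 _ k2P] : geometric K (2^-1 `^ p) @ \oo --> 0.
  by apply: cvg_geometric; have /andP[? ?] := rho01; rewrite ger0_norm// ltW.
exists (maxn k1 k2) => k; rewrite geq_max => /andP[kk1 kk2].
rewrite Wsp_fnorm [e in leRHS]splitr EFinD; apply: leeD; first exact: k1P.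
apply/(gagliardo_leP (ltW e20) (mB k _ mg)); apply: le_trans (gKE k) _; rewrite lee_fin.
by have := k2P k kk2; rewrite sub0r normrN; exact/le_trans/ler_norm.
Qed.

End gagliardo_space.

(** * Hoelder spaces *)

Section hoelder_space.
Variables (R : realType) (n : nat) (b : R) (K : set 'rV[R]_n).
Implicit Types u v w : 'rV[R]_n -> R.

Lemma sup_norm_leP u (a : R) : 0 <= a ->
  (sup_norm K u <= a%:E)%E <-> (forall x, K x -> `|u x| <= a).
Proof.
move=> a0; split=> [ua x Kx|ua].
  rewrite -lee_fin; apply: le_trans ua; apply: ereal_sup_ubound.
  by right; exists x.
by apply: ge_ereal_sup => _ [->|[x Kx <-]]; rewrite lee_fin//; exact: ua.
Qed.

Lemma hoelder_seminorm_leP u (a : R) : 0 <= a ->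
  (hoelder_seminorm b K u <= a%:E)%E <->
  (forall x y, K x -> K y -> `|u x - u y| / enorm (x - y) `^ b <= a).
Proof.
move=> a0; split=> [ua x y Kx Ky|ua].
  rewrite -lee_fin; apply: le_trans ua; apply: ereal_sup_ubound.
  by right; exists (x, y).
by apply: ge_ereal_sup => _ [->|[[x y] [Kx Ky] <-]]; rewrite lee_fin//; exact: ua.
Qed.

Lemma sup_norm_ge0 u : (0 <= sup_norm K u)%E.
Proof. by apply: ereal_sup_ubound; left. Qed.

Lemma hoelder_seminorm_ge0 u : (0 <= hoelder_seminorm b K u)%E.
Proof. by apply: ereal_sup_ubound; left. Qed.

Lemma sup_normD u v w : (forall x, u x = v x + w x) ->
  (sup_norm K u <= sup_norm K v + sup_norm K w)%E.
Proof.
move=> uvw; apply: ge_ereal_sup => _ [->|[x Kx <-]].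
  by apply: adde_ge0; exact: sup_norm_ge0.
apply: (@le_trans _ _ (`|v x|%:E + `|w x|%:E)%E).
  by rewrite -EFinD lee_fin uvw ler_normD.
by apply: leeD; apply: ereal_sup_ubound; right; exists x.
Qed.

Lemma hoelder_seminormD u v w : (forall x, u x = v x + w x) ->
  (hoelder_seminorm b K u <= hoelder_seminorm b K v + hoelder_seminorm b K w)%E.
Proof.
move=> uvw; apply: ge_ereal_sup => _ [->|[[x y] Kxy <-]].
  by apply: adde_ge0; exact: hoelder_seminorm_ge0.
apply: (@le_trans _ _ ((`|v x - v y| / enorm (x - y) `^ b)%:E +
    (`|w x - w y| / enorm (x - y) `^ b)%:E)%E).
  rewrite -EFinD lee_fin /= -mulrDl ler_wpM2r ?invr_ge0 ?powR_ge0//.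
  rewrite !uvw; have -> : v x + w x - (v y + w y) = (v x - v y) + (w x - w y) by ring.
  exact: ler_normD.
by apply: leeD; apply: ereal_sup_ubound; right; exists (x, y).
Qed.

Lemma hoelder_normD u v w : (forall x, u x = v x + w x) ->
  (hoelder_norm b K u <= hoelder_norm b K v + hoelder_norm b K w)%E.
Proof.
move=> uvw; rewrite /hoelder_norm; case: ifPn => _; first exact: sup_normD.
by rewrite addeACA; apply: leeD; [exact: sup_normD|exact: hoelder_seminormD].
Qed.

Lemma hoelder_normN u v : (forall x, u x = - v x) ->
  hoelder_norm b K u = hoelder_norm b K v.
Proof.
move=> uv; have sE : sup_norm K u = sup_norm K v.
  congr (ereal_sup (_ `|` _)); apply/seteqP.
  by split=> _ [x Kx <-]; exists x => //; rewrite uv normrN.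
have hE : hoelder_seminorm b K u = hoelder_seminorm b K v.
  congr (ereal_sup (_ `|` _)); apply/seteqP.
  split=> _ [[x y] Kx <-]; exists (x, y) => //=; rewrite !uv.
    by rewrite -opprD normrN.
  by rewrite -opprD normrN.
by rewrite /hoelder_norm sE hE.
Qed.

Lemma hoelder_norm_le u (a c : R) : 0 <= a -> 0 <= c ->
  (forall x, K x -> `|u x| <= a) ->
  (b != 0 -> forall x y, K x -> K y -> `|u x - u y| / enorm (x - y) `^ b <= c) ->
  (hoelder_norm b K u <= (a + c)%:E)%E.
Proof.
move=> a0 c0 ua uc; rewrite /hoelder_norm; case: ifPn => b0.
  by apply/sup_norm_leP; [exact: addr_ge0|move=> x Kx; rewrite ler_wpDr// ua].
rewrite EFinD; apply: leeD; first exact/sup_norm_leP.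
by apply/hoelder_seminorm_leP => //; exact: uc.
Qed.

Lemma hoelder_norm_sup u (a : R) : 0 <= a -> (hoelder_norm b K u <= a%:E)%E ->
  forall x, K x -> `|u x| <= a.
Proof.
move=> a0 ua; apply/(sup_norm_leP _ a0); apply: le_trans ua.
rewrite /hoelder_norm; case: ifPn => // _; rewrite leeDl//.
exact: hoelder_seminorm_ge0.
Qed.

Lemma hoelder_norm_seminorm u (a : R) : 0 <= a -> b != 0 ->
  (hoelder_norm b K u <= a%:E)%E ->
  forall x y, K x -> K y -> `|u x - u y| / enorm (x - y) `^ b <= a.
Proof.
move=> a0 b0 ua; apply/(hoelder_seminorm_leP _ a0); apply: le_trans ua.
rewrite /hoelder_norm (negbTE b0) leeDr//; exact: sup_norm_ge0.
Qed.

Lemma seminormed_hoelder : seminormed_fspace (hoelder_space b K).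
Proof.
split.
- move=> f _ /=; apply/eqP; rewrite eq_le; apply/andP; split; last first.
    rewrite /hoelder_norm; case: ifPn => _; rewrite ?adde_ge0//;
      [exact: sup_norm_ge0|exact: sup_norm_ge0|exact: hoelder_seminorm_ge0].
  rewrite -[0%E]/(0%:E) -[X in X%:E](addr0 0); apply: hoelder_norm_le => //.
    by move=> x _ /=; rewrite subrr normr0.
  by move=> _ x y _ _ /=; rewrite !subrr normr0 mul0r.
- by move=> f g _ _ /=; apply: hoelder_normN => x /=; ring.
- by move=> f g h _ _ _ /=; apply: hoelder_normD => x /=; ring.
Qed.

(** Besides the values at a point, the difference quotients at a pair of points
also have increments of size at most 2^-k, so the same tail estimate bounds the
sup norm and the seminorm of the difference to the pointwise limit. *)
Lemma complete_hoelder : complete_fspace (hoelder_space b K).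
Proof.
move=> f_ Yf fd.
have fK k : f_ k \_ K = f_ k by have [] := Yf k.
have fc k : {within K, continuous (f_ k)} by have [] := Yf k.
have h0 j : 0 <= 2^-1 ^+ j :> R by rewrite exprn_ge0 ?invr_ge0.
have h01 : 0 < (2^-1 : R) < 1 by rewrite invr_gt0 ltr0n invf_lt1// ltr1n.
have sup_inc k x : K x -> `|f_ k.+1 x - f_ k x| <= 2^-1 ^+ k.
  by move=> Kx; exact: hoelder_norm_sup (h0 k) (fd k) x Kx.
have out k x : ~ K x -> f_ k x = 0.
  by move=> nK; rewrite -fK patchE; case: ifPn => // /set_mem.
have inc k x : `|f_ k.+1 x - f_ k x| <= 1 * 2^-1 ^+ k.
  have [Kx|nK] := pselect (K x); first by rewrite mul1r; exact: sup_inc.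
  by rewrite !out// subrr normr0 mul1r.
have lim y : exists l : R, f_ j y @[j --> \oo] --> l.
  by have [l fl _] := geometric_increments ler01 h01 (inc^~ y); exists l.
have /choice[g gP] := lim.
have e2 k : 2^-1 ^+ k / (1 - 2^-1) = 2 * 2^-1 ^+ k :> R by field.
have tail_inc k (a : nat -> R) (l : R) : a j @[j --> \oo] --> l ->
    (forall j, (k <= j)%N -> `|a j.+1 - a j| <= 2^-1 ^+ j) ->
    `|l - a k| <= 2 * 2^-1 ^+ k.
  move=> al ainc.
  have inc' j : `|a (k + j.+1)%N - a (k + j)%N| <= 2^-1 ^+ k * 2^-1 ^+ j.
    by rewrite addnS -exprD; apply: ainc; exact: leq_addr.
  have [l' al' ] := geometric_increments (h0 k) h01 inc'.
  have Sv : a (k + j)%N @[j --> \oo] --> l.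
    by under eq_fun do rewrite addnC; apply: cvg_comp al; exact: cvg_addnr.
  have -> : l' = l by exact: cvg_unique al' Sv.
  by rewrite addn0 e2.
have tail k x : `|g x - f_ k x| <= 2 * 2^-1 ^+ k.
  apply: (tail_inc k (fun j => f_ j x)) => // j _.
  by have := inc j x; rewrite mul1r.
have tailb k x y : b != 0 -> K x -> K y ->
    `|(g x - f_ k x) - (g y - f_ k y)| / enorm (x - y) `^ b <= 2 * 2^-1 ^+ k.
  move=> b0 Kx Ky; set e := enorm _ `^ b.
  have e0 : 0 <= e by exact: powR_ge0.
  have cv : (f_ j x - f_ j y) / e @[j --> \oo] --> (g x - g y) / e.
    by apply: cvgM; [apply: cvgB; exact: gP|exact: cvg_cst].
  have := tail_inc k _ _ cv.
  have -> : (g x - g y) / e - (f_ k x - f_ k y) / e =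
    ((g x - f_ k x) - (g y - f_ k y)) / e by ring.
  rewrite normrM (@ger0_norm _ e^-1) ?invr_ge0//; apply => j _.
  have -> : (f_ j.+1 x - f_ j.+1 y) / e - (f_ j x - f_ j y) / e =
    ((f_ j.+1 x - f_ j x) - (f_ j.+1 y - f_ j y)) / e by ring.
  rewrite normrM (@ger0_norm _ e^-1) ?invr_ge0//.
  exact: hoelder_norm_seminorm (h0 j) b0 (fd j) x y Kx Ky.
have dist k : (hoelder_norm b K (g \- f_ k)%R <= (4 * 2^-1 ^+ k)%:E)%E.
  have -> : 4 * 2^-1 ^+ k = 2 * 2^-1 ^+ k + 2 * 2^-1 ^+ k :> R by ring.
  apply: hoelder_norm_le; rewrite ?mulr_ge0//.
  - by move=> x _; exact: tail.
  - by move=> b0 x y Kx Ky; exact: tailb.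
have distC k : hoelder_norm b K (f_ k \- g)%R = hoelder_norm b K (g \- f_ k)%R.
  by apply: hoelder_normN => x /=; ring.
have small (e : R) : 0 < e -> exists k0, forall k, (k0 <= k)%N -> 4 * 2^-1 ^+ k <= e.
  move=> e0; have /cvgrPdist_le/(_ _ e0)[k0 _ k0P] : geometric (4 : R) 2^-1 @ \oo --> 0.
    by apply: cvg_geometric; rewrite ger0_norm// invf_lt1//; lra.
  exists k0 => k kk0; have := k0P k kk0.
  by rewrite sub0r normrN; exact/le_trans/ler_norm.
exists g; last first.
  move=> e e0; have [k0 k0P] := small e e0; exists k0 => k kk0.
  by rewrite /= distC; apply: le_trans (dist k) _; rewrite lee_fin k0P.
split.
- apply/funext => x; rewrite patchE; case: ifPn => // /negP xK.
  have nK : ~ K x by move=> Kx; apply: xK; exact: mem_set.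
  have c0 : f_ j x @[j --> \oo] --> (0 : R).
    by rewrite (_ : f_ ^~ x = cst 0); [exact: cvg_cst|apply/funext => j; exact: out].
  exact: cvg_unique c0 (gP x).
- apply/subspace_continuousP => x Kx; apply/cvgrPdist_le => e e0.
  have e30 : 0 < e / 3 by rewrite divr_gt0.
  have [k0 /(_ k0 (leqnn _)) k0P] := small _ e30.
  have f2 y : `|g y - f_ k0 y| <= e / 3.
    by apply: le_trans (tail k0 y) _; apply: le_trans k0P; have := h0 k0; lra.
  have /subspace_continuousP/(_ x Kx)/cvgrPdist_le/(_ _ e30) := fc k0.
  apply: filterS => y fxy.
  have -> : g x - g y = (g x - f_ k0 x) + (f_ k0 x - f_ k0 y) - (g y - f_ k0 y) by ring.
  apply: le_trans (ler_normB _ _) _.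
  apply: le_trans (lerD (ler_normD _ _) (lexx _)) _.
  by have := f2 x; have := f2 y; move: fxy; lra.
- rewrite /=; apply: (@le_lt_trans _ _ (hoelder_norm b K (g \- f_ 0%N)%R + hoelder_norm b K (f_ 0%N))%E).
    by apply: hoelder_normD => x /=; ring.
  apply: lte_add_pinfty; last by have [] := Yf 0%N.
  by apply: le_lt_trans (dist 0%N) _; exact: ltry.
Qed.

End hoelder_space.

(** * Total boundedness in Hoelder spaces *)

Definition hoelder_class (R : realType) (n : nat) (C ga : R)
    (v : 'rV[R]_n -> R) :=
  (forall x, `|v x| <= C) /\
  (forall x y, `|v x - v y| <= C * enorm (x - y) `^ ga).

Section hoelder_class.
Variables (R : realType) (n : nat) (C ga b : R).
Hypotheses (C0 : 0 <= C) (ga0 : 0 < ga) (b0 : 0 <= b) (bga : b < ga).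
Implicit Types (v w : 'rV[R]_n -> R) (K : set 'rV[R]_n).

Lemma coord_le_norm (x : 'rV[R]_n) i : `|x ord0 i| <= `|x|.
Proof.
by rewrite [leRHS]/Num.norm /= mx_normrE; apply/bigmax_geP; right => /=; exists (ord0, i).
Qed.

Lemma enorm_le_norm (x : 'rV[R]_n) : enorm x <= n%:R * `|x|.
Proof. by apply: enorm_le => // i; exact: coord_le_norm. Qed.

(** Interpolation: a function whose oscillation is controlled at the exponent ga
and which is uniformly small has a small seminorm at a smaller exponent; near
the diagonal the first bound wins, away from it the second one does. *)
Lemma hoelder_interpolation K (f : 'rV[R]_n -> R) (M d rho e : R) :
  0 < rho -> 0 <= M -> 0 <= d -> M * rho `^ (ga - b) <= e -> 2 * d / rho `^ b <= e ->
  (forall x, K x -> `|f x| <= d) ->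
  (forall x y, K x -> K y -> `|f x - f y| <= M * enorm (x - y) `^ ga) ->
  forall x y, K x -> K y -> `|f x - f y| / enorm (x - y) `^ b <= e.
Proof.
move=> rho0 M0 d0 Me de fd fM x y Kx Ky.
set ee := enorm (x - y).
have ee_ge0 : 0 <= ee by exact: enorm_ge0.
have [E|ne] := eqVneq ee 0.
  rewrite (enorm_eq0 E) subrr normr0 mul0r; apply: le_trans Me.
  by rewrite mulr_ge0// powR_ge0.
have ee0 : 0 < ee by rewrite lt_neqAle eq_sym ne.
have eb0 : 0 < ee `^ b by exact: powR_gt0.
rewrite ler_pdivrMr//.
have [eer|ree] := leP ee rho.
  apply: le_trans (fM x y Kx Ky) _; rewrite -/ee.
  have -> : ee `^ ga = ee `^ (ga - b) * ee `^ b.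
    by rewrite -powRD ?subrK// (gt_eqF ee0) implybT.
  rewrite mulrA ler_wpM2r ?(ltW eb0)//; apply: le_trans Me.
  rewrite ler_wpM2l//; apply: ge0_ler_powR; rewrite ?nnegrE ?(ltW rho0)//.
  by rewrite subr_ge0 ltW.
apply: (@le_trans _ _ (2 * d)).
  apply: le_trans (ler_normB _ _) _.
  by have := fd x Kx; have := fd y Ky; lra.
have rb0 : 0 < rho `^ b by exact: powR_gt0.
rewrite -ler_pdivrMr//; apply: le_trans de.
rewrite ler_wpM2l ?mulr_ge0// lef_pV2 ?posrE//.
by apply: ge0_ler_powR; rewrite ?nnegrE ?(ltW rho0) ?(ltW ree).
Qed.

Lemma hoelder_class_continuous v : hoelder_class C ga v -> continuous v.
Proof.
move=> [_ vC] x; apply/(@cvgrPdist_le _ _ _ _ (nbhs_filter x)) => e e0.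
pose A := C + 1; have A0 : 0 < A by rewrite /A ltr_wpDl.
pose N : R := n%:R + 1; have N0 : 0 < N by rewrite ltr_wpDl.
pose r := (e / A) `^ ga^-1 / N.
have r0 : 0 < r by rewrite divr_gt0// powR_gt0// divr_gt0.
near=> y.
have yr : `|x - y| <= r.
  near: y; apply/nbhs_ballP; exists r => //= y; rewrite -ball_normE /=; exact: ltW.
apply: le_trans (vC x y) _.
have exy : enorm (x - y) <= (e / A) `^ ga^-1.
  apply: le_trans (enorm_le_norm _) _.
  apply: (@le_trans _ _ (N * r)); last by rewrite /r mulrC divfK// gt_eqF.
  by rewrite ler_pM// /N lerDl.
apply: (@le_trans _ _ (A * (e / A))); last by rewrite mulrC divfK// gt_eqF.
have ea : enorm (x - y) `^ ga <= e / A.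
  have -> : e / A = ((e / A) `^ ga^-1) `^ ga.
    by rewrite -powRrM mulVf ?gt_eqF// powRr1// divr_ge0// ltW.
  by apply: ge0_ler_powR; rewrite ?nnegrE ?powR_ge0 ?enorm_ge0 ?(ltW ga0).
by apply: ler_pM => //; [exact: powR_ge0|rewrite /A lerDl].
Unshelve. all: by end_near. Qed.

Lemma patch_diff v w K x : K x -> (v \_ K \- w \_ K) x = v x - w x.
Proof. by move=> Kx; rewrite /= !patchE mem_set. Qed.

Lemma hoelder_class_carrier K v : hoelder_class C ga v ->
  fcarrier (hoelder_space b K) (v \_ K).
Proof.
move=> vC; have [v1 v2] := vC; have vcont := hoelder_class_continuous vC; split.
- by apply/funext => x; rewrite !patchE; case: ifP => // ->.
- have /subspace_eq_continuous : {in K, v =1 v \_ K}.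
    by move=> x xK; rewrite patchE xK.
  by apply; exact: continuous_subspaceT.
- have bound : (hoelder_norm b K (v \_ K) <= (C + (C * 1 `^ (ga - b) + 2 * C / 1 `^ b))%:E)%E.
    have E1 : 0 <= C * 1 `^ (ga - b) by rewrite mulr_ge0// powR_ge0.
    have E2 : 0 <= 2 * C / 1 `^ b by rewrite !mulr_ge0// invr_ge0 powR_ge0.
    apply: hoelder_norm_le => //; first exact: addr_ge0.
      by move=> x Kx; rewrite patchE mem_set.
    move=> _; apply: (@hoelder_interpolation _ _ C C 1) => //.
    + by rewrite lerDl.
    + by rewrite lerDr.
    + by move=> x Kx; rewrite patchE mem_set.
    + by move=> x y Kx Ky; rewrite !patchE !mem_set.
  by apply: le_lt_trans bound _; exact: ltry.
Qed.

Lemma compact_sub_box K : compact K -> exists L, K `<=` @box R n L.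
Proof.
move=> cK.
have [M [_ KM]] := compact_bounded cK.
have [L LM] : exists L : nat, M + 1 < L%:R.
  by exists (Num.truncn `|M + 1|).+1; apply: le_lt_trans (ler_norm _) _;
    have /andP[] := truncn_itv (normr_ge0 (M + 1)).
exists L => x Kx i.
have xL : `|x ord0 i| < L%:R.
  apply: le_lt_trans LM; apply: le_trans (coord_le_norm x i) _.
  by apply: KM => //; rewrite ltrDl.
by move: xL; rewrite ltr_norml => /andP[x1 x2]; apply/andP; split; lra.
Qed.

(** Functions of the class vary little on small cubes, so finitely many values
determine them up to a small uniform error on K, and [hoelder_interpolation]
improves the uniform error to the norm of exponent b < ga. *)
Lemma hoelder_colouring K (e : R) : compact K -> 0 < e ->
  finitely_coloured (hoelder_class C ga)
    (fun v w => (hoelder_norm b K (v \_ K \- w \_ K)%R <= e%:E)%E).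
Proof.
move=> cK e0; have [L KL] := compact_sub_box cK.
have gb0 : 0 < ga - b by rewrite subr_gt0.
pose A := 2 * C + 1; have A0 : 0 < A by rewrite /A ltr_wpDl// mulr_ge0.
(* A bounds the oscillation of a difference of two functions of the class; rho
   and d are such that [hoelder_interpolation] yields e/2 for the seminorm. *)
pose rho := (e / 2 / A) `^ (ga - b)^-1.
have rho0 : 0 < rho by rewrite powR_gt0// !divr_gt0.
have rhoE : A * rho `^ (ga - b) = e / 2.
  rewrite /rho -powRrM mulVf ?gt_eqF// powRr1 ?divr_ge0 ?(ltW e0) ?(ltW A0)//.
  by rewrite mulrC divfK// gt_eqF.
pose d := Num.min (e / 2) (e / 4 * rho `^ b).
have d0 : 0 < d.
  rewrite lt_min; apply/andP; split; first exact: divr_gt0.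
  by apply: mulr_gt0; [exact: divr_gt0|exact: powR_gt0].
pose N : R := n%:R + 1; have N0 : 0 < N by rewrite ltr_wpDl.
(* On a cube of generation k a difference varies by at most d/2. *)
have [k kP] : exists k, A * (n%:R * side k) `^ ga <= d / 2.
  pose r := (d / 2 / A) `^ ga^-1 / N.
  have r0 : 0 < r by rewrite divr_gt0// powR_gt0// !divr_gt0.
  have /cvgrPdist_le/(_ _ r0)[k _ kP] : (2^-1 ^+ k : R) @[k --> \oo] --> (0 : R).
    by apply: cvg_expr; rewrite ger0_norm// invf_lt1//; lra.
  exists k; have := kP k (leqnn k).
  rewrite sub0r normrN ger0_norm ?exprn_ge0// -/(side k) => kr.
  apply: (@le_trans _ _ (A * (d / 2 / A))); last by rewrite mulrC divfK// gt_eqF.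
  rewrite ler_wpM2l ?(ltW A0)//.
  have -> : d / 2 / A = ((d / 2 / A) `^ ga^-1) `^ ga.
    by rewrite -powRrM mulVf ?gt_eqF// powRr1// !divr_ge0// ltW.
  apply: ge0_ler_powR; rewrite ?nnegrE ?powR_ge0 ?(ltW ga0)//.
    by rewrite mulr_ge0// ltW// side_gt0.
  apply: (@le_trans _ _ (N * r)); last by rewrite /r mulrC divfK// gt_eqF.
  by apply: ler_pM => //; [rewrite ltW// side_gt0|rewrite /N lerDl].
pose J := {ffun 'I_n -> 'I_(2 * (L * 2 ^ k)).+1}.
have /choice[pt ptP] (j : J) : exists x : 'rV[R]_n, gidx k x = index_of_ord j.
  exact: gidx_surj.
pose a v (j : J) := v (pt j).
have aC v : hoelder_class C ga v -> forall j, `|a v j| <= C by move=> [v1 _] j; exact: v1.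
have d20 : 0 < d / 2 by rewrite divr_gt0.
have col := finitely_coloured_preimage aC (@finitely_coloured_family R J C (d / 2) d20).
apply: finitely_colouredW col => v w [v1 v2] [w1 w2] vw.
have fM x y : `|(v x - w x) - (v y - w y)| <= A * enorm (x - y) `^ ga.
  have -> : (v x - w x) - (v y - w y) = (v x - v y) - (w x - w y) by ring.
  apply: le_trans (ler_normB _ _) _.
  apply: le_trans (lerD (v2 x y) (w2 x y)) _.
  rewrite -mulrDl ler_wpM2r ?powR_ge0// /A; lra.
have fd x : K x -> `|v x - w x| <= d.
  move=> Kx; have [j jx] := gidx_box k (KL _ Kx).
  have near : enorm (x - pt j) <= n%:R * side k.
    apply: enorm_le; first by rewrite ltW// side_gt0.
    by move=> i; rewrite !mxE; apply: dcube_coord; rewrite ptP.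
  have -> : v x - w x = ((v x - w x) - (v (pt j) - w (pt j))) + (a v j - a w j).
    by rewrite /a; ring.
  rewrite [d]splitr; apply: le_trans (ler_normD _ _) _; apply: lerD; last exact: vw.
  apply: le_trans (fM _ _) _; apply: le_trans kP; rewrite ler_wpM2l ?(ltW A0)//.
  apply: ge0_ler_powR; rewrite ?nnegrE ?enorm_ge0 ?(ltW ga0)//.
  by rewrite mulr_ge0// ltW// side_gt0.
rewrite [e]splitr; apply: hoelder_norm_le; rewrite ?divr_ge0 ?(ltW e0)//.
  move=> x Kx; rewrite patch_diff//; apply: le_trans (fd x Kx) _.
  by rewrite ge_min lexx.
move=> _; apply: (hoelder_interpolation rho0 (ltW A0) (ltW d0)).
- by rewrite rhoE.
- rewrite ler_pdivrMr ?(powR_gt0 b rho0)//.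
  apply: (@le_trans _ _ (2 * (e / 4 * rho `^ b))).
    by rewrite ler_wpM2l// ge_min lexx orbT.
  by rewrite le_eqVlt; apply/orP; left; apply/eqP; field.
- by move=> x Kx; rewrite patch_diff//; exact: fd.
- by move=> x y Kx Ky; rewrite !patch_diff//; exact: fM.
Qed.

End hoelder_class.

(** * Continuous representatives *)

Section continuous_representatives.
Variables (R : realType) (n : nat).
Implicit Types u v w : 'rV[R]_n -> R.

(** A null set contains no cube, so its complement is dense. *)
Lemma continuous_ae_eq v w : continuous v -> continuous w ->
  {ae leb R n, forall x, v x = w x} -> v = w.
Proof.
move=> cv cw [N [mN N0 vwN]]; apply/funext => x; apply: contrapT => vwx.
have e0 : 0 < `|v x - w x| by rewrite normr_gt0 subr_eq0; apply/eqP.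
have cd : {for x, continuous (v \- w)} by apply: continuousB; [exact: (cv x)|exact: (cw x)].
move/(@cvgrPdist_lt _ _ _ _ (nbhs_filter x)): cd => /(_ _ e0) /nbhs_ballP[r /= r0 rP].
have sub : cube (fun i => x ord0 i) (r / 2) `<=` N.
  move=> y yx; apply: vwN => vwy.
  have xy : ball x r y.
    split => // i j; rewrite (ord1 i) /ball /=.
    have /andP[y1 y2] := yx j; rewrite ltr_norml; apply/andP; split; lra.
  by have := rP y xy; rewrite /= vwy subrr subr0 ltxx.
have r20 : 0 < r / 2 by rewrite divr_gt0.
have : (leb R n (cube (fun i => x ord0 i) (r / 2)) <= leb R n N)%E.
  apply: le_measure => //; rewrite inE//.
  by apply: measurable_Borel_Rn; exact: measurable_cube.
by rewrite N0 leb_cube ?(ltW r20)// lee_fin leNgt exprn_gt0.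
Qed.

Lemma continuous_rep_eq u v : continuous v ->
  {ae leb R n, forall x, u x = v x} -> continuous_rep u = v.
Proof.
have FF := ae_filter_ringOfSetsType (leb R n).
move=> cv uv; have vrep : is_continuous_rep u v.
  by split => //; apply: (@filterS _ _ FF _ _ _ uv) => x ux _.
rewrite /continuous_rep; case: xgetP => [w _ [cw uw]|/(_ v)//].
apply: continuous_ae_eq => //.
by apply: (@filterS2 _ _ FF _ _ _ _ uv uw) => x -> /(_ I).
Qed.

End continuous_representatives.

(** * Lowering the order of differentiability *)

Section lower_order.
Variables (R : realType) (n : nat) (s t p : R) (Om : set (Rn R n)).
Hypotheses (n0 : (0 < n)%N) (p1 : 1 <= p) (t0 : 0 < t) (ts : t < s) (s1 : s < 1).
Hypotheses (mO : measurable Om) (finO : (leb R n Om < +oo)%E).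

Let p0 : 0 < p. Proof. exact: lt_le_trans p1. Qed.
Let s0 : 0 < s. Proof. exact: lt_trans ts. Qed.
Let t01 : 0 < t < 1. Proof. by rewrite t0 (lt_trans ts). Qed.
Let m := fine (leb R n Om).
Let m0 : 0 <= m. Proof. exact: fine_ge0. Qed.
Let mE : leb R n Om = m%:E. Proof. by rewrite fineK// ge0_fin_numE. Qed.

(** The first term bounds the kernel when |x - y| <= rho, where the quotient of
the two kernels is |x - y|^((s - t) p); the second one when |x - y| > rho. *)
Lemma gkernel_split (f : 'rV[R]_n -> R) (rho : R) x y : 0 < rho ->
  gkernel t p f x y <= rho `^ ((s - t) * p) * gkernel s p f x y +
    (2 `^ p / rho `^ (n%:R + t * p) * `|f x| `^ p +
     2 `^ p / rho `^ (n%:R + t * p) * `|f y| `^ p).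
Proof.
move=> rho0; have B0 : 0 <= 2 `^ p / rho `^ (n%:R + t * p) by rewrite divr_ge0 ?powR_ge0.
have st0 : 0 <= (s - t) * p by rewrite mulr_ge0 ?(ltW p0)// subr_ge0 ltW.
have nt0 : 0 < n%:R + t * p by rewrite ltr_wpDl// mulr_gt0.
have a0 : 0 <= rho `^ ((s - t) * p) * gkernel s p f x y.
  by apply: mulr_ge0; [exact: powR_ge0|exact: gkernel_ge0].
have b0 : 0 <= 2 `^ p / rho `^ (n%:R + t * p) * `|f x| `^ p +
     2 `^ p / rho `^ (n%:R + t * p) * `|f y| `^ p.
  by apply: addr_ge0; apply: mulr_ge0 => //; exact: powR_ge0.
rewrite /gkernel in a0 *; set e := enorm (x - y) in a0 *.
have [E|ne] := eqVneq e 0.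
  apply: (@le_trans _ _ 0); last exact: addr_ge0.
  by rewrite (enorm_eq0 E) subrr normr0 powR0 ?(gt_eqF p0)// mul0r.
have e0 : 0 < e by rewrite lt_neqAle eq_sym ne enorm_ge0.
have [er|re] := leP e rho.
  apply: ler_wpDr => //.
  have -> : e `^ (n%:R + s * p) = e `^ ((s - t) * p) * e `^ (n%:R + t * p).
    rewrite -powRD; last by rewrite (gt_eqF e0) implybT.
    by congr (_ `^ _); ring.
  set P := _ `^ p; set es := e `^ ((s - t) * p); set et := e `^ _.
  have -> : rho `^ ((s - t) * p) * (P / (es * et)) =
    (P / et) * (rho `^ ((s - t) * p) / es) by rewrite invfM; ring.
  rewrite ler_peMr ?divr_ge0 ?powR_ge0// ler_pdivlMr ?powR_gt0// mul1r.
  by apply: ge0_ler_powR; rewrite ?nnegrE ?(ltW e0) ?(ltW rho0).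
apply: ler_wpDl => //.
rewrite -mulrDr [leRHS]mulrAC; apply: ler_pM; [exact: powR_ge0|by rewrite invr_ge0 powR_ge0| |].
  apply: le_trans (powRD_le (ltW p0) (normr_ge0 _) (normr_ge0 _)).
  apply: ge0_ler_powR; rewrite ?nnegrE ?(ltW p0)//; exact: ler_normB.
rewrite lef_pV2 ?posrE ?powR_gt0//.
by apply: ge0_ler_powR; rewrite ?nnegrE ?(ltW e0) ?(ltW rho0) ?(ltW nt0) ?(ltW re).
Qed.

(** Pairs at distance at most rho are charged to the energy of order s, all the
others to the L^p norm. As t < s, the first coefficient is small with rho; for
that rho, the second term is small with the L^p norm. *)
Lemma genergy_compare (f : Rn R n -> R) (rho l : R) : 0 < rho ->
  measurable_fun setT f -> (Lpow (leb R n) Om p f <= l%:E)%E ->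
  (genergy t p Om f <= (rho `^ ((s - t) * p))%:E * genergy s p setT f +
     (2 * (2 `^ p / rho `^ (n%:R + t * p)) * m * l)%:E)%E.
Proof.
move=> rho0 mf fl; set B := 2 `^ p / _; set a := rho `^ _.
have B0 : 0 <= B by rewrite divr_ge0 ?powR_ge0.
have a0 : 0 <= a by exact: powR_ge0.
have mfO : measurable_fun Om f by exact: measurable_funTS.
pose G (y : Rn R n) := (\int[leb R n]_(x in Om) (gkernel s p f x y)%:E)%E.
have mG : measurable_fun setT G by exact: measurable_energy_density.
have G0 y : (0 <= G y)%E.
  by apply: integral_ge0 => x _; rewrite lee_fin gkernel_ge0.
have mk y : measurable_fun Om (fun x => (gkernel s p f x y)%:E).
  by apply: measurable_funTS; exact: measurable_gkernelx.
have mp : measurable_fun Om (fun x => (B * `|f x| `^ p)%:E).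
  apply/measurable_EFinP; apply: measurable_funM; first exact: measurable_cst.
  by apply/measurable_EFinP; exact: measurable_Lpow_fun.
have p_ge0 x : (0 <= (B * `|f x| `^ p)%:E)%E by rewrite lee_fin mulr_ge0// powR_ge0.
have inner y : (\int[leb R n]_(x in Om) (gkernel t p f x y)%:E <=
    a%:E * G y + ((B * l)%:E + m%:E * (B * `|f y| `^ p)%:E))%E.
  apply: (@le_trans _ _ (\int[leb R n]_(x in Om) (a%:E * (gkernel s p f x y)%:E +
      ((B * `|f x| `^ p)%:E + cst (B * `|f y| `^ p)%:E x)))%E).
    apply: ge0_le_integral.
    - exact: mO.
    - by move=> x _; rewrite lee_fin gkernel_ge0.
    - by apply: measurable_funTS; exact: measurable_gkernelx.
    - apply: emeasurable_funD; first exact: measurable_funeM.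
      by apply: emeasurable_funD; [exact: mp|exact: measurable_cst].
    - by move=> x _; rewrite -EFinM /= -!EFinD lee_fin; exact: gkernel_split.
  rewrite ge0_integralD; last first.
  - by apply: emeasurable_funD; [exact: mp|exact: measurable_cst].
  - by move=> x _; apply: adde_ge0; exact: p_ge0.
  - exact: measurable_funeM.
  - by move=> x _; rewrite -EFinM lee_fin mulr_ge0// gkernel_ge0.
  - exact: mO.
  apply: leeD.
    rewrite ge0_integralZl_EFin//; first by move=> x _; rewrite lee_fin gkernel_ge0.
  rewrite ge0_integralD; last first.
  - exact: measurable_cst.
  - by move=> x _; exact: p_ge0.
  - exact: mp.
  - by move=> x _; exact: p_ge0.
  - exact: mO.
  rewrite (integral_cst _ mO) mE muleC; apply: leeD => //.
  rewrite integralZ_Lpow// [leRHS]EFinM; apply: lee_wpmul2l => //.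
have mG' : measurable_fun Om G by exact: measurable_funTS.
have B_l : 0 <= l by rewrite -lee_fin; apply: le_trans fl; exact: Lpow_ge0.
have mmp : measurable_fun Om (fun y => m%:E * (B * `|f y| `^ p)%:E)%E.
  exact: measurable_funeM.
have mp_ge0 y : (0 <= m%:E * (B * `|f y| `^ p)%:E)%E by rewrite mule_ge0.
have Bl_ge0 : (0 <= (B * l)%:E)%E by rewrite lee_fin mulr_ge0.
have maG : measurable_fun Om (fun y => a%:E * G y)%E by exact: measurable_funeM.
have aG_ge0 y : (0 <= a%:E * G y)%E by rewrite mule_ge0.
have mrest : measurable_fun Om (fun y => cst (B * l)%:E y + m%:E * (B * `|f y| `^ p)%:E)%E.
  by apply: emeasurable_funD; [exact: measurable_cst|exact: mmp].
have rest_ge0 y : (0 <= cst (B * l)%:E y + m%:E * (B * `|f y| `^ p)%:E)%E.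
  exact: adde_ge0.
apply: (@le_trans _ _ (\int[leb R n]_(y in Om)
    (a%:E * G y + (cst (B * l)%:E y + m%:E * (B * `|f y| `^ p)%:E)))%E).
  apply: ge0_le_integral.
  - exact: mO.
  - by move=> y _; apply: integral_ge0 => x _; rewrite lee_fin gkernel_ge0.
  - by apply: measurable_funTS; exact: measurable_energy_density.
  - by apply: emeasurable_funD; [exact: maG|exact: mrest].
  - by move=> y _; exact: inner.
rewrite ge0_integralD; last first.
- exact: mrest.
- by move=> y _; exact: rest_ge0.
- exact: maG.
- by move=> y _; exact: aG_ge0.
- exact: mO.
apply: leeD.
  rewrite ge0_integralZl_EFin; last first.
  - exact: a0.
  - exact: mG'.
  - by move=> y _; exact: G0.
  - exact: mO.
  apply: lee_wpmul2l; first by rewrite lee_fin.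
  exact: (genergy_subset s p mO (@measurableT _ (Rn R n)) (@subsetT _ Om) mf).
rewrite ge0_integralD; last first.
- exact: mmp.
- by move=> y _; exact: mp_ge0.
- exact: measurable_cst.
- by move=> y _; exact: Bl_ge0.
- exact: mO.
rewrite (integral_cst _ mO) mE ge0_integralZl_EFin; last first.
- exact: m0.
- exact: mp.
- by move=> y _; exact: p_ge0.
- exact: mO.
rewrite integralZ_Lpow//.
have -> : (2 * B * m * l)%:E = ((B * l)%:E * m%:E + m%:E * (B%:E * l%:E))%E.
  by rewrite -!EFinM -EFinD; congr EFin; ring.
apply: leeD => //; apply: lee_wpmul2l => //; apply: lee_wpmul2l => //.
Qed.

Lemma genergy_eq (r : R) (E : set (Rn R n)) (u v : 'rV[R]_n -> R) :
  (forall x, E x -> u x = v x) -> genergy r p E u = genergy r p E v.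
Proof.
move=> uv; apply: eq_integral => y /set_mem Ey; apply: eq_integral => x /set_mem Ex.
by rewrite /gkernel !uv.
Qed.

Lemma measurable_patch (u : Rn R n -> R) : measurable_fun setT u ->
  measurable_fun setT (u \_ Om).
Proof.
by move=> mu_; apply/(measurable_restrictT _ mO); exact: measurable_funTS.
Qed.

Lemma Wsp_restrict_carrier (H : R) (u : 'rV[R]_n -> R) : 0 <= H ->
  energy_bounded s p H u -> fcarrier (Wsp t p Om) (u \_ Om).
Proof.
move=> H0 [mu_ uL uG].
apply/(Wsp_carrierP p1 t01 mO); split.
- apply/(Lp_carrierP _ p1); split.
  + by apply/funext => x; rewrite !patchE; case: ifP => // ->.
  + exact: measurable_patch.
  + rewrite Lpow_patch//; apply: le_lt_trans (Lpow_setT_le mO p mu_) _.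
    by apply: le_lt_trans uL _; exact: ltry.
- exact: measurable_patch.
- rewrite (@genergy_eq t Om (u \_ Om) u); last by move=> x Ox; rewrite patchE mem_set.
  have uL' : (Lpow (leb R n) Om p u <= H%:E)%E.
    by apply: le_trans (Lpow_setT_le mO p mu_) _.
  apply: le_lt_trans (genergy_compare ltr01 mu_ uL') _.
  apply: lte_add_pinfty; last exact: ltry.
  apply: lte_mul_pinfty; rewrite ?lee_fin ?powR_ge0//.
  by apply: le_lt_trans uG _; exact: ltry.
Qed.

(** On a set of bounded energy of order s, functions close enough in L^p(Om) are
close in W^{t,p}(Om), so a colouring for L^p is good enough. *)
Lemma Wsp_colouring (H e : R) : 0 <= H -> 0 < e ->
  finitely_coloured (@energy_bounded R n s p H)
    (fun u w => (fnorm (Wsp t p Om) (u \_ Om \- w \_ Om)%R <= e%:E)%E).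
Proof.
move=> H0 e0.
have e20 : 0 < e / 2 by rewrite divr_gt0.
have tt0 : 0 < t * (1 - t) by have /andP[? ?] := t01; rewrite mulr_gt0// subr_gt0.
(* c1 is the energy for which the seminorm is e/2. Z bounds the energy of order s
   of a difference, and rho makes its contribution at most c1/2. *)
pose c1 := (e / 2) `^ p / (t * (1 - t)).
have c10 : 0 < c1 by rewrite divr_gt0// powR_gt0.
pose Z := 2 `^ p * (H + H) + 1.
have Z0 : 0 < Z by rewrite ltr_wpDl// mulr_ge0 ?powR_ge0// addr_ge0.
have stp0 : 0 < (s - t) * p by rewrite mulr_gt0// subr_gt0.
have q0 : 0 < c1 / 2 / Z by apply: divr_gt0 => //; exact: divr_gt0.
pose rho := (c1 / 2 / Z) `^ ((s - t) * p)^-1.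
have rho0 : 0 < rho by exact: powR_gt0.
have rhoE : rho `^ ((s - t) * p) = c1 / 2 / Z.
  by rewrite /rho -powRrM mulVf ?gt_eqF// powRr1// ltW.
pose B := 2 * (2 `^ p / rho `^ (n%:R + t * p)) * m.
have B0 : 0 <= B.
  apply: mulr_ge0 => //; apply: mulr_ge0 => //.
  by apply: divr_ge0; exact: powR_ge0.
pose d := Num.min ((e / 2) `^ p) (c1 / 2 / (B + 1)).
have B10 : 0 < B + 1 by rewrite ltr_wpDl.
have d0 : 0 < d.
  by rewrite lt_min; apply/andP; split; [exact: powR_gt0|apply: divr_gt0 => //; exact: divr_gt0].
have cond : n%:R * (Num.max p p - p) < s * p * Num.max p p.
  rewrite maxxx subrr mulr0; apply: mulr_gt0 => //; exact: mulr_gt0.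
have col := Lq_colouring n0 s0 p0 H0 mO finO p0 cond d0.
apply: finitely_colouredW col => u w [mu_ uL uG] [mw wL wG] uw.
have mB : measurable_fun setT ((u \- w) : Rn R n -> R).
  exact: (measurable_funB mu_ mw).
have mP : measurable_fun setT ((u \_ Om \- w \_ Om) : Rn R n -> R).
  exact: (measurable_funB (measurable_patch mu_) (measurable_patch mw)).
have pE : (u \_ Om \- w \_ Om)%R = (u \- w)%R \_ Om.
  by apply/funext => x /=; rewrite !patchE; case: ifP => // _; rewrite subrr.
rewrite (Wsp_fnorm p Om t01) [e in leRHS]splitr EFinD; apply: leeD.
  apply/(Lnorm_leP _ _ p0 (ltW e20)).
  rewrite pE Lpow_patch//; apply: le_trans uw _.
  by rewrite lee_fin ge_min lexx.
apply/(gagliardo_leP p1 t01 mO (ltW e20) mP).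
rewrite (@genergy_eq t Om _ (u \- w)); last by move=> x Ox /=; rewrite !patchE mem_set.
apply: le_trans (genergy_compare rho0 mB uw) _; rewrite rhoE.
have uwG : (genergy s p setT (u \- w)%R <= Z%:E)%E.
  have tri := @genergy_triangle R n s p setT p1 (@measurableT _ (Rn R n)) _ _ _ mB mu_ mw.
  apply: (le_trans (tri _)).
    move=> x y /=; have -> : u x - w x - (u y - w y) = (u x - u y) - (w x - w y) by ring.
    exact: ler_normB.
  rewrite /Z; apply: (@le_trans _ _ ((2 `^ p)%:E * (H%:E + H%:E))%E).
    by apply: lee_wpmul2l; [rewrite lee_fin powR_ge0|apply: leeD; [exact: uG|exact: wG]].
  by rewrite -EFinD -EFinM lee_fin lerDl.
rewrite -/c1 [leRHS](_ : _ = (c1 / 2)%:E + (c1 / 2)%:E)%E; last first.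
  by rewrite -EFinD -splitr.
apply: leeD.
  apply: (@le_trans _ _ ((c1 / 2 / Z)%:E * Z%:E)%E).
    by apply: lee_wpmul2l; [rewrite lee_fin ltW|exact: uwG].
  by rewrite -EFinM lee_fin divfK// gt_eqF.
rewrite lee_fin -/B; apply: (@le_trans _ _ (B * (c1 / 2 / (B + 1)))).
  by rewrite ler_wpM2l// ge_min lexx orbT.
have c20 : 0 <= c1 / 2 by apply: divr_ge0 => //; exact: ltW.
by rewrite mulrA ler_pdivrMr// mulrC ler_wpM2l// lerDl.
Qed.

End lower_order.

(** * The compact embeddings *)

(** A preimage is chosen for each element of the image, and lends it its
colour. *)
Lemma finitely_coloured_image (V W : Type) (A : set V) (T : V -> W)
    (small : W -> W -> Prop) :
  finitely_coloured A (fun v w => small (T v) (T w)) ->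
  finitely_coloured (T @` A) small.
Proof.
move=> [I [phi phiP]].
have [->|[f0 A0]] : A = set0 \/ A !=set0 by have [->|/set0P] := eqVneq A set0; [left|right].
  by exists unit, (fun=> tt) => f g [].
have /choice[g gP] (f : W) : exists v, (T @` A) f -> A v /\ T v = f.
  have [[v Av <-]|nf] := pselect ((T @` A) f); first by exists v.
  by exists f0.
exists I, (phi \o g) => f h /gP[Af Tf] /gP[Ah Th] fh.
by rewrite -Tf -Th; exact: phiP.
Qed.

Lemma compact_linear_operator_colouring (U : Type) (R : realType)
    (X Y : normed_fspace U R) (T : (U -> R) -> (U -> R)) :
  seminormed_fspace Y -> complete_fspace Y ->
  (forall u, fcarrier X u -> fcarrier Y (T u)) ->
  (forall (a : R) u v, fcarrier X u -> fcarrier X v ->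
    T (a \*o u \+ v) = a \*o T u \+ T v) ->
  (forall A, A `<=` fcarrier X -> norm_bounded X A -> forall e : R, 0 < e ->
     finitely_coloured A (fun u w => (fnorm Y (T u \- T w)%R <= e%:E)%E)) ->
  compact_linear_operator X Y T.
Proof.
move=> sY cY XY linT col; split => // A AX Abd.
apply: relatively_compact_colouring => //.
  by move=> _ [u /AX uX <-]; exact: XY.
by move=> e e0; apply: finitely_coloured_image; exact: col.
Qed.

Section embeddings.
Variables (R : realType) (n : nat) (p s : R).
Hypotheses (n0 : (0 < n)%N) (p1 : 1 <= p) (s01 : 0 < s < 1).

Let p0 : 0 < p. Proof. exact: lt_le_trans p1. Qed.
Let s0 : 0 < s. Proof. by have /andP[] := s01. Qed.
Let mT : measurable [set: Rn R n]. Proof. exact: measurableT. Qed.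

Lemma norm_bounded_energy (A : set ('rV[R]_n -> R)) :
  A `<=` fcarrier (Wsp s p setT) -> norm_bounded (Wsp s p setT) A ->
  exists2 H, 0 <= H & A `<=` energy_bounded s p H.
Proof.
move=> AX [M AM].
pose c := `|M| `^ p / (s * (1 - s)).
have tt0 : 0 < s * (1 - s) by have /andP[? ?] := s01; rewrite mulr_gt0// subr_gt0.
have c0 : 0 <= c by rewrite divr_ge0 ?powR_ge0// ltW.
exists (`|M| `^ p + c); first by rewrite addr_ge0// powR_ge0.
move=> u Au; have /(Wsp_carrierP p1 s01 mT)[_ mu_ _] := AX u Au.
have uM : (fnorm (Wsp s p setT) u <= `|M|%:E)%E.
  by apply: le_trans (AM u Au) _; rewrite lee_fin ler_norm.
rewrite (Wsp_fnorm p setT s01) in uM.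
split => //.
- apply: (@le_trans _ _ (`|M| `^ p)%:E); last by rewrite lee_fin lerDl.
  apply/(Lnorm_leP _ _ p0 (normr_ge0 M)); apply: le_trans uM.
  by rewrite leeDl// gagliardo_ge0.
- apply: (@le_trans _ _ c%:E); last by rewrite lee_fin lerDr powR_ge0.
  apply/(gagliardo_leP p1 s01 mT (normr_ge0 M) mu_); apply: le_trans uM.
  by rewrite leeDr//; exact: Lnorm_ge0.
Qed.

Lemma carrier_energy (u : 'rV[R]_n -> R) : fcarrier (Wsp s p setT) u ->
  exists2 H, 0 <= H & energy_bounded s p H u.
Proof.
move=> uX; have /(Wsp_carrierP p1 s01 mT)[/(Lp_carrierP _ p1)[_ _ uL] mu_ uG] := uX.
have L0 := Lpow_ge0 (leb R n) setT p u; have G0 := genergy_ge0 s p setT u.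
exists (fine (Lpow (leb R n) setT p u) + fine (genergy s p setT u)).
  by rewrite addr_ge0// fine_ge0.
split => //.
- by rewrite -[leLHS]fineK ?ge0_fin_numE// lee_fin lerDl fine_ge0.
- by rewrite -[leLHS]fineK ?ge0_fin_numE// lee_fin lerDr fine_ge0.
Qed.

Lemma patch_linear (E : set 'rV[R]_n) (a : R) (u v : 'rV[R]_n -> R) :
  (a \*o u \+ v) \_ E = a \*o (u \_ E) \+ (v \_ E).
Proof.
apply/funext => x; rewrite /= !patchE; case: ifP => // _ /=.
by rewrite mulr0 addr0.
Qed.

Section Omega.
Variable Om : set (Rn R n).
Hypotheses (mO : measurable Om) (finO : (leb R n Om < +oo)%E).

(** The condition reads n (q - p) < s p q when q >= p, that is,
q < n p / (n - s p) if s p < n, and nothing if s p >= n; it always holds when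
q <= p. *)
Lemma Lq_embedding (q : R) : 1 <= q ->
  n%:R * (Num.max q p - p) < s * p * Num.max q p ->
  compactly_embedded_on Om (Wsp s p [set: 'rV[R]_n]) (Lp q Om).
Proof.
move=> q1 cond; have q0 : 0 < q by exact: lt_le_trans q1.
apply: compact_linear_operator_colouring.
- exact: seminormed_Lp.
- exact: complete_Lp.
- move=> u /carrier_energy[H H0 uH]; have [mu_ _ _] := uH.
  have [C CP] := Lpow_finite n0 s0 p0 H0 mO finO q0 cond.
  apply/(Lp_carrierP _ q1); split.
  + by apply/funext => x; rewrite !patchE; case: ifP => // ->.
  + exact: measurable_patch.
  + by rewrite Lpow_patch//; apply: le_lt_trans (CP u uH) _; exact: ltry.
- by move=> a u v _ _; exact: patch_linear.
move=> A AX Abd e e0; have [H H0 AH] := norm_bounded_energy AX Abd.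
have [I [phi phiP]] := Lq_colouring n0 s0 p0 H0 mO finO q0 cond (powR_gt0 q e0).
exists I, phi => u w /AH uH /AH wH uw; have [mu_ _ _] := uH; have [mw _ _] := wH.
apply/(Lnorm_leP _ _ q0 (ltW e0)).
have -> : (u \_ Om \- w \_ Om)%R = (u \- w)%R \_ Om.
  by apply/funext => x /=; rewrite !patchE; case: ifP => // _; rewrite subrr.
by rewrite Lpow_patch//; exact: phiP.
Qed.

Lemma lower_order_embedding (t : R) : 0 <= t -> t < s ->
  compactly_embedded_on Om (Wsp s p [set: 'rV[R]_n]) (Wsp t p Om).
Proof.
rewrite le_eqVlt => /predU1P[<- _|t0 ts].
  rewrite /(Wsp 0) eqxx; apply: Lq_embedding => //.
  by rewrite maxxx subrr mulr0; apply: mulr_gt0 => //; exact: mulr_gt0.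
have s1 : s < 1 by have /andP[] := s01.
have t01 : 0 < t < 1 by rewrite t0 (lt_trans ts).
apply: compact_linear_operator_colouring.
- exact: seminormed_Wsp.
- exact: complete_Wsp.
- move=> u /carrier_energy[H H0 uH].
  exact: Wsp_restrict_carrier H0 uH.
- by move=> a u v _ _; exact: patch_linear.
move=> A AX Abd e e0; have [H H0 AH] := norm_bounded_energy AX Abd.
have [I [phi phiP]] := Wsp_colouring n0 p1 t0 ts s1 mO finO H0 e0.
by exists I, phi => u w /AH uH /AH wH uw; exact: phiP.
Qed.

End Omega.

Section hoelder.
Hypothesis nsp : n%:R < s * p.
Let ga := s - n%:R / p.
Let ga0 : 0 < ga. Proof. by rewrite subr_gt0 ltr_pdivrMr. Qed.

Lemma continuous_rep_hoelder (H : R) : 0 <= H -> exists2 C, 0 <= C &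
  forall u : 'rV[R]_n -> R, energy_bounded s p H u ->
    is_continuous_rep u (continuous_rep u) /\ hoelder_class C ga (continuous_rep u).
Proof.
move=> H0; have [C C0 CP] := hoelder_representative n0 s0 p0 H0 nsp.
exists C => // u /CP[v [uv v1 v2]].
have vC : @hoelder_class R n C ga v by [].
have cv := hoelder_class_continuous C0 ga0 vC.
rewrite (continuous_rep_eq cv uv); split => //; split => //.
by apply: (@filterS _ _ (ae_filter_ringOfSetsType (leb R n)) _ _ _ uv) => x ux _.
Qed.

Lemma hoelder_embedding (K : set 'rV[R]_n) (b : R) : compact K ->
  0 <= b -> b < ga ->
  compactly_embedded_C_on K (Wsp s p [set: 'rV[R]_n]) (hoelder_space b K).
Proof.
move=> cK b0 bga.
have rep (u : 'rV[R]_n -> R) : fcarrier (Wsp s p setT) u -> is_continuous_rep u (continuous_rep u).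
  move=> /carrier_energy[H H0 uH]; have [C _ CP] := continuous_rep_hoelder H0.
  by have [] := CP u uH.
split; first by move=> u uX; exists (continuous_rep u); exact: rep.
apply: compact_linear_operator_colouring.
- exact: seminormed_hoelder.
- exact: complete_hoelder.
- move=> u /carrier_energy[H H0 uH]; have [C C0 CP] := continuous_rep_hoelder H0.
  by have [_ vC] := CP u uH; exact: hoelder_class_carrier C0 ga0 b0 bga K _ vC.
- move=> a u v /rep[cu uu] /rep[cv vv]; rewrite -patch_linear; congr (_ \_ K).
  apply: continuous_rep_eq.
    move=> x; apply: continuousD; last exact: cv.
    by apply: continuousM; [exact: cst_continuous|exact: cu].
  have FF := ae_filter_ringOfSetsType (leb R n).
  apply: (@filterS2 _ _ FF _ _ _ _ uu vv) => x /(_ I) ux /(_ I) vx /=.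
  by rewrite ux vx.
move=> A AX Abd e e0; have [H H0 AH] := norm_bounded_energy AX Abd.
have [C C0 CP] := continuous_rep_hoelder H0.
have AC u : A u -> hoelder_class C ga (continuous_rep u) by move=> /AH /CP[].
exact: finitely_coloured_preimage AC (hoelder_colouring C0 ga0 b0 bga cK e0).
Qed.

End hoelder.
End embeddings.

Theorem theorem2p1 (R : realType) (n : nat) (p s : R) (Omega K : set 'rV[R]_n) :
  (1 <= n)%N -> 1 <= p -> 0 < s < 1 ->
  measurable (Omega : set (Rn R n)) -> (leb R n Omega < +oo)%E ->
  compact K ->
  [/\ s * p < n%:R ->
        forall q : R, 1 <= q -> q < n%:R * p / (n%:R - s * p) ->
          compactly_embedded_on Omega (Wsp s p [set: 'rV[R]_n]) (Lp q Omega),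
      s * p = n%:R ->
        forall q : R, 1 <= q ->
          compactly_embedded_on Omega (Wsp s p [set: 'rV[R]_n]) (Lp q Omega),
      n%:R < s * p ->
        forall b : R, 0 <= b -> b < s - n%:R / p ->
          compactly_embedded_C_on K (Wsp s p [set: 'rV[R]_n])
            (hoelder_space b K)
    & bounded_lipschitz_domain Omega ->
        forall t : R, 0 <= t -> t < s ->
          compactly_embedded_on Omega (Wsp s p [set: 'rV[R]_n]) (Wsp t p Omega)].
Proof.
move=> n0 p1 s01 mO finO cK.
have p0 : 0 < p by exact: lt_le_trans p1.
have s0 : 0 < s by have /andP[] := s01.
have spp : 0 < s * p * p by apply: mulr_gt0 => //; exact: mulr_gt0.
split.
- move=> spn q q1 qlt; apply: Lq_embedding => //.
  case: (leP q p) => qp; first by rewrite subrr mulr0.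
  move: qlt; rewrite ltr_pdivlMr ?subr_gt0//; lra.
- move=> spn q q1; apply: Lq_embedding => //.
  case: (leP q p) => qp; first by rewrite subrr mulr0.
  by rewrite spn ltr_pM2l ?ltr0n// ltrBlDr ltrDl.
- by move=> nsp b b0 bga; exact: hoelder_embedding.
- by move=> _ t t0 ts; exact: lower_order_embedding.
Qed.
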